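(* Let $d=2$, $E\subset[1,2]$, $0\le\beta<1$ and $\beta\le\gamma\le1$. Suppose that $\sup_{0<\delta<1}\delta^\beta N(E,\delta)<\infty$ and $\sup_{0<\delta<1}\sup_{|I|\ge\delta}(\delta/|I|)^\gamma N(E\cap I,\delta)<\infty$ (the inner supremum over intervals $I$). (i) If $2\gamma<\beta+1$, then $\Delta(\beta)\subset\mathcal{T}^{rad}_E$. (ii) If $2\gamma\ge\beta+1$, then $\mathcal{Q}(\beta,\gamma)\setminus\{Q_2(2\gamma-1)\}\subset\mathcal{T}^{rad}_E$. Moreover, $M_E$ is bounded from $L^{p,1}_{rad}(\mathbb{R}^2)$ to $L^{q,\infty}(\mathbb{R}^2)$ when $(1/p,1/q)=Q_2(2\gamma-1)$.
   Context: $M_Ef(x)=\sup_{t\in E}\left|\int_{\mathbb{S}^{1}}f(x-ty)\,d\sigma(y)\right|$, $\sigma$ normalized arc-length on $\mathbb{S}^1$. $N(F,a)$ is the minimal number of intervals of length $a$ covering $F$. $\mathcal{T}^{rad}_E=\{(1/p,1/q)\in[0,1]^2: M_E$ bounded $L^p_{rad}(\mathbb{R}^2)\to L^q(\mathbb{R}^2)\}$ ($L^p_{rad}$ radial $L^p$ functions, $1/\infty=0$); $L^{p,1}_{rad}$ are radial functions in the Lorentz space $L^{p,1}$. $O=(0,0)$, $Q_1(b)=(\frac1{1+b},\frac1{1+b})$, $Q_2(b)=(\frac2{3+b},\frac1{3+b})$; $\Delta(\beta)$ is the closed triangle $O,Q_1(\beta),Q_2(\beta)$. For $1\le\beta+1\le2\gamma\le2$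 and $\beta<1$: $\theta=\frac{1-\beta}{2(\gamma-\beta)}$, $Q_3(\beta,\gamma)=\big(\frac{2-\beta(1-\theta)}{2(1+\gamma\theta)},\frac{1}{2(1+\gamma\theta)}\big)$, and $\mathcal{Q}(\beta,\gamma)$ is the closed quadrilateral with vertices $O,Q_1(\beta),Q_3(\beta,\gamma),Q_2(2\gamma-1)$. *)

(* Defs.v *)
From HB Require Import structures.
From mathcomp Require Import all_boot all_order all_algebra.
From mathcomp Require Import all_classical all_reals all_analysis.
From mathcomp Require Import measurable_realfun.
Set Implicit Arguments. Unset Strict Implicit. Unset Printing Implicit Defensive.
Import Order.TTheory GRing.Theory Num.Theory.
Import numFieldNormedType.Exports.
Local Open Scope classical_set_scope.
Local Open Scope ring_scope.

Section Defs.
Variable R : realType.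

Definition leb2 := ((@lebesgue_measure R) \x (@lebesgue_measure R))%E.

(* exponent p in [1, +oo] encoded by its reciprocal a = 1/p in [0,1] *)
Definition expo (a : R) : \bar R := if a == 0 then +oo%E else (a^-1)%:E.

(* circular mean: int_{S^1} f(x - t y) dsigma(y), sigma normalized arc length,
   written with the arc-length parametrization y = (cos th, sin th) *)
Definition circ_avg (f : R * R -> R) (x : R * R) (t : R) : \bar R :=
  ((2 * pi)^-1)%:E *
  (\int[@lebesgue_measure R]_(th in `[0%R, (2 * pi)%R]%classic)
      (f (x.1 - t * cos th, x.2 - t * sin th))%:E)%E.

Definition MaxE (E : set R) (f : R * R -> R) (x : R * R) : \bar R :=
  ereal_sup [set `|circ_avg f x t|%E | t in E].

Definition radial (f : R * R -> R) : Prop :=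
  forall x y : R * R, x.1 ^+ 2 + x.2 ^+ 2 = y.1 ^+ 2 + y.2 ^+ 2 -> f x = f y.

Definition covered_by (F : set R) (a : R) (n : nat) : Prop :=
  exists c : 'I_n -> R, F `<=` \bigcup_(i in [set: 'I_n]) `[c i, c i + a]%classic.

Definition covnum (F : set R) (a : R) : \bar R :=
  ereal_inf [set (n%:R)%:E | n in covered_by F a].

(* M_E : L^p_rad -> L^q bounded, with (u, v) = (1/p, 1/q).  Since M_E f need
   not be measurable, its L^q norm is controlled through a measurable
   a.e. majorant (outer norm). *)
Definition bounded_rad (E : set R) (u v : R) : Prop :=
  exists C : R, forall f : R * R -> R,
    measurable_fun [set: R * R] f -> radial f ->
    (Lnorm leb2 (expo u) (EFin \o f) < +oo)%E ->
    exists g : R * R -> \bar R, measurable_fun [set: R * R] g /\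
      {ae leb2, forall x, (MaxE E f x <= g x)%E} /\
      (Lnorm leb2 (expo v) g <= C%:E * Lnorm leb2 (expo u) (EFin \o f))%E.

Definition T_rad (E : set R) : set (R * R) :=
  [set uv | 0 <= uv.1 <= 1 /\ 0 <= uv.2 <= 1 /\ bounded_rad E uv.1 uv.2].

Definition distrib (f : R * R -> \bar R) (l : R) : \bar R :=
  leb2 [set x | (l%:E < `|f x|)%E].

Definition lorentz_p1 (p : R) (f : R * R -> \bar R) : \bar R :=
  (p%:E * \int[@lebesgue_measure R]_(l in [set l : R | (0 < l)%R])
                 (distrib f l `^ p^-1))%E.

Definition weak_norm (q : R) (g : R * R -> \bar R) : \bar R :=
  ereal_sup [set (l%:E * distrib g l `^ q^-1)%E | l in [set l : R | (0 < l)%R]].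

Definition restricted_weak_rad (E : set R) (p q : R) : Prop :=
  exists C : R, forall f : R * R -> R,
    measurable_fun [set: R * R] f -> radial f ->
    (lorentz_p1 p (EFin \o f) < +oo)%E ->
    exists g : R * R -> \bar R, measurable_fun [set: R * R] g /\
      {ae leb2, forall x, (MaxE E f x <= g x)%E} /\
      (weak_norm q g <= C%:E * lorentz_p1 p (EFin \o f))%E.

Definition ptO : R * R := (0, 0).
Definition Q1 (b : R) : R * R := ((1 + b)^-1, (1 + b)^-1).
Definition Q2 (b : R) : R * R := (2 / (3 + b), 1 / (3 + b)).
Definition theta (b g : R) : R := (1 - b) / (2 * (g - b)).
Definition Q3 (b g : R) : R * R :=
  ((2 - b * (1 - theta b g)) / (2 * (1 + g * theta b g)),
   1 / (2 * (1 + g * theta b g))).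

Definition triangle (A B C : R * R) : set (R * R) :=
  [set P | exists l1 l2 l3 : R, [/\ 0 <= l1, 0 <= l2, 0 <= l3,
     l1 + l2 + l3 = 1 &
     P = (l1 * A.1 + l2 * B.1 + l3 * C.1, l1 * A.2 + l2 * B.2 + l3 * C.2)]].

Definition Delta (b : R) : set (R * R) := triangle ptO (Q1 b) (Q2 b).

(* closed quadrilateral O, Q1(b), Q3(b,g), Q2(2g-1), as the fan of the two
   triangles from O *)
Definition Quad (b g : R) : set (R * R) :=
  triangle ptO (Q1 b) (Q3 b g) `|` triangle ptO (Q3 b g) (Q2 (2 * g - 1)).

End Defs.

(* Main.v *)
Require Import Defs.
From HB Require Import structures.
From mathcomp Require Import all_boot all_order all_algebra.
From mathcomp Require Import all_classical all_reals all_analysis.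
From mathcomp Require Import measurable_realfun ess_sup_inf.
From mathcomp Require Import ring lra.
Set Implicit Arguments. Unset Strict Implicit. Unset Printing Implicit Defensive.
Import Order.TTheory GRing.Theory Num.Theory.
Import numFieldNormedType.Exports.
Local Open Scope classical_set_scope.
Local Open Scope ring_scope.

(** A radial function is a function of one variable. By the law of cosines its mean over the circle
    of radius [t] about a point of norm [r] is an integral over an angle [phi] of its values at the
    distances [s] with [s^2 = r^2 + t^2 - 2 r t cos phi] ([circ_avg_le]). Write [u = 1/p], [v = 1/q]
    and cut the angle into shells [phi ~ exp(-l)]. On a shell, Hölder's inequality and a
    one-dimensional change of variables bound the piece by an explicit power times
    [(int |f|^p s ds)^u] over a short window of distances [s] ([piece_le]). The windows of all [t]
    in [E] lie in one set of pairs [(r, s)] described by a neighbourhood of [E]. This absorbs the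
    supremum over [t]; for fixed [s], the measure of the admissible [r] is then a matter of covering
    numbers of [E].

    There are two regimes. Near the diagonal ([|r - t| < 1/4], near side of the circle), with
    [|r - t| ~ exp(-j)], the Minkowski bound yields a convergent sum over [(j, l)] as soon as
    [2u - 1 <= (1 - beta) v], the edge through [Q1(beta)] and [Q2(beta)] ([piece_Q], [count_Q],
    [strong_Q]). Elsewhere, with [r ~ exp(-m)] and window length [exp(-k)], [k = m + 2l], two counts
    compete: [exp(beta k)] from the Minkowski bound and [exp(2 gamma l)] from the Assouad bound,
    because a small [r] confines [t] to an interval of length about [exp(-m)] ([piece_P],
    [count_P_beta], [count_P_gamma]). The logarithm of a contribution is at most a piecewise linear
    function on the cone [m, l >= 0]; its sign on the extreme rays gives the remaining edges
    [u <= 2v] and the line through [Q3] and [Q2(2 gamma - 1)] ([exponents]).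

    To sum the pieces, every one of them is dominated by the [v]-th power of a single weight [U(r)],
    the integral of [|f|^p s] against one positive kernel. Then an [L^1] to [L^1] bound for that
    kernel suffices ([kint_bound], [arc_bounded_of_pieces]). Inside the region all exponents decay.
    On a critical edge there is no decay along one ray; there each piece of [f] is split at height
    [exp(k u)] and estimated with exponents 1 and [1/v], which localizes [k] near [ln f(s) / u] and
    restores convergence, hence strong type on the edge ([piece_critical], [strong_P_critical]).

    There [f] is written as a superposition of indicators of its level sets. An indicator may be
    estimated at every nearby pair of exponents, and choosing among four pairs according to [(m, l)]
    gives decay in two independent directions, which is the restricted weak type bound
    ([integral_hterm_le], [weak_P], [weak_Q]). The vertex [O] is the bound on [L^infinity], where
    only null sets need care ([bounded_rad_O]). Finally, convexity places the triangle and the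
    quadrilateral inside the four half-planes ([admissible_triangle]). *)

(** * Comparison of nonnegative integrals *)

Section MonotoneIntegral.
Local Open Scope ereal_scope.

Import HBNNSimple.

(** The integral of a nonnegative function is a supremum over the simple functions below it, so the
    comparison holds for arbitrary integrands, measurable or not. *)
Lemma le_integral_ge0 d (T : measurableType d) (R : realType)
    (m : {measure set T -> \bar R}) (D : set T) (f1 f2 : T -> \bar R) :
  (forall x, D x -> 0 <= f1 x) -> (forall x, D x -> f1 x <= f2 x) ->
  \int[m]_(x in D) f1 x <= \int[m]_(x in D) f2 x.
Proof.
move=> f10 f12; rewrite !ge0_integralE//; last first.
  by move=> x Dx; exact: le_trans (f10 _ Dx) (f12 _ Dx).
rewrite ge_ereal_sup// => _ [h/= hf1] <-.
apply: le_ereal_sup_tmp; exists (sintegral m h) => //; exists h => // x.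
apply: le_trans (hf1 x) _; rewrite /patch; case: ifPn => //.
by rewrite inE => /f12.
Qed.

End MonotoneIntegral.

(** * Changes of variables through distance-expanding maps *)

Section Expansive.
Context {R : realType}.
Local Notation mu := (@lebesgue_measure R).
Implicit Types (D A : set R) (h : R -> R).

Definition expansive_on D h (c : R) :=
  forall x y, D x -> D y -> c * `|x - y| <= `|h x - h y|.

(** The preimage has diameter at most [(b - a) / c], so it sits in an interval of twice this length
    centred at any of its points; hence the factor 2. *)
Lemma expansive_preimage_itv D h c a b : 0 < c -> measurable D ->
  measurable_fun setT h -> expansive_on D h c -> a < b ->
  (mu (D `&` h @^-1` `]a, b[) <= (2 / c * (b - a))%:E)%E.
Proof.
move=> c0 mD mh exph ab.
have mp : measurable (D `&` h @^-1` `]a, b[).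
  by apply: measurableI => //; rewrite -[X in measurable X]setTI; exact: mh.
have [S0|/set0P[x0 [Dx0 hx0]]] := eqVneq (D `&` h @^-1` `]a, b[) set0.
  rewrite S0 measure0 lee_fin mulr_ge0 ?divr_ge0 ?ltW ?subr_gt0//.
set d := (b - a) / c.
have sub : D `&` h @^-1` `]a, b[ `<=` `[x0 - d, x0 + d]%classic.
  move=> x [Dx hx]; rewrite /= in_itv/= -ler_distl /d ler_pdivlMr//.
  rewrite mulrC (le_trans (exph _ _ Dx Dx0))//.
  move: hx hx0; rewrite /= !in_itv/= => /andP[h1 h2] /andP[h3 h4].
  rewrite ler_norml; apply/andP; split; lra.
have d0 : 0 < d by rewrite divr_gt0// subr_gt0.
apply: (@le_trans _ _ (mu `[x0 - d, x0 + d])).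
  by apply: le_measure => //; rewrite inE//; exact: measurable_itv.
rewrite (_ : mu `[x0 - d, x0 + d] = ((x0 + d) - (x0 - d))%:E).
  rewrite lee_fin /d; lra.
by rewrite lebesgue_measure_itv/= lte_fin ifT; [rewrite -EFinD|lra].
Qed.

(** Lebesgue measure is the infimum of total lengths of countable covers by open intervals, so the
    interval case is summed over an arbitrary cover. *)
Lemma expansive_preimage D A h c : 0 < c -> measurable D ->
  measurable_fun setT h -> expansive_on D h c -> measurable A ->
  (mu (D `&` h @^-1` A) <= (2 / c)%:E * mu A)%E.
Proof.
move=> c0 mD mh exph mA.
have pre_meas B : measurable B -> measurable (D `&` h @^-1` B).
  move=> mB; apply: measurableI => //.
  by rewrite -[X in measurable X]setTI; exact: mh.
have c20 : 0 < 2 / c by rewrite divr_gt0.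
rewrite -lee_pdivrMl//.
have -> : mu A = ((@wlength R idfun)^* A)%mu by [].
rewrite outer_measure_open_itv_cover.
apply: le_ereal_inf_tmp => /= _ [F [Fitv AF] <-].
have mF i : measurable (F i) by case: (Fitv i) => ab ->.
rewrite lee_pdivrMl// -nneseriesZl; last by move=> i _; exact: wlength_ge0.
apply: (@le_trans _ _ (\sum_(0 <= i <oo) mu (D `&` h @^-1` F i))%E); last first.
  apply: lee_nneseries => // i _.
  have [[a b] ->] := Fitv i; rewrite wlength_itv/=.
  case: ifPn => [|/negP]; rewrite lte_fin => ab.
    by rewrite -EFinD -EFinM; exact: expansive_preimage_itv.
  rewrite (_ : `]a, b[%classic = set0) ?preimage_set0 ?setI0 ?measure0 ?mule0//.
  by apply/seteqP; split => x//=; rewrite in_itv/= => /andP[xa xb]; exact: (ab (lt_trans xa xb)).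
have sub : D `&` h @^-1` A `<=` \bigcup_i (D `&` h @^-1` F i).
  by move=> x [Dx /AF[i _ Fi]]; exists i.
apply: (le_trans (le_measure mu _ _ sub)).
- by rewrite inE; exact: pre_meas.
- by rewrite inE; apply: bigcup_measurable => i _; exact: pre_meas.
apply: (@measure_sigma_subadditive _ _ _ mu) => //.
- by move=> i; exact: pre_meas.
- by apply: bigcup_measurable => i _; exact: pre_meas.
Qed.

(* A map expanding distances by the factor [c] pushes Lebesgue measure forward to
   a measure of density at most [2 / c]: this replaces every change of variables. *)
Lemma expansive_integral D B h c (G : R -> \bar R) : 0 < c ->
  measurable D -> measurable B -> measurable_fun setT h -> expansive_on D h c ->
  (forall x, D x -> B (h x)) ->
  measurable_fun setT G -> (forall x, 0 <= G x)%E ->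
  (\int[mu]_(x in D) G (h x) <= (2 / c)%:E * \int[mu]_(x in B) G x)%E.
Proof.
move=> c0 mD mB mh exph DB mG G0.
have c20 : 0 <= 2 / c by rewrite divr_ge0// ltW.
pose k : {nonneg R} := NngNum c20.
pose m1 : {measure set (measurableTypeR R) -> \bar R} := mrestr mu mD.
pose m2 : {measure set (measurableTypeR R) -> \bar R} := pushforward m1 (h : _ -> measurableTypeR R).
have mG' : measurable_fun setT (G \o h) by exact: measurableT_comp.
have mhB : measurable (h @^-1` B).
  by rewrite -[X in measurable X]setTI; exact: mh.
have -> : (\int[mu]_(x in D) G (h x) = \int[m1]_(x in D) G (h x))%E.
  by apply: eq_measure_integral => A mA AD; rewrite /= /mrestr setIidl.
apply: (@le_trans _ _ (\int[m1]_(x in h @^-1` B) (G \o h) x)%E).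
  apply: ge0_subset_integral => //; exact: measurable_funTS.
have -> : (\int[m1]_(x in h @^-1` B) (G \o h) x = \int[m2 mh]_(y in B) G y)%E.
  by rewrite ge0_integral_pushforward//; exact: measurable_funTS.
rewrite -[(2 / c)%:E]/(k%:num%:E) -ge0_integral_mscale//.
apply: ge0_le_measure_integral => // A mA.
rewrite /= /pushforward /mrestr /mscale/= setIC.
exact: expansive_preimage.
by apply: measurable_funTS.
Qed.
End Expansive.

(** * Polar coordinates up to constants, for functions of the norm *)

Section Polar.
Context {R : realType}.
Local Notation mu := (@lebesgue_measure R).

Lemma measurable_set_lt d (T : measurableType d) (f g : T -> R) :
  measurable_fun setT f -> measurable_fun setT g ->
  measurable [set x | f x < g x].
Proof.
move=> mf mg; rewrite -[X in measurable X]setTI.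
by apply: (@measurable_fun_bool _ _ _ (fun x => f x < g x) true _) => //; exact: measurable_fun_ltr.
Qed.

Lemma measurable_set_le d (T : measurableType d) (f g : T -> R) :
  measurable_fun setT f -> measurable_fun setT g ->
  measurable [set x | f x <= g x].
Proof.
move=> mf mg; rewrite -[X in measurable X]setTI.
by apply: (@measurable_fun_bool _ _ _ (fun x => f x <= g x) true _) => //; exact: measurable_fun_ler.
Qed.

Lemma integral_indicE d (T : measurableType d) (m : {measure set T -> \bar R})
    (D : set T) (f : T -> \bar R) :
  (\int[m]_(x in D) f x = \int[m]_x (f x * (\1_D x)%:E))%E.
Proof.
rewrite integral_mkcond; apply: eq_integral => x _; rewrite patchE indicE.
by case: ifPn => _; rewrite ?mule1 ?mule0.
Qed.

Lemma indic_iff T U (A : set T) (B : set U) x y :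
  (A x <-> B y) -> \1_A x = \1_B y :> R.
Proof. by move=> AB; rewrite !indicE; congr (nat_of_bool _)%:R; apply/idP/idP; rewrite !inE => /AB. Qed.

Lemma integral_indicR (D : set R) (f : R -> \bar R) :
  (\int[mu]_(x in D) f x = \int[mu]_x (f x * (\1_D x)%:E))%E.
Proof. exact: integral_indicE. Qed.

Lemma measurable_fun_indicM d (T : measurableType d) (D : set T) (f : T -> \bar R) :
  measurable D -> measurable_fun setT f ->
  measurable_fun setT (fun x => f x * (\1_D x)%:E)%E.
Proof.
move=> mD mf; apply: emeasurable_funM => //; apply/measurable_EFinP.
exact: measurable_indic.
Qed.

Lemma measurable_sqrt : measurable_fun setT (@Num.sqrt R).
Proof. by apply: continuous_measurable_fun => x; exact: sqrt_continuous. Qed.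

Definition enorm (x : R * R) : R := Num.sqrt (x.1 ^+ 2 + x.2 ^+ 2).

Lemma measurable_enorm : measurable_fun setT enorm.
Proof.
apply: measurableT_comp; first exact: measurable_sqrt.
apply: measurable_funD; apply: measurable_funX;
  [exact: measurable_fst|exact: measurable_snd].
Qed.

Lemma sqr_ltP (x y : R) : 0 <= y -> (x ^+ 2 < y ^+ 2 -> x < y).
Proof. by move=> y0; rewrite ltNge => /negP h; rewrite ltNge; apply/negP => yx; apply: h; rewrite ler_sqr ?nnegrE// (le_trans y0). Qed.

Lemma sqr_leP (x y : R) : 0 <= y -> (x ^+ 2 <= y ^+ 2 -> x <= y).
Proof. by move=> y0; rewrite leNgt => /negP h; rewrite leNgt; apply/negP => yx; apply: h; rewrite ltr_sqr ?nnegrE// ltW// (le_lt_trans y0). Qed.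

(** On the vertical line at abscissa [a], norm [s] is reached at ordinate [h s = sqrt (s^2 - a^2)].
    This map expands distances because [(h s - h s') (h s + h s') = (s - s') (s + s')] and
    [h s <= s]. *)
Lemma polar_inner_ge (G : R -> \bar R) (a : R) : 0 <= a ->
  measurable_fun setT G -> (forall x, 0 <= G x)%E ->
  (\int[mu]_(s in [set s | (a < s)%R]) G s <=
   2%:E * \int[mu]_(y in [set: R]) G (Num.sqrt (a ^+ 2 + y ^+ 2)))%E.
Proof.
move=> a0 mG G0.
pose h s := Num.sqrt (s ^+ 2 - a ^+ 2).
have mh : measurable_fun setT h.
  apply: measurableT_comp; first exact: measurable_sqrt.
  by apply: measurable_funB => //; exact: measurable_funX.
have mD : measurable [set s | (a < s)%R] by exact: measurable_set_lt.
have hsq s : a < s -> h s ^+ 2 = s ^+ 2 - a ^+ 2.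
  move=> as_; rewrite sqr_sqrtr// subr_ge0 ler_sqr ?nnegrE//; lra.
have ex : expansive_on [set s | (a < s)%R] h 1.
  move=> s s'; rewrite /= mul1r.
  wlog ss' : s s' / s' <= s.
    move=> hw as_ as'; have [/hw|/ltW/hw] := leP s' s; first exact.
    by rewrite distrC [X in _ -> _ <= X]distrC; apply.
  move=> as_ as'.
  have h0 := sqrtr_ge0 (s ^+ 2 - a ^+ 2); have h0' := sqrtr_ge0 (s' ^+ 2 - a ^+ 2).
  rewrite -/(h s) -/(h s') in h0 h0'.
  have e1 := hsq _ as_; have e2 := hsq _ as'.
  have b1 : h s <= s by apply: sqr_leP; nra.
  have b2 : h s' <= s' by apply: sqr_leP; nra.
  have key : (h s - h s') * (h s + h s') = (s - s') * (s + s') by rewrite -!subr_sqr e1 e2; ring.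
  have hh' : h s' <= h s by apply: sqr_leP => //; nra.
  rewrite !ger0_norm ?subr_ge0//.
  have [hp|hp] := ltP 0 (h s + h s'); last nra.
  rewrite -(ler_pM2r hp) key; nra.
have mG' : measurable_fun setT (fun y : R => G (Num.sqrt (a ^+ 2 + y ^+ 2))).
  apply: measurableT_comp => //; apply: measurableT_comp; first exact: measurable_sqrt.
  by apply: measurable_funD => //; exact: measurable_funX.
have := @expansive_integral R _ setT h 1 _ ltr01 mD measurableT mh ex (fun _ _ => I) mG' (fun _ => G0 _).
rewrite divr1; apply: le_trans.
rewrite le_eqVlt; apply/orP; left; apply/eqP; apply: eq_integral => s.
rewrite inE/= => as_; rewrite hsq// addrC subrK sqrtr_sqr ger0_norm//; lra.
Qed.

(** In this direction the map is [y |-> sqrt (a^2 + y^2)], which flattens near 0; on [|a| <= |y|] it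
    is at most [2 |y|], hence expands by [1/2] on each of the two half-lines. *)
Lemma polar_inner_le (G : R -> \bar R) (a : R) :
  measurable_fun setT G -> (forall x, 0 <= G x)%E ->
  (\int[mu]_(y in [set y | (`|a| <= `|y|)%R]) G (Num.sqrt (a ^+ 2 + y ^+ 2)) <=
   8%:E * \int[mu]_(s in [set s | (`|a| <= s)%R]) G s)%E.
Proof.
move=> mG G0.
pose h y := Num.sqrt (a ^+ 2 + y ^+ 2).
have mh : measurable_fun setT h.
  apply: measurableT_comp; first exact: measurable_sqrt.
  by apply: measurable_funD => //; exact: measurable_funX.
have mB : measurable [set s | (`|a| <= s)%R] by exact: measurable_set_le.
have hB y : `|a| <= h y.
  by rewrite -sqrtr_sqr ler_wsqrtr// lerDl sqr_ge0.
have hsq y : h y ^+ 2 = a ^+ 2 + y ^+ 2.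
  by rewrite sqr_sqrtr// addr_ge0 ?sqr_ge0.
have one (D : set R) : measurable D ->
    (forall y y', D y -> D y' -> [/\ `|a| <= `|y|, `|a| <= `|y'| & 0 <= y * y']) ->
    (\int[mu]_(y in D) G (h y) <= 4%:E * \int[mu]_(s in [set s | (`|a| <= s)%R]) G s)%E.
  move=> mD DP.
  have ex : expansive_on D h (1 / 2).
    move=> y y' Dy Dy'; have [ay ay' yy'] := DP _ _ Dy Dy'.
    have h0 : 0 <= h y by exact: sqrtr_ge0.
    have h0' : 0 <= h y' by exact: sqrtr_ge0.
    have e1 := hsq y; have e2 := hsq y'.
    have b1 : h y <= 2 * `|y|.
      apply: sqr_leP; first by rewrite mulr_ge0.
      have := real_normK (num_real y); have := real_normK (num_real a).
      have := normr_ge0 a; nra.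
    have b2 : h y' <= 2 * `|y'|.
      apply: sqr_leP; first by rewrite mulr_ge0.
      have := real_normK (num_real y'); have := real_normK (num_real a).
      have := normr_ge0 a; nra.
    have key : `|h y - h y'| * (h y + h y') = `|y - y'| * `|y + y'|.
      rewrite -[X in _ * X = _]ger0_norm ?addr_ge0// -!normrM -!subr_sqr e1 e2.
      by congr `|_|; ring.
    have yD : `|y + y'| = `|y| + `|y'|.
      case: (ger0P y) yy' => Hy; case: (ger0P y') => Hy' yy'.
      - by rewrite ger0_norm// addr_ge0.
      - have : y = 0 by nra.
        by move=> ->; rewrite !add0r ltr0_norm.
      - have : y' = 0 by nra.
        by move=> ->; rewrite !addr0 ltr0_norm.
      - rewrite ltr0_norm; lra.
    have [hp|hp] := ltP 0 (h y + h y').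
      rewrite -(ler_pM2r hp) key yD.
      have := normr_ge0 (y - y'); have := normr_ge0 y; have := normr_ge0 y'; nra.
    have /eqP : y ^+ 2 = 0 by have := sqr_ge0 a; have := sqr_ge0 y; nra.
    rewrite sqrf_eq0 => /eqP ->.
    have /eqP : y' ^+ 2 = 0 by have := sqr_ge0 a; have := sqr_ge0 y'; nra.
    by rewrite sqrf_eq0 => /eqP ->; rewrite !subrr normr0 mulr0.
  have c0 : 0 < 1 / 2 :> R by lra.
  have := @expansive_integral R D _ h _ G c0 mD mB mh ex (fun y _ => hB y) mG G0.
  by rewrite (_ : 2 / (1 / 2) = 4)//; field.
pose D1 := [set y : R | (`|a| <= y)%R]; pose D2 := [set y : R | (y <= - `|a|)%R].
have mD1 : measurable D1 by [].
have mD2 : measurable D2 by exact: measurable_set_le.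
have mGh : measurable_fun setT (G \o h) by exact: measurableT_comp.
have DE : [set y | (`|a| <= `|y|)%R] = D1 `|` D2.
  apply/seteqP; split => y /=; rewrite /D1 /D2/=.
    by case: (ger0P y) => _ ?; [left|right; lra].
  by case=> ?; [rewrite (le_trans _ (ler_norm _))|rewrite -(normrN y) (le_trans _ (ler_norm _))//; lra].
rewrite DE.
have IH : (0 <= \int[mu]_(s in D1) G s)%E by exact: integral_ge0.
apply: (@le_trans _ _ ((\int[mu]_(y in D1) G (h y)) + (\int[mu]_(y in D2) G (h y)))%E).
  rewrite (integral_indicR D1) (integral_indicR D2) -ge0_integralD//; last 4 first.
  - by move=> x _; rewrite mule_ge0// lee_fin.
  - exact: measurable_fun_indicM.
  - by move=> x _; rewrite mule_ge0// lee_fin.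
  - exact: measurable_fun_indicM.
  rewrite integral_indicR; apply: le_integral_ge0 => //.
    by move=> x _; rewrite mule_ge0// lee_fin.
  move=> x _; rewrite -ge0_muleDr ?lee_fin//; apply: lee_wpmul2l => //.
  rewrite -EFinD lee_fin !indicE in_setU.
  by case: (x \in D1); case: (x \in D2) => /=; rewrite ?addr0 ?add0r ?lerDl.
apply: (@le_trans _ _ (4%:E * (\int[mu]_(s in D1) G s) + 4%:E * (\int[mu]_(s in D1) G s))%E).
  apply: leeD; apply: one => //.
  - move=> y y'; rewrite /D1/= => h1 h2; split => //.
    + exact: (le_trans h1 (ler_norm _)).
    + exact: (le_trans h2 (ler_norm _)).
    + by have a0 := normr_ge0 a; rewrite mulr_ge0//; lra.
  - move=> y y'; rewrite /D2/= => h1 h2; split => //.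
    + by rewrite -(normrN y) (le_trans _ (ler_norm _))//; lra.
    + by rewrite -(normrN y') (le_trans _ (ler_norm _))//; lra.
    + by have a0 := normr_ge0 a; rewrite -mulrNN mulr_ge0//; lra.
rewrite -ge0_muleDl ?lee_fin// -EFinD.
by rewrite (_ : 4 + 4 = 8)//; ring.
Qed.

Local Notation leb2 := (@leb2 R).

Lemma measurable_enorm_comp (G : R -> \bar R) : measurable_fun setT G ->
  measurable_fun setT (fun x => G (enorm x)).
Proof. by move=> mG; apply: measurableT_comp => //; exact: measurable_enorm. Qed.

(** [polar_inner_ge] is integrated over the abscissas [a > 0]; after Fubini, the range [0 < a < s]
    produces the weight [s]. *)
Lemma polar_lower (G : R -> \bar R) :
  measurable_fun setT G -> (forall x, 0 <= G x)%E ->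
  (\int[mu]_(s in [set s | (0 < s)%R]) (G s * s%:E) <=
   2%:E * \int[leb2]_x G (enorm x))%E.
Proof.
move=> mG G0.
have mGn := measurable_enorm_comp mG.
rewrite /leb2 fubini_tonelli1//= /fubini_F.
have mP : measurable [set s : R | (0 < s)%R] by exact: measurable_set_lt.
pose W := [set z : R * R | (0 < z.1)%R] `&` [set z : R * R | (z.1 < z.2)%R].
have mW : measurable W.
  by apply: measurableI; apply: measurable_set_lt.
pose f (z : R * R) := (G z.2 * (\1_W z)%:E)%E.
have f0 z : (0 <= f z)%E by rewrite /f mule_ge0// lee_fin.
have mf : measurable_fun setT f.
  apply: measurable_fun_indicM => //; apply: measurableT_comp => //; exact: measurable_snd.
apply: (@le_trans _ _ (\int[mu]_a \int[mu]_s f (a, s))%E).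
  rewrite (@fubini_tonelli _ _ _ _ _ mu mu f)//.
  rewrite integral_indicE le_eqVlt; apply/orP; left; apply/eqP.
  apply: eq_integral => s _.
  rewrite /f/= ge0_integralZl//; last first.
    apply/measurable_EFinP; apply: (@measurableT_comp _ _ _ _ _ _ (\1_W : R * R -> R)).
      exact: measurable_indic.
    exact: measurable_fun_pair.
  rewrite -muleA; congr (_ * _)%E.
  rewrite (_ : (fun x => _) = (fun x => (\1_[set a | 0 < a < s] x)%:E)); last first.
    by apply/funext => x; congr (_%:E); apply: indic_iff; rewrite /W/=; split => [[-> ->]|/andP[-> ->]].
  have mI : measurable [set a : R | 0 < a < s] by rewrite (_ : mkset _ = `]0, s[%classic)//; apply/seteqP; split => x /=; rewrite in_itv.
  rewrite integral_indic// setIT (_ : [set a : R | 0 < a < s] = `]0, s[%classic); last first.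
    by apply/seteqP; split => x /=; rewrite in_itv.
  rewrite [X in _ = X](lebesgue_measure_itv `]0%R, s[)/= lte_fin indicE.
  case: ifPn => s0; first by rewrite mem_set// mule1 -EFinD subr0.
  by rewrite memNset ?mule0//=; exact/negP.
rewrite -ge0_integralZl//; last 2 first.
- exact: (@measurable_fun_fubini_tonelli_F _ _ _ _ _ mu (fun x => G (enorm x))).
- by move=> x _; exact: integral_ge0.
apply: le_integral_ge0 => //.
  by move=> x _; exact: integral_ge0.
move=> a _; have [a0|a0] := ltP 0 a.
  apply: le_trans (polar_inner_ge (ltW a0) mG G0).
  rewrite [leRHS]integral_indicR le_eqVlt; apply/orP; left; apply/eqP.
  apply: eq_integral => s _; rewrite /f/=; congr (_ * _%:E)%E.
  by apply: indic_iff; rewrite /W/=; split => [[]|].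
rewrite [leLHS]integral0_eq ?mule_ge0 ?integral_ge0// => s _.
by rewrite /f indicE memNset ?mule0//= => -[/=]; rewrite ltNge a0.
Qed.

(** The plane is the union of [|x1| <= |x2|] and [|x2| <= |x1|], and [polar_inner_le] applies to
    each. Fubini over [|a| <= s] gives [2 s], so the constant is [2 * 8 * 2]. *)
Lemma polar_upper (G : R -> \bar R) :
  measurable_fun setT G -> (forall x, 0 <= G x)%E ->
  (\int[leb2]_x G (enorm x) <=
   32%:E * \int[mu]_(s in [set s | (0 < s)%R]) (G s * s%:E))%E.
Proof.
move=> mG G0.
have mGn := measurable_enorm_comp mG.
pose A1 := [set z : R * R | `|z.1| <= `|z.2| ].
pose A2 := [set z : R * R | `|z.2| <= `|z.1| ].
have mn1 : measurable_fun setT (fun z : R * R => `|z.1|) by apply: measurableT_comp => //; exact: measurable_fst.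
have mn2 : measurable_fun setT (fun z : R * R => `|z.2|) by apply: measurableT_comp => //; exact: measurable_snd.
have mA1 : measurable A1 by exact: measurable_set_le.
have mA2 : measurable A2 by exact: measurable_set_le.
pose K := (\int[mu]_a \int[mu]_(s in [set s | (`|a| <= s)%R]) G s)%E.
pose W := [set z : R * R | (`|z.1| <= z.2)%R].
have mW : measurable W by apply: measurable_set_le => //; exact: measurable_snd.
pose f (z : R * R) := (G z.2 * (\1_W z)%:E)%E.
have f0 z : (0 <= f z)%E by rewrite /f mule_ge0// lee_fin.
have mf : measurable_fun setT f.
  apply: measurable_fun_indicM => //; apply: measurableT_comp => //; exact: measurable_snd.
have fE a : (\int[mu]_(s in [set s | (`|a| <= s)%R]) G s = \int[mu]_s f (a, s))%E.
  rewrite integral_indicE; apply: eq_integral => s _; rewrite /f/=;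
  by congr (_ * _%:E)%E; apply: indic_iff; split.
have mK : measurable_fun setT (fun a : R => \int[mu]_(s in [set s | (`|a| <= s)%R]) G s)%E.
  rewrite (_ : (fun a => _) = (fun a : R => \int[mu]_s f (a, s))%E); last exact/funext.
  exact: measurable_fun_fubini_tonelli_F.
have KE : K = (2%:E * \int[mu]_(s in [set s | (0 < s)%R]) (G s * s%:E))%E.
  rewrite /K; under eq_integral do rewrite fE.
  rewrite (@fubini_tonelli _ _ _ _ _ mu mu f)//.
  have mP : measurable [set s : R | (0 < s)%R] by exact: measurable_set_lt.
  rewrite -ge0_integralZl//; last 2 first.
  - apply: emeasurable_funM; first exact: measurable_funTS.
    exact/measurable_EFinP.
  - by move=> s /= s0; rewrite mule_ge0// lee_fin ltW.
  rewrite [RHS]integral_indicE.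
  apply: eq_integral => s _.
  rewrite /f/= ge0_integralZl//; last first.
    apply/measurable_EFinP; apply: (@measurableT_comp _ _ _ _ _ _ (\1_W : R * R -> R)).
      exact: measurable_indic.
    exact: measurable_fun_pair.
  rewrite muleCA -!muleA; congr (_ * _)%E.
  rewrite (_ : (fun x => _) = (fun x => (\1_(`[- s, s]%classic) x)%:E)); last first.
    by apply/funext => x; congr (_%:E); apply: indic_iff; rewrite /W/= in_itv/= ler_norml.
  rewrite integral_indic// setIT [X in X = _](lebesgue_measure_itv `[(- s)%R, s])/= lte_fin indicE.
  have [s0|s0] := ltP 0 s.
    rewrite mem_set// ifT; last lra.
    by rewrite mulr1n mule1 -EFinD -EFinM; congr (_%:E); ring.
  rewrite memNset/=; last by apply/negP; rewrite -leNgt.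
  by rewrite ifF ?mulr0n ?mule0//; apply/negP/negP; rewrite -leNgt; lra.
have half (A : set (R * R)) : measurable A -> (0 <= \int[leb2]_x (G (enorm x) * (\1_A x)%:E))%E.
  by move=> mA; apply: integral_ge0 => x _; rewrite mule_ge0// lee_fin.
have h1 : (\int[leb2]_x (G (enorm x) * (\1_A1 x)%:E) <= 8%:E * K)%E.
  rewrite fubini_tonelli1//=; last 2 first.
  - exact: measurable_fun_indicM.
  - by move=> x; rewrite mule_ge0// lee_fin.
  rewrite /K -ge0_integralZl//; last by move=> x _; exact: integral_ge0.
  apply: le_integral_ge0 => //.
    by move=> x _; apply: integral_ge0 => y _; rewrite mule_ge0// lee_fin.
  move=> a _; apply: le_trans (polar_inner_le _ mG G0).
  rewrite [leRHS]integral_indicR le_eqVlt; apply/orP; left; apply/eqP.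
  apply: eq_integral => s _; rewrite /enorm/=;
  by congr (_ * _%:E)%E; apply: indic_iff; split.
have h2 : (\int[leb2]_x (G (enorm x) * (\1_A2 x)%:E) <= 8%:E * K)%E.
  rewrite fubini_tonelli2//=; last 2 first.
  - exact: measurable_fun_indicM.
  - by move=> x; rewrite mule_ge0// lee_fin.
  rewrite /K -ge0_integralZl//; last by move=> x _; exact: integral_ge0.
  apply: le_integral_ge0 => //.
    by move=> x _; apply: integral_ge0 => y _; rewrite mule_ge0// lee_fin.
  move=> a _; apply: le_trans (polar_inner_le _ mG G0).
  rewrite [leRHS]integral_indicR le_eqVlt; apply/orP; left; apply/eqP.
  apply: eq_integral => s _; rewrite /enorm/= addrC;
  by congr (_ * _%:E)%E; apply: indic_iff; split.
apply: (@le_trans _ _ (8%:E * K + 8%:E * K)%E); last first.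
  have K0 : (0 <= K)%E by apply: integral_ge0 => a _; exact: integral_ge0.
  rewrite -ge0_muleDl ?lee_fin// -EFinD KE muleA -EFinM.
  by rewrite (_ : (8 + 8) * 2 = 32)//; ring.
apply: le_trans (leeD h1 h2).
rewrite -ge0_integralD//; last 4 first.
- by move=> x _; rewrite mule_ge0// lee_fin.
- exact: measurable_fun_indicM.
- by move=> x _; rewrite mule_ge0// lee_fin.
- exact: measurable_fun_indicM.
apply: le_integral_ge0 => //.
move=> x _; rewrite -ge0_muleDr ?lee_fin//.
rewrite -[leLHS]mule1; apply: lee_wpmul2l => //.
rewrite -EFinD lee_fin !indicE.
have [xx|/ltW xx] := leP `|x.1| `|x.2|.
  by rewrite (_ : x \in A1) ?inE// lerDl.
by rewrite addrC (_ : x \in A2) ?inE// lerDl.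
Qed.

End Polar.

(** * Reduction of the circular mean to integrals over quarter circles *)

Section CircularMean.
Context {R : realType}.
Local Notation mu := (@lebesgue_measure R).
Local Notation pi := (@trigo.pi R).

Lemma polar_angle (x : R * R) : 0 < enorm x -> exists al : R,
  [/\ - pi <= al, al <= pi, x.1 = enorm x * cos al & x.2 = enorm x * sin al].
Proof.
set r := enorm x => r0.
have rsq : r ^+ 2 = x.1 ^+ 2 + x.2 ^+ 2 by rewrite sqr_sqrtr// addr_ge0 ?sqr_ge0.
have x1r : `|x.1| <= r.
  by rewrite -sqrtr_sqr ler_wsqrtr// lerDl sqr_ge0.
have c1 : -1 <= x.1 / r <= 1 by rewrite ler_pdivlMr// ler_pdivrMr// mulN1r mul1r -ler_norml.
have p0 := @pi_ge0 R.
have ca : cos (acos (x.1 / r)) = x.1 / r by rewrite acosK// in_itv.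
have sa : r * sin (acos (x.1 / r)) = `|x.2|.
  rewrite sin_acos// -{1}(gtr0_norm r0) -sqrtr_sqr -sqrtrM ?sqr_ge0// -sqrtr_sqr.
  congr Num.sqrt; rewrite [LHS](_ : _ = r ^+ 2 - x.1 ^+ 2); last by field; rewrite gt_eqF.
  by rewrite rsq; ring.
have [x2|x2] := leP 0 x.2.
  exists (acos (x.1 / r)); split.
  - by rewrite (le_trans _ (acos_ge0 c1))// oppr_le0.
  - exact: acos_lepi.
  - by rewrite ca mulrCA divff ?mulr1// gt_eqF.
  - by rewrite sa ger0_norm.
exists (- acos (x.1 / r)); split.
- by rewrite lerN2 acos_lepi.
- by rewrite (le_trans _ p0)// oppr_le0 acos_ge0.
- by rewrite cosN ca mulrCA divff ?mulr1// gt_eqF.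
- by rewrite sinN mulrN sa ltr0_norm// opprK.
Qed.

(* distance from the centre to the point at angle [phi] of the circle of radius
   [t] around a point of norm [r], with [c = +- cos phi] *)
Definition sdist (r t c : R) : R := Num.sqrt (r ^+ 2 + t ^+ 2 - 2 * r * t * c).

(** [e = 1] is a quarter of the circle on the side of the origin, [e = -1] one on the far side; by
    symmetry these two stand for the whole circle. *)
Definition arc_integral (g : R -> R) (e r t : R) : \bar R :=
  (\int[mu]_(phi in `]0%R, (pi / 2)%R]) (g (sdist r t (e * cos phi)))%:E)%E.

Lemma measurable_cos : measurable_fun setT (@cos R).
Proof. by apply: continuous_measurable_fun => x; exact: continuous_cos. Qed.

Lemma measurable_sin : measurable_fun setT (@sin R).
Proof. by apply: continuous_measurable_fun => x; exact: continuous_sin. Qed.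

Lemma measurable_sdist r t : measurable_fun setT (sdist r t).
Proof.
apply: measurableT_comp; first exact: measurable_sqrt.
by apply: measurable_funB => //; exact: measurable_funM.
Qed.

Lemma le_integral_cover2 (D A B : set R) (f : R -> \bar R) :
  measurable A -> measurable B -> D `<=` A `|` B ->
  measurable_fun setT f -> (forall x, 0 <= f x)%E ->
  (\int[mu]_(x in D) f x <= (\int[mu]_(x in A) f x) + (\int[mu]_(x in B) f x))%E.
Proof.
move=> mA mB DAB mf f0.
rewrite (integral_indicR D) (integral_indicR A) (integral_indicR B) -ge0_integralD//; last 4 first.
- by move=> x _; rewrite mule_ge0// lee_fin.
- exact: measurable_fun_indicM.
- by move=> x _; rewrite mule_ge0// lee_fin.
- exact: measurable_fun_indicM.
apply: le_integral_ge0 => x _; first by rewrite mule_ge0// lee_fin.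
rewrite -ge0_muleDr ?lee_fin//; apply: lee_wpmul2l => //.
rewrite -EFinD lee_fin !indicE.
case: (boolP (x \in D)) => [|_]; last by rewrite addr_ge0.
rewrite inE => /DAB[Ax|Bx]; first by rewrite (mem_set Ax) lerDl.
by rewrite addrC (mem_set Bx) lerDl.
Qed.

(** The isometry [y |-> s y + d] carries a quarter turn onto [[0, pi/2]]; the 2 is the loss of
    [expansive_integral]. *)
Lemma arc_piece (H : R -> R) (al e s d a : R) : 
  measurable_fun setT H -> (forall x, 0 <= H x) ->
  s = 1 \/ s = -1 ->
  (forall y, cos y = e * cos (s * y + d)) ->
  (forall y, a <= y -> y <= a + pi / 2 -> 0 <= s * y + d <= pi / 2) ->
  (\int[mu]_(th in `[(al + a)%R, (al + a + pi / 2)%R]) (H (cos (th - al)))%:E <=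
   2%:E * \int[mu]_(phi in `]0%R, (pi / 2)%R]) (H (e * cos phi))%:E)%E.
Proof.
move=> mH H0 s1 cosE hb.
pose h th := s * (th - al) + d.
have mh : measurable_fun setT h.
  by apply: measurable_funD => //; apply: measurable_funM => //; exact: measurable_funB.
have s1n : `|s| = 1 by case: s1 => ->; rewrite ?normrN normr1.
have ex : expansive_on `[(al + a)%R, (al + a + pi / 2)%R]%classic h 1.
  move=> x y _ _; have -> : h x - h y = s * (x - y) by rewrite /h; ring.
  by rewrite normrM s1n.
have mG : measurable_fun setT (fun p : R => (H (e * cos p))%:E).
  apply/measurable_EFinP; apply: measurableT_comp => //.
  by apply: measurable_funM => //; exact: measurable_cos.
have hB x : `[(al + a)%R, (al + a + pi / 2)%R]%classic x -> `[0, pi / 2]%classic (h x).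
  rewrite /= !in_itv/= => /andP[h1 h2]; apply: hb; lra.
have := @expansive_integral R _ `[0, pi / 2]%classic h 1 _ ltr01 (measurable_itv _) (measurable_itv _) mh ex hB mG (fun _ => H0 _).
rewrite divr1 integral_itv_obnd_cbnd; last exact: measurable_funTS.
apply: le_trans; apply: le_integral_ge0 => x _; first by rewrite lee_fin.
by rewrite /h -cosE.
Qed.

Lemma measurable_radial_profile (f : R * R -> R) :
  measurable_fun [set: R * R] f -> measurable_fun setT (fun s : R => `|f (s, 0%R)|%R).
Proof.
move=> mf; have h : measurable_fun setT (fun s : R => (s, 0 : R)).
  exact: measurable_fun_pair.
have mf0 : measurable_fun setT (fun s : R => f (s, 0%R)).
  exact: (measurableT_comp mf h).
by apply: measurableT_comp => //; exact: mf0.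
Qed.

Lemma adde_fin (x y : \bar R) : (0 <= x)%E -> (0 <= y)%E -> (x + y)%E != +oo%E ->
  (exists a, x = a%:E) /\ (exists b, y = b%:E).
Proof.
move: x y => [a| |] [b| |] // _ _ h; first by split; [exists a|exists b].
all: by move: h; rewrite ?addye ?addey ?eqxx.
Qed.

(** By radiality and the law of cosines the integrand depends only on the cosine of the angle with
    [x]. The circle is covered by eight quarter turns, four of each sign of that cosine, each
    costing a factor 2. *)
Lemma circ_avg_le (f : R * R -> R) (x : R * R) (t : R) :
  measurable_fun [set: R * R] f -> radial f -> 0 < enorm x ->
  (`|circ_avg f x t| <= 8%:E * (arc_integral (fun s : R => `|f (s, 0%R)|%R) 1 (enorm x) t +
     arc_integral (fun s : R => `|f (s, 0%R)|%R) (-1) (enorm x) t))%E.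
Proof.
move=> mf rf r0; pose g s := `|f (s, 0)|.
have [al [al1 al2 x1E x2E]] := polar_angle r0.
set r := enorm x in r0 x1E x2E *.
have p0 := @pi_gt0 R.
pose H c := g (sdist r t c).
have mg : measurable_fun setT g by exact: measurable_radial_profile.
have mH : measurable_fun setT H by apply: measurableT_comp => //; exact: measurable_sdist.
have H0 c : 0 <= H c by exact: normr_ge0.
have fH th : `|f (x.1 - t * cos th, x.2 - t * sin th)| = H (cos (th - al)).
  rewrite /H /g; congr `|_|; apply: rf => /=.
  rewrite expr0n/= addr0.
  have E : (x.1 - t * cos th) ^+ 2 + (x.2 - t * sin th) ^+ 2 =
      r ^+ 2 + t ^+ 2 - 2 * r * t * cos (th - al).
    rewrite cosB x1E x2E.
    have h1 := cos2Dsin2 al; have h2 := cos2Dsin2 th.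
    have er : r ^+ 2 = r ^+ 2 * (cos al ^+ 2 + sin al ^+ 2) by rewrite h1 mulr1.
    have et : t ^+ 2 = t ^+ 2 * (cos th ^+ 2 + sin th ^+ 2) by rewrite h2 mulr1.
    rewrite er et; ring.
  by rewrite sqr_sqrtr// -E addr_ge0 ?sqr_ge0.
have mth : measurable_fun setT (fun th : R => f (x.1 - t * cos th, x.2 - t * sin th)).
  apply: measurableT_comp => //; apply: measurable_fun_pair; apply: measurable_funB => //; apply: measurable_funM => //; [exact: measurable_cos|exact: measurable_sin].
rewrite /circ_avg abseM gee0_abs ?lee_fin ?invr_ge0; last lra.
(* The normalizing factor [(2 * pi)^-1] is bounded by 1. *)
apply: (@le_trans _ _ (1%:E * \int[mu]_(th in `[0%R, (2 * pi)%R]) (H (cos (th - al)))%:E)%E).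
  apply: lee_pmul => //; rewrite ?abse_ge0 ?lee_fin ?invr_ge0//; first lra.
    by rewrite invf_le1; have := @pi_ge2 R; lra.
  apply: le_trans (le_abse_integral _ _ _) _ => //.
    exact/measurable_EFinP/measurable_funTS.
  by apply: le_integral_ge0 => th _; rewrite ?abse_ge0//= fH.
rewrite mul1e.
have mHa : measurable_fun setT (fun th : R => (H (cos (th - al)))%:E).
  apply/measurable_EFinP; apply: measurableT_comp => //.
  apply: measurableT_comp; first exact: measurable_cos.
  exact: measurable_funB.
pose J k := (\int[mu]_(th in `[(al + (k%:R * (pi / 2) - pi))%R, (al + (k%:R * (pi / 2) - pi) + pi / 2)%R]) (H (cos (th - al)))%:E)%E.
have cover n : (\int[mu]_(th in `[(al - pi)%R, (al + (n%:R * (pi / 2) - pi))%R]) (H (cos (th - al)))%:E <= \sum_(k < n) J k)%E.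
  elim: n => [|n IH].
    rewrite big_ord0 mul0r sub0r (_ : `[_, _]%classic = [set al - pi]) ?integral_set1//.
    by rewrite set_itv1.
  rewrite big_ord_recr/=; apply: le_trans (leeD IH (lexx _)).
  apply: le_integral_cover2 => //; last by move=> y; rewrite lee_fin.
  move=> y /=; rewrite !in_itv/= => /andP[h1 h2].
  have [h3|h3] := leP y (al + (n%:R * (pi / 2) - pi)); first by left; rewrite h1.
  by right; rewrite ltW//=; move: h2; rewrite -natr1; lra.
pose Ip : \bar R := arc_integral g 1 r t.
pose Im : \bar R := arc_integral g (-1) r t.
rewrite -[leRHS]/(8%:E * (Ip + Im))%E.
have Ip0 : (0 <= Ip)%E by apply: integral_ge0 => y _; rewrite lee_fin normr_ge0.
have Im0 : (0 <= Im)%E by apply: integral_ge0 => y _; rewrite lee_fin normr_ge0.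
have cosDp := @cosDpi R.
have cosBp (y : R) : cos (y - pi) = - cos y.
  by rewrite -[y in RHS](subrK pi) cosDp opprK.
(* Since [al] lies in [[-pi, pi]], eight quarter turns starting at [al - pi] cover the period
   [[0, 2 * pi]]. *)
apply: (@le_trans _ _ (\sum_(k < 8) J k)%E).
  apply: le_trans (cover 8%N).
  apply: ge0_subset_integral => //.
  - exact: measurable_funTS.
  - by move=> y _; rewrite lee_fin.
  - by move=> y; rewrite /= !in_itv/= => /andP[h1 h2]; apply/andP; split; lra.
rewrite !big_ord_recr big_ord0/= add0e.
have cosm (y : R) : cos (-1 * y) = cos y by rewrite mulN1r cosN.
have K (k : nat) (e s d : R) (I : \bar R) : I = (\int[mu]_(phi in `]0%R, (pi / 2)%R]) (H (e * cos phi))%:E)%E ->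
   s = 1 \/ s = -1 ->
   (forall y, cos y = e * cos (s * y + d)) ->
   (forall y, k%:R * (pi / 2) - pi <= y -> y <= k%:R * (pi / 2) - pi + pi / 2 -> 0 <= s * y + d <= pi / 2) ->
   (J k <= 2%:E * I)%E.
  move=> -> s1 h1 h2. apply: (@arc_piece H al e s d _ mH H0 s1 h1 h2).
have IpE : Ip = (\int[mu]_(phi in `]0%R, (pi / 2)%R]) (H (1 * cos phi))%:E)%E by [].
have ImE : Im = (\int[mu]_(phi in `]0%R, (pi / 2)%R]) (H (-1 * cos phi))%:E)%E by [].
have J0 : (J 0%N <= 2%:E * Im)%E.
  apply: (K _ _ 1 pi _ ImE); [by left|by move=> y; rewrite mul1r cosDp; ring|].
  by move=> y h1 h2; apply/andP; split; clear -h1 h2 p0; lra.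
have J1 : (J 1%N <= 2%:E * Ip)%E.
  apply: (K _ _ (-1) 0 _ IpE); [by right|by move=> y; rewrite mul1r mulN1r addr0 cosN|].
  by move=> y h1 h2; apply/andP; split; clear -h1 h2 p0; lra.
have J2 : (J 2%N <= 2%:E * Ip)%E.
  apply: (K _ _ 1 0 _ IpE); [by left|by move=> y; rewrite !mul1r addr0|].
  by move=> y h1 h2; apply/andP; split; clear -h1 h2 p0; lra.
have J3 : (J 3%N <= 2%:E * Im)%E.
  apply: (K _ _ (-1) pi _ ImE); [by right|by move=> y; rewrite cosDp cosm; ring|].
  by move=> y h1 h2; apply/andP; split; clear -h1 h2 p0; lra.
have J4 : (J 4%N <= 2%:E * Im)%E.
  apply: (K _ _ 1 (- pi) _ ImE); [by left|by move=> y; rewrite cosBp mul1r; ring|].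
  by move=> y h1 h2; apply/andP; split; clear -h1 h2 p0; lra.
have J5 : (J 5%N <= 2%:E * Ip)%E.
  apply: (K _ _ (-1) (pi + pi) _ IpE); [by right|by move=> y; rewrite addrA !cosDp cosm; ring|].
  by move=> y h1 h2; apply/andP; split; clear -h1 h2 p0; lra.
have J6 : (J 6%N <= 2%:E * Ip)%E.
  apply: (K _ _ 1 (- pi - pi) _ IpE); [by left|by move=> y; rewrite addrA !cosBp !mul1r; ring|].
  by move=> y h1 h2; apply/andP; split; clear -h1 h2 p0; lra.
have J7 : (J 7%N <= 2%:E * Im)%E.
  apply: (K _ _ (-1) (pi + pi + pi) _ ImE); [by right|by move=> y; rewrite (_ : -1 * y + _ = -1 * y + pi + pi + pi) ?cosDp ?cosm; ring|].
  by move=> y h1 h2; apply/andP; split; clear -h1 h2 p0; lra.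
clear IpE ImE K cover mHa fH; clearbody Ip Im J.
have [Ioo|Ifin] := eqVneq (Ip + Im)%E +oo%E.
  by rewrite Ioo mulry gtr0_sg// mul1e leey.
have [[a Ea] [b Eb]] := adde_fin Ip0 Im0 Ifin.
move: J0 J1 J2 J3 J4 J5 J6 J7; rewrite Ea Eb -!EFinM => J0 J1 J2 J3 J4 J5 J6 J7.
apply: (le_trans (leeD (leeD (leeD (leeD (leeD (leeD (leeD J0 J1) J2) J3) J4) J5) J6) J7)).
by rewrite -!EFinD lee_fin; clear; lra.
Qed.

End CircularMean.

(** * Quantitative bounds for sine and cosine on a quarter turn *)

Section Trigonometry.
Context {R : realType}.
Local Notation pi := (@trigo.pi R).

Lemma sin_mvt (y : R) : 0 < y -> exists2 z : R, 0 < z < y & sin y = y * cos z.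
Proof.
move=> y0.
have ds x : x \in `]0, y[ -> is_derive x 1 (@sin R) (cos x) by move=> _; exact: is_derive_sin.
have [|z zi] := MVT y0 ds.
  by apply: continuous_subspaceT => x; exact: continuous_sin.
rewrite sin0 !subr0 => ->; exists z; last by rewrite mulrC.
by move: zi; rewrite in_itv.
Qed.

Lemma sin_le (y : R) : 0 <= y -> sin y <= y.
Proof.
rewrite le_eqVlt => /predU1P[<-|y0]; first by rewrite sin0.
have [z _ ->] := sin_mvt y0; have := cos_le1 z; nra.
Qed.

(** Doubling and the mean value theorem give [sin y = y cos (y/2) cos z] with [0 < z < y/2], and
    both cosines have square at least [1/2] since doubling their angle stays within [pi/2]. *)
Lemma sin_ge_half (y : R) : 0 <= y <= pi / 2 -> y / 2 <= sin y.
Proof.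
move=> /andP[]; rewrite le_eqVlt => /predU1P[<-|y0 ypi]; first by rewrite sin0 mul0r.
have p0 := @pi_gt0 R.
have cosb (z : R) : 0 <= z <= y / 2 -> 0 <= cos z /\ 1 / 2 <= cos z ^+ 2.
  move=> /andP[z0 zy]; split; first by apply: cos_ge0_pihalf; apply/andP; split; lra.
  have : 0 <= cos (z *+ 2) by apply: cos_ge0_pihalf; rewrite (mulr2n z); apply/andP; split; lra.
  rewrite cos_mulr2n (mulr2n (cos z ^+ 2)); lra.
have y20 : 0 < y / 2 by lra.
have [z /andP[z0 zy] e] := sin_mvt y20.
have zb : 0 <= z <= y / 2 by apply/andP; split; lra.
have yb : 0 <= y / 2 <= y / 2 by apply/andP; split; lra.
have [h1 h2] := cosb z zb.
have [h3 h4] := cosb (y / 2) yb.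
have -> : sin y = y * (cos (y / 2) * cos z).
  rewrite [in LHS](_ : y = (y / 2) *+ 2); last by rewrite (mulr2n (y / 2)); lra.
  rewrite sin_mulr2n e (mulr2n (cos _ * _)); by field.
have h5 : 1 / 2 <= cos (y / 2) * cos z.
  apply: sqr_leP; first exact: mulr_ge0.
  rewrite exprMn; nra.
nra.
Qed.

Lemma cos_sub (x y : R) : cos x - cos y = 2 * sin ((y + x) / 2) * sin ((y - x) / 2).
Proof.
have -> : cos x = cos ((y + x) / 2 - (y - x) / 2) by congr cos; lra.
have -> : cos y = cos ((y + x) / 2 + (y - x) / 2) by congr cos; lra.
by rewrite cosB cosD; ring.
Qed.

Lemma cos_sub_ge (x y : R) : 0 <= x -> x <= y -> y <= pi / 2 ->
  (y ^+ 2 - x ^+ 2) / 8 <= cos x - cos y.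
Proof.
move=> x0 xy ypi; rewrite cos_sub.
have b1 : 0 <= (y + x) / 2 <= pi / 2 by apply/andP; split; lra.
have b2 : 0 <= (y - x) / 2 <= pi / 2 by apply/andP; split; lra.
have h1 := sin_ge_half b1; have h2 := sin_ge_half b2.
have p1 : 0 <= (y + x) / 2 / 2 by lra.
have p2 : 0 <= (y - x) / 2 / 2 by lra.
have -> : (y ^+ 2 - x ^+ 2) / 8 = 2 * ((y + x) / 2 / 2 * ((y - x) / 2 / 2)) by field.
by rewrite -[leRHS]mulrA ler_pM2l//; exact: ler_pM.
Qed.

Lemma cos_ge_sqr (x : R) : 0 <= x -> 1 - cos x <= x ^+ 2 / 2.
Proof.
move=> x0; have := cos_sub 0 x; rewrite cos0 addr0 subr0 => ->.
have x20 : 0 <= x / 2 by lra.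
have h := sin_le x20.
have h' : - (x / 2) <= sin (x / 2).
  have [xp|xp] := ltP 0 (x / 2).
    by have [z _ ->] := sin_mvt xp; have := cos_geN1 z; nra.
  have -> : x / 2 = 0 by lra.
  by rewrite sin0 oppr0.
have : 0 <= (x / 2 - sin (x / 2)) * (x / 2 + sin (x / 2)) by apply: mulr_ge0; lra.
rewrite -subr_sqr; lra.
Qed.

End Trigonometry.

(** * Hölder's inequality on a set of finite measure *)

Section Jensen.
Local Open Scope ereal_scope.
Context d (T : measurableType d) (R : realType) (m : {measure set T -> \bar R}).

(** Hölder against the indicator of [D] with exponents [1 / (1 - u)] and [1 / u]; [u = 1] is treated
    apart because the first one becomes infinite. *)
Lemma integral_powR_le (D : set T) (h : T -> R) (l u : R) :
  measurable D -> m D <= l%:E -> measurable_fun setT h -> (forall x, 0 <= h x)%R ->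
  (0 < u <= 1)%R ->
  \int[m]_(x in D) (h x)%:E <=
  (l `^ (1 - u))%:E * (\int[m]_(x in D) (h x `^ u^-1)%:E) `^ u.
Proof.
move=> mD mDl mh h0 /andP[u0]; rewrite le_eqVlt => /predU1P[->|u1].
  rewrite subrr powRr0 mul1e poweRe1; last by apply: integral_ge0 => x _; rewrite lee_fin powR_ge0.
  apply: le_integral_ge0 => x _; first by rewrite lee_fin.
  by rewrite invr1 powRr1.
have l0 : (0 <= l)%R by rewrite -lee_fin (le_trans _ mDl).
have mi : measurable_fun setT (\1_D : T -> R) by exact: measurable_indic.
have u10 : (0 < 1 - u)%R by rewrite subr_gt0.
have pq : ((1 - u)^-1^-1 + u^-1^-1 = 1)%R by rewrite !invrK subrK.
have mhD : measurable_fun setT (fun x => h x * \1_D x)%R by exact: measurable_funM.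
have := hoelder m mi mhD _ _ pq.
rewrite !invr_gt0 => /(_ u10 u0).
rewrite Lnorm1.
rewrite (_ : \int[m]_x _ = \int[m]_(x in D) (h x)%:E); last first.
  rewrite (integral_indicE _ D); apply: eq_integral => x _ /=.
  rewrite -EFinM indicE; case: (x \in D); rewrite ?mulr1 ?mulr0 ?mul1r ?normr0// ger0_norm//.
move=> /le_trans; apply.
rewrite unlock !invrK; apply: lee_pmul.
- exact: poweR_ge0.
- exact: poweR_ge0.
- rewrite -poweR_EFin; apply: gt0_ler_poweR => //.
  + exact: ltW.
  + by rewrite in_itv/= leey andbT; apply: integral_ge0 => x _; rewrite ?lee_fin ?poweR_ge0 ?powR_ge0.
  + by rewrite in_itv/= leey andbT lee_fin.
  apply: le_trans mDl.
  rewrite -[in leRHS](setIid D) -integral_indic// (integral_indicE _ D).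
  apply: le_integral_ge0 => x _; first exact: poweR_ge0.
  rewrite /= indicE; case: (x \in D) => /=; rewrite ?mulr1n ?mulr0n ?normr1 ?normr0 ?poweR_EFin ?powR1 ?mul1e ?lexx//.
  by rewrite powR0 ?mule0// invr_neq0// gt_eqF.
- apply: gt0_ler_poweR => //.
  + exact: ltW.
  + by rewrite in_itv/= leey andbT; apply: integral_ge0 => x _; rewrite ?lee_fin ?poweR_ge0 ?powR_ge0.
  + by rewrite in_itv/= leey andbT; apply: integral_ge0 => x _; rewrite lee_fin powR_ge0.
  rewrite (integral_indicE _ D).
  apply: le_integral_ge0 => x _; first exact: poweR_ge0.
  rewrite /= indicE; case: (x \in D) => /=; rewrite ?mulr1n ?mulr0n ?mulr1 ?mulr0.
    by rewrite ger0_norm// mule1.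
  by rewrite normr0 mule0 ?poweR_EFin powR0// invr_neq0// gt_eqF.
Qed.

End Jensen.

(** * The estimate of one piece, and the angular shells *)

Section Piece.
Context {R : realType}.
Local Notation mu := (@lebesgue_measure R).
Local Notation pi := (@trigo.pi R).

(** Hölder on [D] gives the power of [l], the change of variables [h] gives [2 / c], and
    [1 <= s / w] on [W] inserts the planar weight [s]. *)
Lemma piece_le (D W : set R) (h g : R -> R) (c w l u : R) :
  0 < c -> 0 < w -> 0 < u <= 1 ->
  measurable D -> measurable W -> measurable_fun setT h ->
  expansive_on D h c -> (forall x, D x -> W (h x)) -> (forall s, W s -> w <= s) ->
  (mu D <= l%:E)%E -> measurable_fun setT g -> (forall x, 0 <= g x) ->
  (\int[mu]_(x in D) (g (h x))%:E <=
   (l `^ (1 - u) * (2 / c / w) `^ u)%:E *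
   (\int[mu]_(s in W) (g s `^ u^-1 * s)%:E) `^ u)%E.
Proof.
move=> c0 w0 u01 mD mW mh ex DW Ww Dl mg g0.
have mgh : measurable_fun setT (g \o h) by exact: measurableT_comp.
have mgp : measurable_fun setT (fun s => (g s `^ u^-1)%:E).
  by apply/measurable_EFinP; apply: (@measurableT_comp _ _ _ _ _ _ (@powR R ^~ u^-1)) => //; exact: measurable_powR.
have H := @integral_powR_le _ _ _ mu D (g \o h) l u mD Dl mgh (fun x => g0 (h x)) u01.
apply: (le_trans H) => {H}.
rewrite [in leRHS]EFinM -muleA; apply: lee_wpmul2l; first by rewrite lee_fin powR_ge0.
rewrite -poweR_EFin -poweRM; last 2 first.
- by rewrite lee_fin !divr_ge0// ltW.
- by apply: integral_ge0 => s /Ww ws; rewrite lee_fin mulr_ge0 ?powR_ge0// (le_trans (ltW w0)).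
have c20 : (0 <= (2 / c)%:E)%E by rewrite lee_fin divr_ge0// ltW.
apply: gt0_ler_poweR.
- by case/andP: u01 => /ltW.
- by rewrite in_itv/= leey andbT; apply: integral_ge0 => x _; rewrite lee_fin powR_ge0.
- rewrite in_itv/= leey andbT mule_ge0//; first by rewrite lee_fin !divr_ge0// ltW.
  by apply: integral_ge0 => s /Ww ws; rewrite lee_fin mulr_ge0 ?powR_ge0// (le_trans (ltW w0)).
apply: (le_trans (expansive_integral c0 mD mW mh ex DW mgp _)) => [s|]; first by rewrite lee_fin powR_ge0.
rewrite [(2 / c / w)%:E]EFinM -muleA; apply: lee_wpmul2l => //.
rewrite -ge0_integralZl//; last 3 first.
- by apply: measurable_funTS; apply/measurable_EFinP; apply: measurable_funM => //; exact/measurable_EFinP.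
- by move=> s /Ww ws; rewrite lee_fin mulr_ge0 ?powR_ge0// (le_trans (ltW w0)).
- by rewrite lee_fin invr_ge0 ltW.
apply: le_integral_ge0 => s Ws; first by rewrite lee_fin powR_ge0.
rewrite -EFinM lee_fin mulrCA ler_peMr ?powR_ge0//.
by rewrite ler_pdivlMl// mulr1 Ww.
Qed.

(** Shells of ratio [e] rather than 2, so that every size is [expR] of a linear form in the indices.
    The factor 2 lets the shells exhaust []0, pi / 2]], as [pi / 2 < 2]. *)
Definition Phi (l : nat) : set R :=
  [set p | [/\ 2 * expR (- l.+1%:R) < p, p <= 2 * expR (- l%:R) & p <= pi / 2]].

Lemma measurable_Phi l : measurable (Phi l).
Proof.
rewrite (_ : Phi l = `]2 * expR (- l.+1%:R), 2 * expR (- l%:R)] `&` `]-oo, pi / 2]); last first.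
  apply/seteqP; split => x; rewrite /= !in_itv/=; first by case=> -> ->.
  by case=> /andP[].
exact: measurableI.
Qed.

Lemma measure_Phi l : (mu (Phi l) <= (2 * expR (- l%:R))%:E)%E.
Proof.
have e0 := expR_gt0 (- l%:R : R).
apply: (@le_trans _ _ (mu `]0, 2 * expR (- l%:R)])).
  apply: le_measure; rewrite ?inE; [exact: measurable_Phi|exact: measurable_itv|].
  move=> x [h1 h2 h3]; have e1 := expR_gt0 (- l.+1%:R : R).
  by rewrite /= in_itv/= h2 andbT; apply: lt_trans h1; rewrite mulr_gt0.
have -> : mu `]0, 2 * expR (- l%:R)] = (2 * expR (- l%:R))%:E; last exact: lexx.
by rewrite lebesgue_measure_itv/= lte_fin ifT ?mulr_gt0// -EFinD subr0.
Qed.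

Lemma expR1_ge2 : 2 <= expR 1 :> R.
Proof. by have := expR_ge1Dx (1 : R); lra. Qed.

Lemma expRN1_ge : 1 / 4 <= expR (- 1) :> R.
Proof.
have h := expR_ge1Dx (- (1 / 2) : R).
rewrite (_ : - 1 = - (1 / 2) + - (1 / 2) :> R); last by lra.
rewrite expRD; have := expR_ge0 (- (1 / 2) : R); nra.
Qed.

Lemma expRNS (l : nat) : expR (- l.+1%:R) = expR (- l%:R) * expR (- 1) :> R.
Proof. by rewrite -expRD -natr1 opprD. Qed.

Lemma expRNS_ge (l : nat) : expR (- l%:R) / 4 <= expR (- l.+1%:R) :> R.
Proof. rewrite expRNS; have := expRN1_ge; have := expR_ge0 (- l%:R : R); nra. Qed.

Lemma expRN_small (p : R) : 0 < p -> exists n : nat, 2 * expR (- n%:R) < p.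
Proof.
move=> p0; exists (Num.bound (2 / p)).
have h : 2 / p < (Num.bound (2 / p))%:R by apply: archi_boundP; rewrite divr_ge0// ltW.
set n := Num.bound (2 / p) in h *.
have h2 := expR_ge1Dx (n%:R : R).
have e0 := expR_gt0 (n%:R : R).
rewrite expRN -ltr_pdivlMl// mulrC -[X in _ < X]invrK ltf_pV2 ?posrE ?invr_gt0 ?divr_gt0//.
rewrite invf_div; lra.
Qed.

Lemma dyadic_scale (p a : R) : 0 < p -> p <= a -> exists l : nat,
  a * expR (- l.+1%:R) < p /\ p <= a * expR (- l%:R).
Proof.
move=> p0 pa; have a0 : 0 < a by exact: lt_le_trans pa.
have [n hn] := @expRN_small (2 * p / a) ltac:(by rewrite divr_gt0// mulr_gt0).
have ex : exists n : nat, a * expR (- n%:R) < p.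
  by exists n; move: hn; rewrite ltr_pdivlMr// => hn; nra.
case: (ex_minnP ex) => [[|m]] hm min.
  by move: hm; rewrite oppr0 expR0 mulr1 ltNge pa.
exists m; split => //; rewrite leNgt; apply/negP => /min.
by rewrite ltnn.
Qed.

Lemma Phi_cover p : 0 < p -> p <= pi / 2 -> exists l, Phi l p.
Proof.
move=> p0 ppi; have p2 : p <= 2 by apply: le_trans ppi (ltW (@pihalf_lt2 R)).
by have [l [h1 h2]] := dyadic_scale p0 p2; exists l.
Qed.

End Piece.

(** * Geometry of the distance as a function of the angle *)

Section Geometry.
Context {R : realType}.
Local Notation mu := (@lebesgue_measure R).
Local Notation pi := (@trigo.pi R).
Variable E : set R.

Definition nbd (d : R) : set R := [set a | exists2 t, E t & `|a - t| < d].

Lemma measurable_nbd d : measurable (nbd d).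
Proof.
apply: open_measurable.
rewrite (_ : nbd d = \bigcup_(t in E) ball t d).
  by apply: bigcup_open => t _; exact: ball_open.
apply/seteqP; split => a [t Et h]; exists t => //; first by rewrite /ball/= distrC.
by rewrite distrC.
Qed.

Lemma nbdS d d' : d <= d' -> nbd d `<=` nbd d'.
Proof. by move=> dd a [t Et h]; exists t => //; exact: lt_le_trans dd. Qed.

(** The shell [m = 0] is unbounded: radii above [expR (-1)] are handled together, the factor
    [(1 + r)^-1] compensating for their size. *)
Definition Xm (m : nat) : set R :=
  [set r | expR (- m.+1%:R) < r /\ ((m == 0)%N \/ r <= expR (- m%:R))].

(** Away from the diagonal, [expR (- scaleP m l)] is the order of the window of distances: radius of
    size [expR (- m)] times the square of an angle of size [expR (- l)]. *)
Definition scaleP (m l : nat) : R := m%:R + 2 * l%:R.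

(** Pairs (radius [r], distance [s]) that can occur away from the diagonal. The three branches are
    [s] close to [r + t], [r - t] and [t - r] for some [t] in [E]. *)
Definition ZP (m l : nat) : set (R * R) :=
  let d := 129 * expR (- scaleP m l) in
  [set z | (1 + z.1) / 16 <= z.2 /\
     [\/ nbd d (z.2 - z.1), nbd d (z.1 - z.2) | nbd d (z.1 + z.2)]].

(** Near the diagonal [s] is comparable to the larger of [|r - t| ~ expR (- j)] and the angle. If
    [j <= l], then [s] is close to [|r - t|]; otherwise only the closeness of [r] to [E] is
    recorded. *)
Definition ZQ (j l : nat) : set (R * R) :=
  let d := 73 * expR (j%:R - 2 * l%:R) in
  let s := expR (- (minn j l)%:R) in
  [set z | [/\ z.1 < 3, s / 5 <= z.2, z.2 <= 5 * s &
     if (j <= l)%N then nbd d (z.1 - z.2) \/ nbd d (z.1 + z.2)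
     else nbd (expR (1 - j%:R)) z.1]].

Lemma sdist_sq (r t c : R) : 0 <= r -> 0 <= t -> -1 <= c <= 1 ->
  sdist r t c ^+ 2 = r ^+ 2 + t ^+ 2 - 2 * r * t * c.
Proof.
move=> r0 t0 /andP[c1 c2]; rewrite sqr_sqrtr//.
have h : 0 <= r * t by exact: mulr_ge0.
have := sqr_ge0 (r - t); nra.
Qed.

Lemma Xm_exists (r : R) : 0 < r -> exists m, Xm m r.
Proof.
move=> r0; have [r1|r1] := leP r 1.
  have [m [h1 h2]] := dyadic_scale r0 r1; exists m.
  by move: h1 h2; rewrite !mul1r => h1 h2; split; [|right].
exists 0%N; split; last by left.
by apply: le_lt_trans r1; rewrite expR_le1 oppr_le0.
Qed.

Lemma Xm_gt0 m (r : R) : Xm m r -> 0 < r.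
Proof. by move=> [h _]; exact: lt_trans (expR_gt0 _) h. Qed.

Lemma Xm_ratio_le m (r : R) : Xm m r -> r / (1 + r) <= expR (- m%:R).
Proof.
move=> Xr; have r0 := Xm_gt0 Xr; case: Xr => [_ []].
  move/eqP => ->; rewrite oppr0 expR0 ler_pdivrMr; lra.
move=> h; apply: le_trans h; rewrite ler_pdivrMr; nra.
Qed.

Lemma Xm_ratio_ge m (r : R) : Xm m r -> expR (- m%:R) / 8 <= r / (1 + r).
Proof.
move=> Xr; have r0 := Xm_gt0 Xr; case: Xr => [h _].
have h1 := @expRNS_ge R m.
have h2 : expR (- m%:R) <= 1 :> R by rewrite expR_le1 oppr_le0.
have h3 := expR_gt0 (- m%:R : R).
rewrite ler_pdivlMr; last lra.
set e := expR (- m%:R) in h1 h2 h3 *.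
have [r1|r1] := leP r 1.
  by have : 0 <= e * (1 - r) by [apply: mulr_ge0; lra]; lra.
by have : 0 <= (1 - e) * (1 + r) by [apply: mulr_ge0; lra]; lra.
Qed.

Section OnePiece.
Variables (r t e : R).
Hypotheses (r0 : 0 < r) (t1 : 1 <= t) (e1 : e = 1 \/ e = -1).

Let bnd := `|r - e * t|.
Let s p := sdist r t (e * cos p).

Let ssq p : s p ^+ 2 = r ^+ 2 + t ^+ 2 - 2 * r * t * (e * cos p).
Proof.
have t1' := t1; have r0' := r0;
apply: sdist_sq; [exact: ltW|lra|].
have := cos_geN1 p; have := cos_le1 p.
by move=> ? ?; case: e1 => ->; apply/andP; split; lra.
Qed.

Lemma sdist_bnd_sq p : s p ^+ 2 = bnd ^+ 2 + e * (2 * r * t * (1 - cos p)).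
Proof.
have t1' := t1; have r0' := r0;
by rewrite ssq /bnd real_normK ?num_real//; case: e1 => ->; ring.
Qed.

(** The derivative of the distance in the angle has absolute value [r t sin p / s p], which is at
    least of order [r a / S]; the argument uses differences of squares in its place. *)
Lemma sdist_expansive (D : set R) (a S : R) : 0 < a -> 0 < S ->
  (forall p, D p -> [/\ a <= p, p <= pi / 2 & s p <= S]) ->
  expansive_on D s (r * a / (4 * S)).
Proof.
have t1' := t1; have r0' := r0;
move=> a0 S0 DP x y.
wlog xy : x y / x <= y.
  move=> hw Dx Dy; have [/hw|/ltW/hw] := leP x y; first exact.
  by rewrite distrC [X in _ -> _ <= X]distrC; apply.
move=> /DP[ax xpi sx] /DP[ay ypi sy].
have sx0 : 0 <= s x by exact: sqrtr_ge0.
have sy0 : 0 <= s y by exact: sqrtr_ge0.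
have cxy := cos_sub_ge (le_trans (ltW a0) ax) xy ypi.
have key : `|s x - s y| * (s x + s y) = 2 * r * t * (cos x - cos y).
  rewrite -[X in _ * X = _]ger0_norm ?addr_ge0// -normrM -subr_sqr !ssq.
  rewrite (_ : _ - _ = - e * (2 * r * t * (cos x - cos y))); last by ring.
  rewrite normrM (_ : `|- e| = 1); last by case: e1 => ->; rewrite ?normrN ?normr1.
  rewrite mul1r ger0_norm//; apply: mulr_ge0; last nra.
  by rewrite !mulr_ge0//; lra.
have dxy : a * (y - x) / 4 <= cos x - cos y.
  apply: le_trans cxy; rewrite subr_sqr; nra.
have h1 : r * (a * (y - x) / 2) <= `|s x - s y| * (s x + s y).
  rewrite key.
  have : 0 <= r * (a * (y - x)) by rewrite !mulr_ge0//; lra.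
  have : r * (a * (y - x) / 4) <= r * (cos x - cos y) by apply: ler_wpM2l => //; lra.
  nra.
have h2 : `|s x - s y| * (s x + s y) <= `|s x - s y| * (2 * S).
  by apply: ler_wpM2l => //; lra.
rewrite (distrC x) (ger0_norm (_ : 0 <= y - x)); last lra.
rewrite mulrAC ler_pdivrMr; last lra.
have := le_trans h1 h2; lra.
Qed.

(** The difference of the squares of [s p] and [bnd] is [2 r t (1 - cos p)] in absolute value, at
    most [r t p^2]; one factor [s p + bnd >= bnd] is divided out. *)
Lemma sdist_window p : 0 <= p -> 0 < bnd -> `|s p - bnd| <= r * t * p ^+ 2 / bnd.
Proof.
have t1' := t1; have r0' := r0;
move=> p0 b0; rewrite ler_pdivlMr//.
have sp0 : 0 <= s p by exact: sqrtr_ge0.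
have h : `|s p - bnd| * (s p + bnd) = 2 * r * t * (1 - cos p).
  rewrite -[X in _ * X = _]ger0_norm ?addr_ge0 ?(ltW b0)// -normrM -subr_sqr sdist_bnd_sq.
  rewrite addrAC subrr add0r normrM (_ : `|e| = 1); last by case: e1 => ->; rewrite ?normrN ?normr1.
  have := cos_le1 p => c1; rewrite mul1r ger0_norm// !mulr_ge0//; lra.
have h2 : `|s p - bnd| * bnd <= `|s p - bnd| * (s p + bnd).
  by apply: ler_wpM2l => //; lra.
apply: (le_trans h2); rewrite h.
have := cos_ge_sqr p0.
have : 0 <= r * t by rewrite mulr_ge0//; lra.
nra.
Qed.

Lemma sdist_le_sum p : s p <= r + t.
Proof.
have t1' := t1; have r0' := r0;
apply: sqr_leP; first lra.
rewrite ssq; have := cos_geN1 p; have := cos_le1 p.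
have : 0 <= r * t by rewrite mulr_ge0//; lra.
by case: e1 => ->; nra.
Qed.

Lemma sdist_ge_bnd p : e = 1 -> bnd <= s p.
Proof.
have t1' := t1; have r0' := r0;
move=> ee; apply: sqr_leP; first exact: sqrtr_ge0.
rewrite sdist_bnd_sq ee; have := cos_le1 p.
have : 0 <= r * t by rewrite mulr_ge0//; lra.
nra.
Qed.

End OnePiece.
End Geometry.

(** * One piece away from the diagonal *)

Section Pieces.
Context {R : realType}.
Local Notation mu := (@lebesgue_measure R).
Local Notation pi := (@trigo.pi R).
Variable E : set R.

Lemma measurable_comp_set d (T : measurableType d) (f : T -> R) (A : set R) :
  measurable_fun setT f -> measurable A -> measurable [set z | A (f z)].
Proof. by move=> mf mA; rewrite -[X in measurable X]setTI; exact: mf. Qed.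

Lemma measurable_ZP m l : measurable (ZP E m l).
Proof.
pose N : set R := nbd E (129 * expR (- scaleP m l)).
have mN : measurable N by exact: measurable_nbd.
have m1 : measurable_fun setT (fun z : R * R => z.1) by exact: measurable_fst.
have m2 : measurable_fun setT (fun z : R * R => z.2) by exact: measurable_snd.
rewrite (_ : ZP E m l = [set z : R * R | (1 + z.1) / 16 <= z.2] `&`
  (([set z : R * R | N (z.2 - z.1)] `|` [set z : R * R | N (z.1 - z.2)]) `|` [set z : R * R | N (z.1 + z.2)])).
  apply: measurableI.
    apply: measurable_set_le => //.
    by apply: measurable_funM => //; exact: measurable_funD.
  by apply: measurableU; [apply: measurableU|]; apply: measurable_comp_set mN;
    [apply: measurable_funB|apply: measurable_funB|apply: measurable_funD].
apply/seteqP; split => z; rewrite /ZP -/N /=.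
  by case=> h1 [] h2; split => //; [left; left|left; right|right].
by case=> h1 [[]|] h2; split => //; [constructor 1|constructor 2|constructor 3].
Qed.

Lemma measurable_ZQ j l : measurable (ZQ E j l).
Proof.
pose s : R := expR (- (minn j l)%:R).
pose C := if (j <= l)%N then [set z : R * R | nbd E (73 * expR (j%:R - 2 * l%:R)) (z.1 - z.2)] `|`
    [set z : R * R | nbd E (73 * expR (j%:R - 2 * l%:R)) (z.1 + z.2)]
  else [set z : R * R | nbd E (expR (1 - j%:R)) z.1].
have mC : measurable C.
  rewrite /C; case: ifP => _; last exact: measurable_comp_set (measurable_nbd _ _).
  by apply: measurableU; apply: measurable_comp_set (measurable_nbd _ _);
    [apply: measurable_funB|apply: measurable_funD].
rewrite (_ : ZQ E j l = [set z : R * R | z.1 < 3] `&` [set z : R * R | s / 5 <= z.2] `&`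
   [set z : R * R | z.2 <= 5 * s] `&` C).
  repeat apply: measurableI => //.
  - by apply: measurable_set_lt => //; exact: measurable_fst.
  - by apply: measurable_set_le => //; exact: measurable_snd.
  - by apply: measurable_set_le => //; exact: measurable_snd.
apply/seteqP; split => z; rewrite /ZQ /C -/s /=.
  by case=> h1 h2 h3; case: ifP => _ h4; do !split.
by case=> [[[h1 h2] h3]]; case: ifP => _ h4; split.
Qed.

Lemma measurable_section (A : set (R * R)) (r : R) : measurable A ->
  measurable [set s | A (r, s)].
Proof.
by move=> mA; rewrite -[X in measurable X]setTI; apply: (@pair1_measurable _ _ _ _ r).
Qed.

Lemma expansive_onW (D : set R) (h : R -> R) c c' : c' <= c ->
  expansive_on D h c -> expansive_on D h c'.
Proof.
by move=> cc ex x y Dx Dy; apply: le_trans (ex _ _ Dx Dy); exact: ler_wpM2r.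
Qed.

Lemma measurable_sdist_cos r t e : measurable_fun setT (fun p : R => sdist r t (e * cos p)).
Proof.
apply: measurableT_comp; first exact: measurable_sdist.
by apply: measurable_funM => //; exact: measurable_cos.
Qed.

Lemma powR_le_max1 (x u : R) : 1 <= x -> 0 < u <= 1 -> x `^ u <= x.
Proof. by move=> x1 /andP[_ u1]; exact: ler1_powR. Qed.

Lemma expR_powR (x y : R) : expR x `^ y = expR (x * y).
Proof. by rewrite expRM. Qed.

Lemma powR_split_const (x B y u : R) : 0 <= x -> 1 <= B -> 0 <= y -> 0 < u <= 1 ->
  (2 * x) `^ (1 - u) * (B * y) `^ u <= 2 * B * (x `^ (1 - u) * y `^ u).
Proof.
move=> x0 B1 y0 u01; have B0 : 0 <= B by exact: le_trans B1.
rewrite !powRM// mulrACA; apply: ler_wpM2r; first by rewrite mulr_ge0// powR_ge0.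
apply: ler_pM; rewrite ?powR_ge0//; last exact: powR_le_max1.
by case/andP: u01 => *; apply: ler1_powR; lra.
Qed.

Variable g : R -> R.
Hypotheses (mg : measurable_fun setT g) (g0 : forall x, 0 <= g x).

(** Here [|r - e t| >= (1 + r) / 16], so all distances are comparable to [1 + r]. The expansion
    constant is then of order [r / (1 + r)] times the angle, that is [expR (- (m + l))], and the
    window has length of order [expR (- scaleP m l)]. *)
Lemma piece_P m l (r t e u : R) : 0 < u <= 1 -> Xm m r -> 1 <= t -> t <= 2 -> E t ->
  e = -1 \/ (e = 1 /\ 1 / 4 <= `|r - t|) ->
  (\int[mu]_(p in Phi l) (g (sdist r t (e * cos p)))%:E <=
   (8192 * expR (u * scaleP m l - l%:R))%:E *
   (((1 + r)^-1)%:E * \int[mu]_(s in [set s | ZP E m l (r, s)]) (g s `^ u^-1 * s)%:E) `^ u)%E.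
Proof.
move=> u01 Xr t1 t2 Et he.
have r0 := Xm_gt0 Xr.
have e1 : e = 1 \/ e = -1 by case: he => [|[]]; [right|left].
have el0 := expR_gt0 (- l%:R : R).
have el1 : expR (- l%:R) <= 1 :> R by rewrite expR_le1 oppr_le0.
have elS := @expRNS_ge R l.
have b_ge : (1 + r) / 16 <= `|r - e * t|.
  case: he => [->|[-> h]].
    by rewrite mulN1r opprK ger0_norm; lra.
  rewrite mul1r; have [r3|r3] := leP r 3; first lra.
  by rewrite ger0_norm; lra.
have b0 : 0 < `|r - e * t| by lra.
have PhiP p : Phi l p -> [/\ 0 < p, 2 * expR (- l.+1%:R) <= p, p <= 2 * expR (- l%:R) & p <= pi / 2].
  by case=> h1 h2 h3; split => //; lra.
have sge p : Phi l p -> (1 + r) / 16 <= sdist r t (e * cos p).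
  move=> /PhiP[p0 h1 h2 h3]; case: he => [ee|[ee _]].
    apply: sqr_leP; first exact: sqrtr_ge0.
    rewrite sdist_sq//; [|lra|lra|]; last first.
      have := cos_geN1 p; have := cos_le1 p => ? ?; rewrite ee; apply/andP; split; lra.
    have c0 : 0 <= cos p by apply: cos_ge0_pihalf; have := @pi_gt0 R; move=> ?; apply/andP; split; lra.
    have rt : 0 <= r * t * cos p by rewrite !mulr_ge0//; lra.
    have tt : 1 <= t ^+ 2 by nra.
    have rr := sqr_ge0 (r - 1).
    have r2 := sqr_ge0 r.
    rewrite ee; move: rt tt rr r2; clear; rewrite !expr2; lra.
  by apply: (le_trans b_ge); exact: sdist_ge_bnd.
have kpos : 0 < expR (- (m%:R + l%:R)) / 128 :> R by rewrite divr_gt0// expR_gt0.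
have ex : expansive_on (Phi l) (fun p => sdist r t (e * cos p)) (expR (- (m%:R + l%:R)) / 128).
  apply: expansive_onW; last first.
    apply: (@sdist_expansive R r t e r0 t1 e1 (Phi l) (2 * expR (- l.+1%:R)) (2 * (1 + r))).
    - by rewrite mulr_gt0// expR_gt0.
    - lra.
    - move=> p /PhiP[p0 h1 h2 h3]; split => //.
      apply: le_trans (sdist_le_sum r0 t1 e1 p) _; lra.
  rewrite (_ : _ / (4 * _) = r / (1 + r) * (expR (- l.+1%:R) / 4)); last by field; lra.
  rewrite opprD expRD -mulrA.
  apply: (@le_trans _ _ (expR (- m%:R) / 8 * (expR (- l%:R) / 16))).
    have := expR_gt0 (- m%:R : R); nra.
  apply: ler_pM; [by rewrite divr_ge0// expR_ge0|by rewrite divr_ge0// expR_ge0|exact: Xm_ratio_ge|].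
  lra.
have win p : Phi l p -> ZP E m l (r, sdist r t (e * cos p)).
  move=> Pp; split; first exact: sge.
  have [p0 h1 h2 h3] := PhiP _ Pp.
  have w := sdist_window r0 t1 e1 (ltW p0) b0.
  have w2 : `|sdist r t (e * cos p) - `|r - e * t| | < 129 * expR (- scaleP m l).
    apply: (le_lt_trans w).
    have ed : expR (- scaleP m l) = expR (- m%:R) * expR (- l%:R) ^+ 2 :> R.
      by rewrite /scaleP expr2 -!expRD; congr expR; ring.
    apply: (@le_lt_trans _ _ (128 * (r / (1 + r)) * expR (- l%:R) ^+ 2)).
      rewrite ler_pdivrMr//.
      have pp : p ^+ 2 <= 4 * expR (- l%:R) ^+ 2 by nra.
      have rt : r * t * p ^+ 2 <= r * 2 * (4 * expR (- l%:R) ^+ 2).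
        have q0 := sqr_ge0 p; have q1 : 0 <= r * t by rewrite mulr_ge0 ?(ltW r0)// (le_trans ler01).
        by apply: ler_pM => //; apply: ler_wpM2l => //; exact: ltW.
      apply: (le_trans rt).
      apply: (@le_trans _ _ (128 * (r / (1 + r)) * expR (- l%:R) ^+ 2 * ((1 + r) / 16))).
        by rewrite le_eqVlt; apply/orP; left; apply/eqP; field; lra.
      apply: ler_wpM2l => //; rewrite mulr_ge0 ?sqr_ge0// mulr_ge0//.
      by rewrite divr_ge0 ?(ltW r0)// addr_ge0// ltW.
    have e0 : 0 < expR (- scaleP m l) :> R by exact: expR_gt0.
    have xm := Xm_ratio_le Xr.
    have : r / (1 + r) * expR (- l%:R) ^+ 2 <= expR (- scaleP m l).
      by rewrite ed; apply: ler_wpM2r => //; exact: sqr_ge0.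
    lra.
  have sp0 : 0 <= sdist r t (e * cos p) by exact: sqrtr_ge0.
  set sp := sdist r t (e * cos p) in w2 sp0 *.
  case: e1 => ee.
    move: w2; rewrite ee mul1r; have [rt|rt] := leP t r.
      rewrite (@ger0_norm _ (r - t)) ?subr_ge0// => w2; constructor 2; exists t => //=.
      by rewrite (_ : r - sp - t = - (sp - (r - t))) ?normrN//; lra.
    rewrite (@ltr0_norm _ (r - t)) ?subr_lt0// => w2; constructor 3; exists t => //=.
    by rewrite (_ : r + sp - t = sp - - (r - t))//; lra.
  move: w2; rewrite ee mulN1r opprK (@ger0_norm _ (r + t)); last lra.
  move=> w2; constructor 1; exists t => //=.
  by rewrite (_ : sp - r - t = sp - (r + t))//; lra.
have w0 : 0 < (1 + r) / 16 by lra.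
have mW := measurable_section r (measurable_ZP m l).
have := @piece_le R (Phi l) [set s | ZP E m l (r, s)] (fun p => sdist r t (e * cos p)) g
  _ _ _ u kpos w0 u01 (measurable_Phi l) mW (measurable_sdist_cos r t e) ex win _ (measure_Phi l) mg g0.
move=> /(_ (fun s h => h.1)) /le_trans; apply.
rewrite poweRM ?lee_fin ?invr_ge0; [|lra|]; last first.
  apply: integral_ge0 => s [h _]; rewrite lee_fin mulr_ge0 ?powR_ge0//.
  by move: h => /=; lra.
rewrite poweR_EFin muleA; apply: lee_wpmul2r; first exact: poweR_ge0.
rewrite -EFinM lee_fin.
have n1 : expR (m%:R + l%:R) != 0 :> R by rewrite gt_eqF ?expR_gt0.
have r10 : 0 < 1 + r by rewrite addr_gt0.
have n2 : 1 + r != 0 by rewrite gt_eqF.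
(* [4096 = 2 * 128 * 16], from the expansion constant and the lower bound [(1 + r) / 16] of the
   distances. *)
rewrite (_ : 2 / _ / _ = 4096 * (expR (m%:R + l%:R) * (1 + r)^-1)); last first.
  by rewrite expRN; field; rewrite n1 n2.
have y0 : 0 <= expR (m%:R + l%:R) * (1 + r)^-1 by rewrite mulr_ge0 ?expR_ge0// invr_ge0 ltW.
have B1 : 1 <= 4096 :> R by lra.
apply: (le_trans (powR_split_const (ltW el0) B1 y0 u01)).
rewrite powRM ?expR_ge0 ?invr_ge0 ?(ltW r10)// !expR_powR.
rewrite (_ : u * scaleP m l - l%:R = - l%:R * (1 - u) + (m%:R + l%:R) * u); last by rewrite /scaleP; ring.
rewrite (_ : 2 * 4096 = 8192); last by ring.
by rewrite expRD !mulrA.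
Qed.

End Pieces.

(** * One piece near the diagonal *)

Section PieceQ.
Context {R : realType}.
Local Notation mu := (@lebesgue_measure R).
Local Notation pi := (@trigo.pi R).
Variable E : set R.
Variable g : R -> R.
Hypotheses (mg : measurable_fun setT g) (g0 : forall x, 0 <= g x).

(** Now [r] and [t] are bounded above and below, and [s^2] is comparable to [(r - t)^2 + p^2], so
    [s] is of size [L = expR (- min j l)]. The map expands by about [expR (- l) / L]. *)
Lemma piece_Q j l (r t u : R) : 0 < u <= 1 -> 0 < r -> 1 <= t -> t <= 2 -> E t ->
  `|r - t| < 1 / 4 -> expR (- j.+1%:R) < `|r - t| -> `|r - t| <= expR (- j%:R) ->
  (\int[mu]_(p in Phi l) (g (sdist r t (1 * cos p)))%:E <=
   (1280 * expR (- (1 - 2 * u) * l%:R))%:E *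
   (\int[mu]_(s in [set s | ZQ E j l (r, s)]) (g s `^ u^-1 * s)%:E) `^ u)%E.
Proof.
move=> u01 r0 t1 t2 Et b4 bj1 bj.
have e1 : (1 : R) = 1 \/ (1 : R) = -1 by left.
set b := `|r - t| in b4 bj1 bj *.
have b0 : 0 < b by apply: lt_trans bj1; exact: expR_gt0.
have [r1 r2] : 3 / 4 <= r /\ r <= 9 / 4.
  by move: b4; rewrite /b ltr_norml => /andP[]; split; lra.
have bE : `|r - 1 * t| = b by rewrite mul1r.
have [rt1 rt2] : 3 / 4 <= r * t /\ r * t <= 9 / 2 by split; nra.
have el0 := expR_gt0 (- l%:R : R).
have elS := @expRNS_ge R l.
have ej0 := expR_gt0 (- j%:R : R).
have ejS := @expRNS_ge R j.
pose L : R := expR (- (minn j l)%:R).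
have L0 : 0 < L by exact: expR_gt0.
have lL : expR (- l%:R) <= L by rewrite ler_expR lerN2 ler_nat geq_minr.
have jL : expR (- j%:R) <= L by rewrite ler_expR lerN2 ler_nat geq_minl.
have PhiP p : Phi l p -> [/\ 0 < p, 2 * expR (- l.+1%:R) <= p, p <= 2 * expR (- l%:R) & p <= pi / 2].
  by case=> h1 h2 h3; split => //; have := expR_gt0 (- l.+1%:R : R); lra.
have s0 p : 0 <= sdist r t (1 * cos p) by exact: sqrtr_ge0.
have ssq p : sdist r t (1 * cos p) ^+ 2 = b ^+ 2 + 1 * (2 * r * t * (1 - cos p)).
  by rewrite -bE; apply: sdist_bnd_sq.
have s_up p : Phi l p -> sdist r t (1 * cos p) <= 5 * L.
  move=> /PhiP[p0 h1 h2 h3]; apply: sqr_leP; first lra.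
  rewrite ssq; have cp := cos_ge_sqr (ltW p0).
  have cp0 : 0 <= 1 - cos p by have := cos_le1 p; lra.
  have p2 : p ^+ 2 <= 4 * L ^+ 2.
    rewrite (_ : 4 * L ^+ 2 = (2 * L) ^+ 2); last by ring.
    rewrite ler_sqr ?nnegrE; lra.
  have b2 : b ^+ 2 <= L ^+ 2 by rewrite ler_sqr ?nnegrE; lra.
  have h : r * t * (1 - cos p) <= 9 / 2 * (2 * L ^+ 2).
    apply: ler_pM => //; lra.
  rewrite exprMn; lra.
have s_lo p : Phi l p -> L / 5 <= sdist r t (1 * cos p).
  move=> Pp; have [p0 h1 h2 h3] := PhiP _ Pp.
  case: (leqP j l) => jl.
    have -> : L = expR (- j%:R) by rewrite /L (minn_idPl jl).
    have := sdist_ge_bnd r0 t1 e1 p (erefl _); rewrite bE; lra.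
  have LE : L = expR (- l%:R) by rewrite /L (minn_idPr (ltnW jl)).
  apply: sqr_leP => //.
  rewrite ssq; have cp := @cos_sub_ge R 0 p (lexx _) (ltW p0) h3.
  rewrite cos0 expr0n/= subr0 in cp.
  have pL : L / 2 <= p by rewrite LE; lra.
  have p2 : L ^+ 2 / 4 <= p ^+ 2.
    rewrite (_ : L ^+ 2 / 4 = (L / 2) ^+ 2); last by field.
    rewrite ler_sqr ?nnegrE; lra.
  have h : 3 / 4 * (L ^+ 2 / 32) <= r * t * (1 - cos p).
    have := sqr_ge0 L => LL; apply: ler_pM => //; lra.
  have := sqr_ge0 L; have := sqr_ge0 b => h5 h6.
  rewrite (_ : (L / 5) ^+ 2 = L ^+ 2 / 25); last by field.
  lra.
have kpos : 0 < expR (- l%:R) / L / 64 by rewrite !divr_gt0.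
have ex : expansive_on (Phi l) (fun p => sdist r t (1 * cos p)) (expR (- l%:R) / L / 64).
  apply: expansive_onW; last first.
    apply: (@sdist_expansive R r t 1 r0 t1 e1 (Phi l) (2 * expR (- l.+1%:R)) (5 * L)).
    - by rewrite mulr_gt0// expR_gt0.
    - lra.
    - by move=> p Pp; have [p0 h1 h2 h3] := PhiP _ Pp; split => //; exact: s_up.
  rewrite (_ : _ / (4 * _) = (r * expR (- l.+1%:R) / 10) / L); last by field; lra.
  rewrite mulrAC ler_wpM2r ?invr_ge0 ?(ltW L0)//.
  have : 3 / 4 * (expR (- l%:R) / 4) <= r * expR (- l.+1%:R) by apply: ler_pM => //; lra.
  lra.
have win p : Phi l p -> ZQ E j l (r, sdist r t (1 * cos p)).
  move=> Pp; have [p0 h1 h2 h3] := PhiP _ Pp.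
  split; [by rewrite /=; lra|exact: s_lo|exact: s_up|].
  case: (leqP j l) => jl /=; last first.
    exists t => //; apply: (le_lt_trans bj).
    by rewrite ltr_expR; lra.
  have w := sdist_window r0 t1 e1 (ltW p0); rewrite bE in w; move/(_ b0) in w.
  have w2 : `|sdist r t (1 * cos p) - b| < 73 * expR (j%:R - 2 * l%:R).
    have X0 := expR_gt0 (j%:R - 2 * l%:R : R).
    apply: (le_lt_trans w); apply: (@le_lt_trans _ _ (72 * expR (j%:R - 2 * l%:R))); last lra.
    rewrite ler_pdivrMr//.
    have XE : expR (j%:R - 2 * l%:R) * expR (- j%:R) = expR (- l%:R) ^+ 2 :> R.
      by rewrite expr2 -!expRD; congr expR; ring.
    have p2 : p ^+ 2 <= 4 * expR (- l%:R) ^+ 2.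
      rewrite (_ : 4 * _ ^+ 2 = (2 * expR (- l%:R)) ^+ 2); last by ring.
      rewrite ler_sqr ?nnegrE; lra.
    have h : r * t * p ^+ 2 <= 9 / 2 * (4 * expR (- l%:R) ^+ 2).
      apply: ler_pM => //; [lra|exact: sqr_ge0].
    have h' : expR (j%:R - 2 * l%:R) * (expR (- j%:R) / 4) <= expR (j%:R - 2 * l%:R) * b.
      by apply: ler_wpM2l; lra.
    lra.
  set sp := sdist _ _ _ in w2 *.
  move: w2; rewrite /b; have [rt|rt] := leP t r.
    rewrite (@ger0_norm _ (r - t)) ?subr_ge0// => w2; left; exists t => //=.
    by rewrite (_ : r - sp - t = - (sp - (r - t))) ?normrN//; lra.
  rewrite (@ltr0_norm _ (r - t)) ?subr_lt0// => w2; right; exists t => //=.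
  by rewrite (_ : r + sp - t = sp - - (r - t))//; lra.
have w0 : 0 < L / 5 by lra.
have mW := measurable_section r (measurable_ZQ E j l).
have := @piece_le R (Phi l) [set s | ZQ E j l (r, s)] (fun p => sdist r t (1 * cos p)) g
  _ _ _ u kpos w0 u01 (measurable_Phi l) mW (measurable_sdist_cos r t 1) ex win _ (measure_Phi l) mg g0.
have Zs s : ZQ E j l (r, s) -> L / 5 <= s by case.
move=> /(_ Zs) /le_trans; apply.
apply: lee_wpmul2r; first exact: poweR_ge0.
rewrite lee_fin.
have n1 : expR (l%:R) != 0 :> R by rewrite gt_eqF ?expR_gt0.
(* The size [L] cancels between the expansion constant and the weight [s >= L / 5], which is why [j]
   is absent from the constant; [640 = 2 * 64 * 5]. *)
rewrite (_ : 2 / _ / _ = 640 * expR (l%:R)); last first.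
  by rewrite expRN; field; rewrite n1 gt_eqF.
have B1 : 1 <= 640 :> R by lra.
apply: (le_trans (powR_split_const (ltW el0) B1 (expR_ge0 _) u01)).
rewrite !expR_powR (_ : - (1 - 2 * u) * l%:R = - l%:R * (1 - u) + l%:R * u); last by ring.
rewrite (_ : 2 * 640 = 1280); last by ring.
by rewrite expRD.
Qed.

End PieceQ.

(** * Measures of sections from covering numbers *)

Section Counting.
Context {R : realType}.
Local Notation mu := (@lebesgue_measure R).

Lemma covnum_le (F : set R) (d w C : R) : 0 < w <= 1 ->
  (w%:E * covnum F d <= C%:E)%E ->
  exists2 n : nat, Defs.covered_by F d n & n%:R <= (`|C| + 1) / w.
Proof.
move=> /andP[w0 w1]; rewrite -lee_pdivlMl// => h.
have h2 : (covnum F d < ((`|C| + 1) / w)%:E)%E.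
  apply: (le_lt_trans h); rewrite -EFinM lte_fin mulrC ltr_pM2r ?invr_gt0//.
  by rewrite (le_lt_trans (ler_norm C))// ltrDl.
have [x [n cn <-] nx] := ereal_inf_lt h2.
by exists n => //; rewrite -lee_fin ltW.
Qed.

Lemma powR_invK (A y : R) : 0 <= A -> ((A^-1) `^ y)^-1 = A `^ y.
Proof. by move=> A0; rewrite -powRN -powR_inv1// -powRrM mulN1r opprK. Qed.

Lemma measure_itvcc (a w : R) : 0 <= w -> mu `[a, a + w]%classic = w%:E.
Proof.
move=> w0; rewrite lebesgue_measure_itv/= lte_fin; case: ifPn => [_|].
  by rewrite -EFinB addrAC subrr add0r.
by rewrite -leNgt => h; congr (_%:E); lra.
Qed.

(** Each covering interval of [F], enlarged by [d] on both sides and pulled back by the isometry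
    [r |-> s r + tau], contributes length [2 d + d']. *)
Lemma measure_covered (F A : set R) (d d' s : R) (tau : R) (n : nat) :
  0 <= d -> 0 <= d' -> s = 1 \/ s = -1 ->
  Defs.covered_by F d' n -> measurable A ->
  (forall r, A r -> exists2 t, F t & `|s * r + tau - t| < d) ->
  (mu A <= (n%:R * (2 * d + d'))%:E)%E.
Proof.
move=> d0 d0' s1 [c Fc] mA AF.
(* The left ends are extended to all of [nat] by a default value, as the finite union is indexed by
   natural numbers; only [i < n] is used. *)
pose lo (i : nat) := oapp c 0 (insub i) - d - tau.
pose I (i : nat) : set R := if s == 1 then `[lo i, lo i + (2 * d + d')]%classic
  else `[- (lo i + (2 * d + d')), - (lo i + (2 * d + d')) + (2 * d + d')]%classic.
have mI i : measurable (I i) by rewrite /I; case: ifP.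
have w0 : 0 <= 2 * d + d' by rewrite addr_ge0// mulr_ge0.
have muI i : (mu (I i) <= (2 * d + d')%:E)%E.
  by rewrite /I; case: ifP => _; rewrite measure_itvcc.
apply: (@le_trans _ _ (\sum_(i < n) mu (I i))%E).
  suff sub : A `<=` \big[setU/set0]_(i < n) I i by apply: (@content_subadditive _ _ _ mu) => // k _; exact: mI.
  move=> r Ar; have [t Ft h] := AF r Ar; have [i _ ci] := Fc _ Ft.
  rewrite -bigcup_mkord; exists (val i) => /=; first exact: ltn_ord.
  have loE : lo (val i) = c i - d - tau by rewrite /lo valK.
  move: ci; rewrite /= in_itv/= => /andP[c1 c2].
  move: h; rewrite ltr_norml => /andP[h1 h2].
  rewrite /I loE; case: s1 => se.
    by rewrite se eqxx/= in_itv/=; move: h1 h2; rewrite se mul1r => h1 h2; apply/andP; split; lra.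
  rewrite se ifF/=; last by apply/negbTE; rewrite lt_eqF//; lra.
  by rewrite in_itv/=; move: h1 h2; rewrite se mulN1r => h1 h2; apply/andP; split; lra.
apply: (@le_trans _ _ (\sum_(i < n) (2 * d + d')%:E)%E); first exact: lee_sum.
by rewrite sumEFin sumr_const card_ord -(mulr_natl (2 * d + d') n).
Qed.

Variables (E : set R) (beta gamma : R).
Hypotheses (E12 : E `<=` `[1, 2]%classic).
Hypotheses (beta0 : 0 <= beta) (beta1 : beta < 1).

Definition minkowski_bound : Prop := exists C : R, forall delta : R, 0 < delta < 1 ->
   ((delta `^ beta)%:E * covnum E delta <= C%:E)%E.

Definition assouad_bound : Prop := exists C : R, forall delta : R, 0 < delta < 1 ->
   forall a b : R, delta <= b - a ->
   (((delta / (b - a)) `^ gamma)%:E * covnum (E `&` `[a, b]%classic) delta <= C%:E)%E.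

(** Intervals of half the length [expR (- x)] keep [delta < 1] also at [x = 0]; the price is at most
    a factor 2. *)
Lemma cover_beta : minkowski_bound -> exists2 C : R, 0 <= C & forall x : R, 0 <= x ->
  exists2 n : nat, Defs.covered_by E (expR (- x) / 2) n & n%:R <= C * expR (beta * x).
Proof.
have b0 := beta0; have b1 := beta1.
move=> [C HC]; exists (2 * (`|C| + 1)); first by rewrite mulr_ge0// addr_ge0.
move=> x x0; have ex0 := expR_gt0 (- x).
have ex1 : expR (- x) <= 1 by rewrite expR_le1 oppr_le0.
have d01 : 0 < expR (- x) / 2 < 1 by apply/andP; split; lra.
have w1 : 0 < (expR (- x) / 2) `^ beta <= 1.
  rewrite powR_gt0; last lra.
  apply: (@le_trans _ _ (1 `^ beta)); last by rewrite powR1.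
  by apply: ge0_ler_powR; rewrite ?nnegrE//; lra.
have [n cn nC] := covnum_le w1 (HC _ d01).
exists n => //; apply: (le_trans nC).
have -> : expR (- x) / 2 = (2 * expR x)^-1 by rewrite expRN invfM mulrC.
rewrite powR_invK ?mulr_ge0 ?expR_ge0// powRM ?expR_ge0// expR_powR (mulrC x).
rewrite mulrA [2 * _]mulrC; apply: ler_wpM2r; first exact: expR_ge0.
apply: ler_wpM2l; first by rewrite addr_ge0.
by apply: ler1_powR; lra.
Qed.

Lemma cover_gamma : 0 <= gamma -> gamma <= 1 -> assouad_bound -> exists2 C : R, 0 <= C & forall x a b : R, 0 <= x -> expR (- x) <= b - a ->
  exists2 n : nat, Defs.covered_by (E `&` `[a, b]%classic) (expR (- x) / 2) n & n%:R <= C * (expR x * (b - a)) `^ gamma.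
Proof.
move=> g0 g1 [C HC]; exists (2 * (`|C| + 1)); first by rewrite mulr_ge0// addr_ge0.
move=> x a b x0 xab; have ex0 := expR_gt0 (- x).
have ex1 : expR (- x) <= 1 by rewrite expR_le1 oppr_le0.
have d01 : 0 < expR (- x) / 2 < 1 by apply/andP; split; lra.
have dab : expR (- x) / 2 <= b - a by lra.
have ab : 0 < b - a by lra.
have w1 : 0 < (expR (- x) / 2 / (b - a)) `^ gamma <= 1.
  rewrite powR_gt0; last by rewrite !divr_gt0.
  apply: (@le_trans _ _ (1 `^ gamma)); last by rewrite powR1.
  apply: ge0_ler_powR; rewrite ?nnegrE//; first by rewrite !divr_ge0// ltW.
  by rewrite ler_pdivrMr// mul1r.
have [n cn nC] := covnum_le w1 (HC _ d01 _ _ dab).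
exists n => //; apply: (le_trans nC).
have -> : expR (- x) / 2 / (b - a) = (2 * (expR x * (b - a)))^-1.
  by rewrite expRN !invfM mulrA (mulrC 2^-1).
have X0 : 0 <= expR x * (b - a) by rewrite mulr_ge0 ?expR_ge0// ltW.
rewrite powR_invK ?mulr_ge0 ?expR_ge0 ?(ltW ab)// powRM//.
rewrite mulrA [2 * _]mulrC; apply: ler_wpM2r; first exact: powR_ge0.
apply: ler_wpM2l; first by rewrite addr_ge0.
by apply: ler1_powR => //; lra.
Qed.

(* The three branches of [ZP] are translates/reflections of the neighbourhood of [E] in the variable [r]. *)
Lemma measure_branch (C M x d : R) (X : set R) (F : set R) (n : nat) (s tau : R) :
  0 <= M -> s = 1 \/ s = -1 -> measurable X -> Defs.covered_by F (expR (- x) / 2) n ->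
  d <= M * expR (- x) -> n%:R <= C ->
  (forall r t, X r -> E t -> `|s * r + tau - t| < d -> F t) ->
  (mu (X `&` [set r : R | nbd E d (s * r + tau)%R]) <= ((2 * M + 1) * C * expR (- x))%:E)%E.
Proof.
move=> M0 s1 mX cov dM nC XF.
have ex0 := expR_gt0 (- x).
have md : measurable (X `&` [set r : R | nbd E d (s * r + tau)%R]).
  apply: measurableI => //; apply: measurable_comp_set; last exact: measurable_nbd.
  by apply: measurable_funD => //; exact: measurable_funM.
have h : forall r, (X `&` [set r : R | nbd E d (s * r + tau)%R]) r ->
    exists2 t, F t & `|s * r + tau - t| < M * expR (- x).
  move=> r [Xr [t Et h]]; exists t; first exact: XF h.
  exact: lt_le_trans dM.
have Me : 0 <= M * expR (- x) by rewrite mulr_ge0// ltW.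
have ex2 : 0 <= expR (- x) / 2 by lra.
apply: (le_trans (measure_covered Me ex2 s1 cov md h)).
rewrite lee_fin; have n0 : (0 : R) <= n%:R by [].
rewrite (_ : (2 * M + 1) * C * expR (- x) = C * (2 * (M * expR (- x)) + expR (- x))); last by ring.
by apply: ler_pM => //; lra.
Qed.

Lemma measurable_Xm m : measurable (@Xm R m).
Proof.
case: m => [|m].
  rewrite (_ : Xm 0 = [set r : R | expR (- 1%:R) < r]); first exact: measurable_set_lt.
  by apply/seteqP; split => r /=; [case|move=> h; split => //; left].
rewrite (_ : Xm m.+1 = `]expR (- m.+2%:R), expR (- m.+1%:R)]%classic)//.
apply/seteqP; split => r; rewrite /Xm /= in_itv/=; first by case=> -> [].
by case/andP => h1 h2; split => //; right.
Qed.

Lemma mu_union3 (A B C D : set R) (b : R) :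
  measurable A -> measurable B -> measurable C -> D `<=` A `|` B `|` C -> measurable D ->
  (mu A <= b%:E)%E -> (mu B <= b%:E)%E -> (mu C <= b%:E)%E ->
  (mu D <= (3 * b)%:E)%E.
Proof.
move=> mA mB mC sub mD hA hB hC.
have mAB : measurable (A `|` B) by exact: measurableU.
apply: (@le_trans _ _ (mu (A `|` B `|` C))).
  by apply: le_measure => //; rewrite inE//; exact: measurableU.
have -> : (3 * b)%:E = (b%:E + b%:E + b%:E)%E by rewrite -!EFinD; congr (_%:E); ring.
apply: (le_trans (measureU2 mu mAB mC)); apply: leeD => //.
by apply: (le_trans (measureU2 mu mA mB)); exact: leeD.
Qed.

Definition secP m l (s : R) : set R := Xm m `&` [set r | ZP E m l (r, s)].

Lemma measurable_secP m l s : measurable (secP m l s).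
Proof.
apply: measurableI; first exact: measurable_Xm.
by rewrite -[X in measurable X]setTI; apply: (@pair2_measurable _ _ _ _ s) => //; exact: measurable_ZP.
Qed.

Lemma secP_measure m l s b :
  (forall s' tau : R, s' = 1 \/ s' = -1 ->
    (mu (Xm m `&` [set r | nbd E (129 * expR (- scaleP m l))%R (s' * r + tau)%R]) <= b%:E)%E) ->
  (mu (secP m l s) <= (3 * b)%:E)%E.
Proof.
move=> h.
have mb (s' tau : R) : measurable (Xm m `&` [set r | nbd E (129 * expR (- scaleP m l))%R (s' * r + tau)%R]).
  apply: measurableI; first exact: measurable_Xm.
  apply: measurable_comp_set; last exact: measurable_nbd.
  by apply: measurable_funD => //; exact: measurable_funM.
apply: (@mu_union3 _ _ _ _ b (mb (-1) s) (mb 1 (- s)) (mb 1 s) _ (measurable_secP m l s)).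
- move=> r [Xr [_ [] /= zr]].
  + by left; left; split => //=; rewrite mulN1r addrC.
  + by left; right; split => //=; rewrite mul1r.
  + by right; split => //=; rewrite mul1r.
- by apply: h; right.
- by apply: h; left.
- by apply: h; left.
Qed.

Lemma scaleP_ge0 m l : 0 <= scaleP m l :> R.
Proof. by rewrite addr_ge0// mulr_ge0. Qed.

Lemma count_P_beta : minkowski_bound -> exists2 C : R, 0 <= C & forall m l (s : R),
  (mu (secP m l s) <= (C * expR (beta * scaleP m l - scaleP m l))%:E)%E.
Proof.
move=> /cover_beta[C C0 HC]; exists (3 * ((2 * 129 + 1) * C)); first by rewrite !mulr_ge0//; lra.
move=> m l s; have [n cn nC] := HC _ (scaleP_ge0 m l).
rewrite -mulrA; apply: secP_measure => s' tau s1.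
apply: (le_trans (@measure_branch _ 129 (scaleP m l) _ (Xm m) E n s' tau _ s1 (measurable_Xm m) cn (lexx _) nC _)) => //.
rewrite lee_fin expRD mulrA -!mulrA; lra.
Qed.

(** For [m > 0] the radius is at most [expR (- m)], so for fixed [s] only the [t] within order
    [expR (- m)] of [s] or [-s] matter. The Assouad bound at scale [expR (- scaleP m l)] on this
    interval gives [(expR (scaleP m l - m))^gamma = expR (2 gamma l)]. *)
Lemma count_P_gamma : 0 <= gamma -> gamma <= 1 -> assouad_bound ->
  exists2 C : R, 0 <= C & forall m l (s : R),
  (mu (secP m l s) <= (C * expR (gamma * (2 * l%:R) - scaleP m l))%:E)%E.
Proof.
move=> g0 g1 /(cover_gamma g0 g1)[C C0 HC].
exists (3 * ((2 * 129 + 1) * (260 * C))); first by rewrite !mulr_ge0//; lra.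
move=> m l s; rewrite -mulrA; apply: secP_measure => s' tau s1.
have ex0 := expR_gt0 (- scaleP m l : R).
have em0 := expR_gt0 (- m%:R : R).
have em1 : expR (- scaleP m l) <= expR (- m%:R) :> R by rewrite ler_expR lerN2 lerDl mulr_ge0.
have ek1 : expR (- scaleP m l) <= 1 :> R by rewrite expR_le1 oppr_le0 scaleP_ge0.
have e2l : expR (scaleP m l) * expR (- m%:R) = expR (2 * l%:R) :> R.
  by rewrite -expRD; congr expR; rewrite /scaleP; ring.
pose a : R := if m == 0%N then 1 else tau - expR (- m%:R) - 129 * expR (- scaleP m l).
pose b : R := if m == 0%N then 2 else tau + expR (- m%:R) + 129 * expR (- scaleP m l).
have [ab abu] : expR (- scaleP m l) <= b - a /\ b - a <= 260 * expR (- m%:R).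
  rewrite /a /b; case: eqP => [m0|_]; last by split; lra.
  have em : expR (- m%:R) = 1 :> R by rewrite m0 oppr0 expR0.
  by split; lra.
have [n cn nC] := HC _ _ _ (scaleP_ge0 m l) ab.
have nC' : n%:R <= 260 * C * expR (gamma * (2 * l%:R)).
  apply: (le_trans nC); rewrite mulrAC mulrC; apply: ler_wpM2r => //.
  apply: (@le_trans _ _ ((260 * expR (2 * l%:R)) `^ gamma)).
    apply: ge0_ler_powR; rewrite ?nnegrE//.
    - by rewrite mulr_ge0 ?expR_ge0//; lra.
    - by rewrite -e2l mulrCA; apply: ler_wpM2l => //; exact: expR_ge0.
  rewrite powRM ?expR_ge0// expR_powR (mulrC gamma); apply: ler_wpM2r; first exact: expR_ge0.
  by apply: ler1_powR => //; lra.
apply: (le_trans (@measure_branch _ 129 (scaleP m l) _ (Xm m) _ n s' tau _ s1 (measurable_Xm m) cn (lexx _) nC' _)) => //.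
  move=> r t [Xr Xr'] Et h; split => //.
  have := E12 Et; rewrite /= !in_itv/= => t12.
  rewrite /a /b; case: eqP => [//|/eqP m0].
  have rm : r <= expR (- m%:R) by case: Xr' => //; rewrite (negbTE m0).
  have r0 : 0 < r by apply: lt_trans Xr; exact: expR_gt0.
  move: h; rewrite ltr_norml => /andP[h1 h2].
  by case: s1 h1 h2 => ->; rewrite ?mul1r ?mulN1r => h1 h2; apply/andP; split; lra.
rewrite lee_fin expRD -!mulrA; lra.
Qed.

Definition secQ j l (s : R) : set R := [set r | ZQ E j l (r, s)].

Lemma measurable_secQ j l s : measurable (secQ j l s).
Proof.
by rewrite -[X in measurable X]setTI; apply: (@pair2_measurable _ _ _ _ s) => //; exact: measurable_ZQ.
Qed.

(** For fixed [s] the radius lies in a translate of the neighbourhood of [E] at scale [expR (- x)],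
    with [x = 2 l - j] or [x = j]; about [expR (beta x)] intervals of that length cover it. *)
Lemma count_Q : minkowski_bound -> exists2 C : R, 0 <= C & forall j l (s : R),
  (mu (secQ j l s) <= (C * expR (- (1 - beta) * (if (j <= l)%N then 2 * l%:R - j%:R else j%:R)))%:E)%E.
Proof.
move=> /cover_beta[C C0 HC]; exists (2 * ((2 * 73 + 1) * C)); first by rewrite !mulr_ge0//; lra.
move=> j l s; have ms := measurable_secQ j l s.
have mb (d s' tau : R) : measurable (setT `&` [set r : R | nbd E d (s' * r + tau)%R]).
  apply: measurableI => //.
  apply: measurable_comp_set; last exact: measurable_nbd.
  by apply: measurable_funD => //; exact: measurable_funM.
set x : R := if _ then _ else _.
have x0 : 0 <= x.
  rewrite /x; case: ifPn => // jl; rewrite subr_ge0.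
  have : (j%:R <= l%:R :> R) by rewrite ler_nat.
  have : (0 <= l%:R :> R) by []. lra.
have [n cn nC] := HC _ x0.
have B (M d s' tau : R) : 0 <= M -> M <= 73 -> d <= M * expR (- x) -> s' = 1 \/ s' = -1 ->
    (mu (setT `&` [set r : R | nbd E d (s' * r + tau)%R]) <= ((2 * 73 + 1) * C * expR (- (1 - beta) * x))%:E)%E.
  move=> M0 M73 dM s1.
  apply: (le_trans (@measure_branch _ M x d setT E n s' tau M0 s1 measurableT cn dM nC _)) => //.
  rewrite lee_fin.
  rewrite (_ : - (1 - beta) * x = beta * x + - x); last by ring.
  rewrite expRD !mulrA -!mulrA.
  have : 0 <= C * (expR (beta * x) * expR (- x)) by rewrite !mulr_ge0 ?expR_ge0.
  set y := C * _ => y0; nra.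
have e1 := @expRN1_ge R.
have [jl|jl] := leqP j l.
  have xE : x = 2 * l%:R - j%:R by rewrite /x jl.
  have dE : 73 * expR (j%:R - 2 * l%:R) <= 73 * expR (- x) by rewrite xE opprB.
  have M0 : 0 <= 73 :> R by lra.
  have h1 := B 73 _ 1 (- s) M0 (lexx _) dE (or_introl erefl).
  have h2 := B 73 _ 1 s M0 (lexx _) dE (or_introl erefl).
  apply: (@le_trans _ _ (mu ((setT `&` [set r : R | nbd E (73 * expR (j%:R - 2 * l%:R))%R (1 * r + - s)%R]) `|` (setT `&` [set r : R | nbd E (73 * expR (j%:R - 2 * l%:R))%R (1 * r + s)%R])))).
    apply: le_measure => //; rewrite ?inE//; first by apply: measurableU; exact: mb.
    move=> r [/= _ _ _]; rewrite jl !mul1r; case=> h; [left|right]; split => //=; by rewrite mul1r.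
  apply: (le_trans (measureU2 mu (mb _ _ _) (mb _ _ _))).
  apply: (le_trans (leeD h1 h2)); rewrite -EFinD lee_fin.
  by rewrite le_eqVlt; apply/orP; left; apply/eqP; ring.
have xE : x = j%:R by rewrite /x leqNgt jl.
have dE : expR (1 - j%:R) <= 4 * expR (- x).
  rewrite xE expRD; apply: ler_wpM2r; first exact: expR_ge0.
  have e0 := expR_gt0 (1 : R).
  have : expR 1 * expR (- 1) = 1 :> R by rewrite -expRD subrr expR0.
  have : expR 1 * (1 / 4) <= expR 1 * expR (- 1) :> R by apply: ler_wpM2l => //; exact: ltW.
  lra.
have M0 : 0 <= 4 :> R by lra.
have M1 : 4 <= 73 :> R by lra.
have h := B 4 _ 1 0 M0 M1 dE (or_introl erefl).
apply: (@le_trans _ _ (mu (setT `&` [set r : R | nbd E (expR (1 - j%:R))%R (1 * r + 0)%R]))).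
  apply: le_measure => //; rewrite ?inE//; first exact: mb.
  by move=> r [/= _ _ _]; rewrite leqNgt jl/= => h'; split => //=; rewrite mul1r addr0.
apply: (le_trans h); rewrite lee_fin -!mulrA ler_peMl//; last lra.
by rewrite !mulr_ge0 ?expR_ge0//; lra.
Qed.

End Counting.

(** * Exponential sums bounded uniformly in their centres *)

Section Sums.
Context {R : realType}.

Lemma nneseries_ge_term (f : nat -> \bar R) (k : nat) : (forall n, 0 <= f n)%E ->
  (f k <= \sum_(n <oo) f n)%E.
Proof.
move=> f0; apply: le_trans (nneseries_lim_ge k.+1 _); last by move=> n _ _; exact: f0.
rewrite big_mkord big_ord_recr/= leeDr// sume_ge0//.
Qed.

Lemma nneseries_le (f : nat -> R) (C : R) : (forall n, 0 <= f n) ->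
  (forall N : nat, \sum_(n < N) f n <= C) -> (\sum_(n <oo) (f n)%:E <= C%:E)%E.
Proof.
move=> f0 fC; apply: lime_le; first by apply: is_cvg_nneseries => n _ _; rewrite lee_fin.
by apply: nearW => N; rewrite big_mkord sumEFin lee_fin.
Qed.

Definition step_fun (eta K y : R) : R :=
  if y <= 0 then K * expR (eta * y) else 2 * K - K * expR (- (eta * y)).

(* The increments of the bounded function [step_fun] dominate the terms, so the sum telescopes. *)
Lemma step_fun_incr (eta K y : R) : 0 < eta -> K * (1 - expR (- eta)) = 1 ->
  expR (- (eta * `|y|)) <= step_fun eta K (y + 1) - step_fun eta K y.
Proof.
move=> eta0 K1.
have q1 : expR (- eta) < 1 by rewrite expR_lt1 oppr_lt0.
have q0 := expR_gt0 (- eta).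
have K0 : 0 < K.
  rewrite ltNge; apply/negP => K0.
  have : K * (1 - expR (- eta)) <= 0 by apply: mulr_le0_ge0 => //; lra.
  by rewrite K1; lra.
have Q1 : 1 <= expR eta by rewrite -expR0 ler_expR ltW.
have qQ : expR eta * expR (- eta) = 1 by rewrite -expRD subrr expR0.
rewrite /step_fun; have [y0|y0] := leP y 0; have [y1|y1] := leP (y + 1) 0; last 2 first.
- lra.
- rewrite gtr0_norm//.
  have -> : expR (- (eta * (y + 1))) = expR (- (eta * y)) * expR (- eta).
    by rewrite -expRD; congr expR; ring.
  set z := expR (- (eta * y)).
  rewrite le_eqVlt; apply/orP; left; apply/eqP.
  by rewrite -[LHS]mulr1 -K1; ring.
- rewrite ler0_norm// mulrN opprK.
  have -> : expR (eta * (y + 1)) = expR (eta * y) * expR eta.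
    by rewrite -expRD; congr expR; ring.
  have z0 := expR_ge0 (eta * y).
  rewrite (_ : _ - _ = expR (eta * y) * (K * (expR eta - 1))); last by ring.
  rewrite ler_peMr//.
  have -> : K * (expR eta - 1) = expR eta * (K * (1 - expR (- eta))).
    have -> : expR eta * (K * (1 - expR (- eta))) = K * (expR eta - expR eta * expR (- eta)) by ring.
    by rewrite qQ.
  by rewrite K1 mulr1.
- rewrite ler0_norm// mulrN opprK.
  set a := expR (eta * y); set b := expR (- (eta * (y + 1))).
  have a1 : a <= 1 by rewrite expR_le1 mulr_ge0_le0 ?(ltW eta0).
  have b1 : b <= 1 by rewrite expR_le1 oppr_le0 mulr_ge0 ?(ltW eta0) ?(ltW y1).
  have ab : a * b = expR (- eta) by rewrite /a /b -expRD; congr expR; ring.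
  have h : 0 <= (1 - a) * (1 - b) by apply: mulr_ge0; lra.
  have h2 : 1 - expR (- eta) <= 2 - a - b by rewrite -ab; lra.
  have h3 : K * (1 - expR (- eta)) <= K * (2 - a - b) by apply: ler_wpM2l => //; exact: ltW.
  by rewrite K1 in h3; lra.
Qed.

Lemma step_fun_bound (eta K y : R) : 0 < eta -> 0 <= K -> 0 <= step_fun eta K y <= 2 * K.
Proof.
move=> e0 K0; rewrite /step_fun; have [y0|y0] := leP y 0.
  have h0 := expR_ge0 (eta * y).
  have h1 : expR (eta * y) <= 1 by rewrite expR_le1 pmulr_rle0.
  by apply/andP; split; nra.
have h0 := expR_ge0 (- (eta * y)).
have h1 : expR (- (eta * y)) <= 1 by rewrite expR_le1 oppr_le0 mulr_ge0// ltW.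
by apply/andP; split; nra.
Qed.

Lemma exp_sum (eta : R) : 0 < eta -> exists2 C : R, 0 <= C &
  forall (a : R) (N : nat), \sum_(n < N) expR (- (eta * `|n%:R - a|)) <= C.
Proof.
move=> e0; have q1 : expR (- eta) < 1 by rewrite expR_lt1 oppr_lt0.
pose K := (1 - expR (- eta))^-1.
have K0 : 0 <= K by rewrite invr_ge0; lra.
have K1 : K * (1 - expR (- eta)) = 1 by rewrite mulVf// gt_eqF//; lra.
exists (2 * K); first by rewrite mulr_ge0.
move=> a N.
suff : \sum_(n < N) expR (- (eta * `|n%:R - a|)) <= step_fun eta K (N%:R - a) - step_fun eta K (0 - a).
  have /andP[_ h1] := step_fun_bound (N%:R - a) e0 K0.
  have /andP[h2 _] := step_fun_bound (0 - a) e0 K0.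
  lra.
elim: N => [|N IH]; first by rewrite big_ord0 subrr.
rewrite big_ord_recr/=.
have h := step_fun_incr (N%:R - a) e0 K1.
rewrite (_ : N.+1%:R - a = N%:R - a + 1); last by rewrite -natr1; ring.
lra.
Qed.

Lemma exp_series (eta : R) : 0 < eta -> exists2 C : R, 0 <= C &
  forall a : R, (\sum_(n <oo) (expR (- (eta * `|n%:R - a|)))%:E <= C%:E)%E.
Proof.
move=> /exp_sum[C C0 HC]; exists C => // a; apply: nneseries_le => // n; exact: expR_ge0.
Qed.

(** The constant must not depend on [a] and [b]: in the applications these depend on the point [s]
    and on the size of the function there. *)
Lemma exp_series2 (eta : R) : 0 < eta -> exists2 C : R, 0 <= C &
  forall (a b B : R) (F : nat -> nat -> R), 0 <= B -> (forall i j, 0 <= F i j) ->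
  (forall i j, F i j <= B * expR (- (eta * `|i%:R - a|)) * expR (- (eta * `|j%:R - b|))) ->
  (\sum_(i <oo) \sum_(j <oo) (F i j)%:E <= (B * C)%:E)%E.
Proof.
move=> /exp_series[C C0 HC]; exists (C * C); first exact: mulr_ge0.
move=> a b B F B0 F0 FB.
apply: (@le_trans _ _ (\sum_(i <oo) ((B * C)%:E * (expR (- (eta * `|i%:R - a|)))%:E))%E).
  apply: lee_nneseries => [i _|i _].
    by move=> _; apply: nneseries_ge0 => j _ _; rewrite lee_fin.
  apply: (@le_trans _ _ (\sum_(j <oo) ((B * expR (- (eta * `|i%:R - a|)))%:E * (expR (- (eta * `|j%:R - b|)))%:E))%E).
    by apply: lee_nneseries => [j _ _|j _]; rewrite -?EFinM lee_fin.
  rewrite nneseriesZl; last by move=> j _; rewrite lee_fin expR_ge0.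
  rewrite -[in leRHS]EFinM [in leRHS]mulrAC [in leRHS]EFinM; apply: lee_wpmul2l; last exact: HC.
  by rewrite lee_fin mulr_ge0 ?expR_ge0.
rewrite nneseriesZl; last by move=> j _; rewrite lee_fin expR_ge0.
by rewrite [in leRHS]mulrA [in leRHS]EFinM; apply: lee_wpmul2l; rewrite ?lee_fin ?mulr_ge0.
Qed.

End Sums.

(** * One positive kernel dominating all the pieces *)

Section Kernel.
Context {R : realType}.
Local Notation mu := (@lebesgue_measure R).
Local Notation pi := (@trigo.pi R).

Variables (A : nat -> nat -> set (R * R)) (c : nat -> nat -> R -> R) (om F : R -> R).
Hypotheses (mA : forall i l, measurable (A i l)) (mc : forall i l, measurable_fun setT (c i l))
  (c0 : forall i l s, 0 <= c i l s) (mom : measurable_fun setT om) (om0 : forall r, 0 <= om r)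
  (mF : measurable_fun setT F) (F0 : forall s, 0 <= F s).

Definition kterm i l (z : R * R) : \bar R := (c i l z.2 * (om z.1 * \1_(A i l) z))%:E.

Definition kern (z : R * R) : \bar R := (\sum_(i <oo) \sum_(l <oo) kterm i l z)%E.

Definition kint (r : R) : \bar R := (\int[mu]_s (kern (r, s) * (F s)%:E))%E.

Lemma kterm_ge0 i l z : (0 <= kterm i l z)%E.
Proof. by rewrite lee_fin mulr_ge0// mulr_ge0// indicE. Qed.

Lemma kern_ge0 z : (0 <= kern z)%E.
Proof. by apply: nneseries_ge0 => i _ _; apply: nneseries_ge0 => l _ _; exact: kterm_ge0. Qed.

Lemma kint_ge0 r : (0 <= kint r)%E.
Proof. by apply: integral_ge0 => s _; rewrite mule_ge0// ?kern_ge0// lee_fin. Qed.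

Lemma measurable_kterm i l : measurable_fun setT (kterm i l).
Proof.
apply/measurable_EFinP; apply: measurable_funM.
  by apply: (measurableT_comp (mc i l)); exact: measurable_snd.
apply: measurable_funM; first by apply: (measurableT_comp mom); exact: measurable_fst.
exact: measurable_indic.
Qed.

Lemma measurable_kern : measurable_fun setT kern.
Proof.
apply: ge0_emeasurable_sum => [i z _ _|i _].
  by apply: nneseries_ge0 => l _ _; exact: kterm_ge0.
by apply: ge0_emeasurable_sum => [l z _ _|l _]; [exact: kterm_ge0|exact: measurable_kterm].
Qed.

Let KF (z : R * R) : \bar R := (kern z * (F z.2)%:E)%E.

Let mKF : measurable_fun setT KF.
Proof.
apply: emeasurable_funM; first exact: measurable_kern.
by apply/measurable_EFinP; apply: (measurableT_comp mF); exact: measurable_snd.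
Qed.

Let KF0 z : (0 <= KF z)%E.
Proof. by rewrite mule_ge0// ?kern_ge0// lee_fin. Qed.

Lemma measurable_kint : measurable_fun setT kint.
Proof. exact: (@measurable_fun_fubini_tonelli_F _ _ _ _ _ mu KF). Qed.

Definition klo i l (r : R) : \bar R :=
  (\int[mu]_s (c i l s * (om r * \1_(A i l) (r, s)) * F s)%:E)%E.

Lemma klo_le i l r : (klo i l r <= kint r)%E.
Proof.
apply: le_integral_ge0 => s _.
  by rewrite lee_fin !mulr_ge0// indicE.
rewrite EFinM; apply: lee_wpmul2r; first by rewrite lee_fin.
apply: le_trans (nneseries_ge_term i _) => [|n]; last first.
  by apply: nneseries_ge0 => j _ _; exact: kterm_ge0.
by apply: (nneseries_ge_term l) => j; exact: kterm_ge0.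
Qed.

(* Schur test in its easiest form, [L^1] to [L^1]. *)
Lemma kint_bound (M : nat -> nat -> R) (C : R) : (forall i l, 0 <= M i l) -> 0 <= C ->
  (forall i l s, 0 < s ->
     (\int[mu]_(r in [set r | (0 < r)%R]) ((om r * \1_(A i l) (r, s)) * r)%:E <= (M i l)%:E)%E) ->
  (forall s, 0 < s -> (\sum_(i <oo) \sum_(l <oo) (c i l s * M i l)%:E <= C%:E)%E) ->
  (forall s, s <= 0 -> F s = 0) ->
  (\int[mu]_(r in [set r | (0 < r)%R]) (kint r * r%:E) <= C%:E * \int[mu]_s (F s)%:E)%E.
Proof.
move=> M0 C0 hM hC hF.
have mP : measurable [set r : R | (0 < r)%R] by exact: measurable_set_lt.
pose ind (r : R) : R := \1_[set r : R | (0 < r)%R] r * r.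
have ind0 r : 0 <= ind r.
  rewrite /ind indicE; case: (boolP (r \in _)) => [|_]; rewrite ?mul0r// mul1r inE/=; exact: ltW.
have mind : measurable_fun setT ind by apply: measurable_funM => //; exact: measurable_indic.
pose G (z : R * R) : \bar R := (KF z * (ind z.1)%:E)%E.
have mG : measurable_fun setT G.
  apply: emeasurable_funM => //; apply/measurable_EFinP.
  by apply: (measurableT_comp mind); exact: measurable_fst.
have G0 z : (0 <= G z)%E by rewrite mule_ge0// lee_fin.
have -> : (\int[mu]_(r in [set r | (0 < r)%R]) (kint r * r%:E) = \int[mu]_r \int[mu]_s G (r, s))%E.
  rewrite integral_indicR; apply: eq_integral => r _.
  have mr : measurable_fun setT (fun s : R => KF (r, s)).
    by apply: (@measurableT_comp _ _ _ _ _ _ KF _ (pair r)) => //; exact: pair1_measurable.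
  have -> : (\int[mu]_s G (r, s) = kint r * (ind r)%:E)%E.
    by rewrite /kint /G/= ge0_integralZr// lee_fin.
  by rewrite -muleA -EFinM /ind mulrC.
rewrite (@fubini_tonelli _ _ _ _ _ mu mu G)//=.
rewrite -ge0_integralZl//; last 2 first.
- exact/measurable_EFinP.
- by move=> s _; rewrite lee_fin.
apply: le_integral_ge0 => s _; first by apply: integral_ge0 => r _.
have [s0|s0] := leP s 0.
  rewrite hF// mule0 integral0_eq// => r _.
  by rewrite /G /KF/= hF// mule0 mul0e.
rewrite (_ : (fun x => G (x, s)) = (fun x => (F s)%:E * (kern (x, s) * (ind x)%:E))%E); last first.
  by apply/funext => x; rewrite /G /KF/= muleAC muleC.
have mks : measurable_fun setT (fun x : R => kern (x, s)).
  by apply: (@measurableT_comp _ _ _ _ _ _ kern _ (pair^~ s)); [exact: measurable_kern|exact: pair2_measurable].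
rewrite ge0_integralZl//; last 3 first.
- by apply: emeasurable_funM => //; exact/measurable_EFinP.
- by move=> x _; rewrite mule_ge0// ?kern_ge0// lee_fin.
- by rewrite lee_fin.
rewrite muleC; apply: lee_wpmul2r; first by rewrite lee_fin.
apply: le_trans (hC _ s0).
have mkt i l : measurable_fun setT (fun x : R => kterm i l (x, s)).
  by apply: (@measurableT_comp _ _ _ _ _ _ (kterm i l) _ (pair^~ s)); [exact: measurable_kterm|exact: pair2_measurable].
have mterm i l : measurable_fun setT (fun x : R => kterm i l (x, s) * (ind x)%:E)%E.
  by apply: emeasurable_funM => //; exact/measurable_EFinP.
have term0 i l x : (0 <= kterm i l (x, s) * (ind x)%:E)%E.
  by rewrite mule_ge0 ?kterm_ge0// lee_fin.
rewrite (_ : (fun x => kern (x, s) * (ind x)%:E)%E =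
   (fun x => \sum_(i <oo) \sum_(l <oo) (kterm i l (x, s) * (ind x)%:E))%E); last first.
  apply/funext => x; rewrite muleC /kern -nneseriesZl; last first.
    by move=> i _; apply: nneseries_ge0 => l _ _; exact: kterm_ge0.
  apply: eq_eseriesr => i _; rewrite -nneseriesZl; last by move=> l _; exact: kterm_ge0.
  by apply: eq_eseriesr => l _; rewrite muleC.
rewrite integral_nneseries//; last 2 first.
- move=> i; apply: ge0_emeasurable_sum => [l x _ _|l _]; [exact: term0|exact: mterm].
- by move=> i x _; apply: nneseries_ge0 => l _ _; exact: term0.
apply: lee_nneseries => [i _ _|i _]; first by apply: integral_ge0 => x _; apply: nneseries_ge0 => l _ _; exact: term0.
rewrite integral_nneseries//; last by move=> l; exact: mterm.
apply: lee_nneseries => [l _ _|l _]; first by apply: integral_ge0 => x _; exact: term0.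
rewrite EFinM.
apply: (@le_trans _ _ ((c i l s)%:E * (\int[mu]_(r in [set r | (0 < r)%R]) ((om r * \1_(A i l) (r, s)) * r)%:E))%E); last first.
  by apply: lee_wpmul2l; rewrite ?lee_fin//; exact: hM.
rewrite integral_indicR -ge0_integralZl//; last 3 first.
- apply: measurable_fun_indicM => //; apply/measurable_EFinP; apply: measurable_funM => //.
  apply: measurable_funM => //.
  apply: (@measurableT_comp _ _ _ _ _ _ (\1_(A i l) : R * R -> R) _ (pair^~ s)); first exact: measurable_indic.
  exact: pair2_measurable.
- move=> x _; rewrite -EFinM lee_fin !indicE.
  case: (boolP (x \in _)) => [|_]; last by rewrite mulr0.
  by rewrite inE/= => x0; rewrite !mulr_ge0// ltW.
- by rewrite lee_fin.
apply: le_integral_ge0 => x _; first exact: term0.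
by rewrite /kterm /ind/= -!EFinM lee_fin le_eqVlt; apply/orP; left; apply/eqP; ring.
Qed.

End Kernel.

(** * The pieces in terms of the normalized radial density *)

Section Core.
Context {R : realType}.
Local Notation mu := (@lebesgue_measure R).
Local Notation pi := (@trigo.pi R).
Variable E : set R.

(** Density of the [p]-th power of the norm in polar coordinates, [p = 1 / u], up to [2 * pi]. *)
Definition prof (g : R -> R) (u s : R) : R := (\1_[set s : R | (0 < s)%R] s) * (g s `^ u^-1 * s).

Lemma prof_ge0 g u s : 0 <= prof g u s.
Proof.
rewrite /prof indicE; case: (boolP (s \in _)) => [|_]; last by rewrite mul0r.
by rewrite inE/= mul1r => s0; rewrite mulr_ge0 ?powR_ge0// ltW.
Qed.

Lemma profE g u s : 0 < s -> prof g u s = g s `^ u^-1 * s.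
Proof. by move=> s0; rewrite /prof indicE mem_set// mul1r. Qed.

Lemma prof_le0 g u s : s <= 0 -> prof g u s = 0.
Proof. by move=> s0; rewrite /prof indicE memNset ?mul0r//=; apply/negP; rewrite -leNgt. Qed.

Lemma measurable_powR_fun (g : R -> R) (p : R) : measurable_fun setT g ->
  measurable_fun setT (fun s => g s `^ p).
Proof. by move=> mg; apply: (@measurableT_comp _ _ _ _ _ _ (@powR R ^~ p)) => //; exact: measurable_powR. Qed.

Lemma measurable_prof g u : measurable_fun setT g -> measurable_fun setT (prof g u).
Proof.
move=> mg; apply: measurable_funM; first by apply: measurable_indic; exact: measurable_set_lt.
by apply: measurable_funM => //; exact: measurable_powR_fun.
Qed.

Lemma arc_le_sum (g : R -> R) e r t : measurable_fun setT g -> (forall x, 0 <= g x) ->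
  (arc_integral g e r t <= \sum_(l <oo) \int[mu]_(p in Phi l) (g (sdist r t (e * cos p)))%:E)%E.
Proof.
move=> mg g0.
have mh : measurable_fun setT (fun p : R => (g (sdist r t (e * cos p)))%:E).
  by apply/measurable_EFinP; apply: measurableT_comp => //; exact: measurable_sdist_cos.
under eq_eseriesr do rewrite integral_indicR.
rewrite -integral_nneseries//; last 2 first.
- by move=> n; apply: measurable_fun_indicM => //; exact: measurable_Phi.
- by move=> n x _; rewrite mule_ge0// lee_fin.
rewrite /arc_integral integral_indicR; apply: le_integral_ge0 => p _.
  by rewrite mule_ge0// lee_fin.
have term0 n : (0 <= (g (sdist r t (e * cos p)))%:E * (\1_(Phi n) p)%:E)%E by rewrite mule_ge0// lee_fin.
rewrite [in leLHS]indicE; case: (boolP (p \in _)) => [|_]; last first.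
  by rewrite mule0; apply: nneseries_ge0 => n _ _.
rewrite inE/= in_itv/= => /andP[p0 ppi]; have [l Pl] := Phi_cover p0 ppi.
apply: le_trans (nneseries_ge_term l term0).
by rewrite indicE (mem_set Pl).
Qed.

Definition AP (m l : nat) : set (R * R) := ZP E m l `&` [set z | Xm m z.1].

Lemma measurable_AP m l : measurable (AP m l).
Proof.
apply: measurableI; first exact: measurable_ZP.
have m1 : measurable_fun setT (fun z : R * R => z.1) by exact: measurable_fst.
rewrite -[X in measurable X]setTI; apply: m1 => //; exact: measurable_Xm.
Qed.

Definition omP (r : R) : R := (1 + `|r|)^-1.

Lemma omP_ge0 r : 0 <= omP r.
Proof. by rewrite invr_ge0 addr_ge0. Qed.

Lemma omP_le1 r : omP r <= 1.
Proof. by rewrite invf_le1 ?lerDl// ltr_wpDr. Qed.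

(** Excludes the configuration where [r - e t] may be small: near side of the circle with [r] close
    to [t]. *)
Definition condP (r t e : R) : Prop := e = -1 \/ (e = 1 /\ 1 / 4 <= `|r - t|).
Definition condQ (r t e : R) : Prop := e = 1 /\ `|r - t| < 1 / 4.

Lemma poweR_le_exp (X : \bar R) (u v : R) : (0 <= X)%E -> (X <= 1)%E -> 0 < v -> v <= u ->
  (X `^ u <= X `^ v)%E.
Proof.
move=> X0 X1 v0 vu; have [x xE] : exists x, X = x%:E.
  by move: X0 X1; case: X => [x| |] //; exists x.
move: X0 X1; rewrite xE !lee_fin => x0 x1.
have [->|xn0] := eqVneq x 0.
  by rewrite !powR0// gt_eqF// (lt_le_trans v0).
have x01 : 0 < x <= 1 by rewrite x1 lt_neqAle eq_sym xn0 x0.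
exact: (ger_powR x01 vu).
Qed.

Variables (g : R -> R) (u v : R).
Hypotheses (mg : measurable_fun setT g) (g0 : forall x, 0 <= g x).
Hypotheses (v0 : 0 < v).
Hypothesis norm1 : (\int[mu]_s (prof g u s)%:E <= 1)%E.

Lemma wprof_ge0 (a b : R) (A : set (R * R)) (z : R * R) (s : R) : 0 <= a -> 0 <= b ->
  0 <= a * (b * \1_A z) * prof g u s.
Proof.
move=> a0 b0; apply: mulr_ge0; last exact: prof_ge0.
by apply: mulr_ge0 => //; apply: mulr_ge0 => //; rewrite indicE.
Qed.

(** Lets a part [g'] of [g] be estimated at another exponent [u']. The loss allowed in the
    hypothesis turns [expR (u' k)] back into [expR (u k)], [k = scaleP m l], and as the mass is at
    most 1, the outer power [u'] may be lowered to [v]. *)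
Lemma P_core m l (g' Dk : R -> R) (r t e u' : R) :
  measurable_fun setT g' -> (forall x, 0 <= g' x) -> measurable_fun setT Dk ->
  (forall s, 0 <= Dk s <= 1) -> 0 < u' <= 1 -> v <= u' ->
  (forall s, 0 < s -> g' s `^ u'^-1 <= expR (- (scaleP m l * (1 - u / u'))) * (g s `^ u^-1 * Dk s)) ->
  Xm m r -> 1 <= t -> t <= 2 -> E t -> condP r t e ->
  (\int[mu]_(p in Phi l) (g' (sdist r t (e * cos p)))%:E <=
   (8192 * expR (u * scaleP m l - l%:R))%:E *
   (\int[mu]_s (Dk s * (omP r * \1_(AP m l) (r, s)) * prof g u s)%:E) `^ v)%E.
Proof.
move=> mg' g'0 mD D01 u'01 vu' g'g Xr t1 t2 Et he.
have r0 := Xm_gt0 Xr; have u'0 : 0 < u' by case/andP: u'01.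
have omE : omP r = (1 + r)^-1 by rewrite /omP gtr0_norm.
set X : \bar R := (\int[mu]_s (Dk s * (omP r * \1_(AP m l) (r, s)) * prof g u s)%:E)%E.
have X0 : (0 <= X)%E.
  apply: integral_ge0 => s _; have /andP[d0 _] := D01 s.
  by rewrite lee_fin wprof_ge0 ?omP_ge0//.
have X1 : (X <= 1)%E.
  apply: (le_trans _ norm1); apply: le_integral_ge0 => s _; have /andP[d0 d1] := D01 s.
    by rewrite lee_fin wprof_ge0 ?omP_ge0//.
  rewrite lee_fin; apply: ler_piMl; first exact: prof_ge0.
  have i01 : 0 <= (\1_(AP m l) (r, s) : R) <= 1 by rewrite indicE; case: (_ \in _); rewrite ?lexx ler01.
  case/andP: i01 => i0 i1.
  by rewrite mulr_ile1 ?mulr_ge0 ?omP_ge0// mulr_ile1 ?omP_ge0 ?omP_le1.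
apply: (le_trans (piece_P mg' g'0 l u'01 Xr t1 t2 Et he)).
pose K0 : R := 8192; rewrite -/K0; have K0_ge0 : 0 <= K0 by exact: ler0n.
move: K0 K0_ge0 => K0 K0_ge0.
pose kk : R := scaleP m l * (1 - u / u').
have step : (((1 + r)^-1)%:E * \int[mu]_(s in [set s | ZP E m l (r, s)]) (g' s `^ u'^-1 * s)%:E <= (expR (- kk))%:E * X)%E.
  rewrite -omE integral_indicR -!ge0_integralZl//; last 5 first.
  - apply/measurable_EFinP; apply: measurable_funM; last exact: measurable_prof.
    apply: measurable_funM => //; apply: measurable_funM => //.
    apply: (@measurableT_comp _ _ _ _ _ _ (\1_(AP m l) : R * R -> R) _ (pair r)); first by apply: measurable_indic; exact: measurable_AP.
    exact: pair1_measurable.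
  - move=> s _; have /andP[d0 _] := D01 s.
    by rewrite lee_fin wprof_ge0 ?omP_ge0//.
  - apply: measurable_fun_indicM; first (by apply: measurable_section; exact: measurable_ZP).
    by apply/measurable_EFinP; apply: measurable_funM => //; exact: measurable_powR_fun.
  - move=> s _; rewrite indicE; case: (boolP (s \in _)) => [|_]; last by rewrite mule0.
    rewrite inE/= mule1 lee_fin => -[/= h _]; rewrite mulr_ge0 ?powR_ge0//.
    by apply: le_trans h; rewrite divr_ge0// addr_ge0// ltW.
  - by rewrite lee_fin omP_ge0.
  have main s : ZP E m l (r, s) -> omP r * (g' s `^ u'^-1 * s) <=
     expR (- kk) * (Dk s * (omP r * \1_(AP m l) (r, s)) * prof g u s).
    move=> Zs; have s0 : 0 < s.
      case: Zs => /= h _; apply: lt_le_trans h; rewrite divr_gt0// addr_gt0//.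
    have ZA : AP m l (r, s) by split.
    rewrite profE// indicE (mem_set ZA) mulr1.
    rewrite (_ : expR _ * _ = omP r * (expR (- kk) * (g s `^ u^-1 * Dk s) * s)); last by ring.
    apply: ler_wpM2l; first exact: omP_ge0.
    by apply: ler_wpM2r; [exact: ltW|exact: g'g].
  apply: le_integral_ge0 => s _.
    rewrite indicE; case: (boolP (s \in _)) => [|_]; last by rewrite !mule0.
    rewrite inE/= mule1 => -[/= h _]; rewrite -EFinM lee_fin mulr_ge0 ?omP_ge0// mulr_ge0 ?powR_ge0//.
    by apply: le_trans h; rewrite divr_ge0// addr_ge0// ltW.
  rewrite [in leLHS]indicE; case: (boolP (s \in _)) => [|_].
    by rewrite inE/= mule1 -!EFinM lee_fin => /main.
  rewrite !mule0 -EFinM lee_fin; have /andP[d0 _] := D01 s.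
  by rewrite mulr_ge0 ?expR_ge0// wprof_ge0 ?omP_ge0//.
have L0 : (0 <= ((1 + r)^-1)%:E * \int[mu]_(s in [set s | ZP E m l (r, s)]) (g' s `^ u'^-1 * s)%:E)%E.
  rewrite mule_ge0 ?lee_fin ?invr_ge0 ?addr_ge0 ?(ltW r0)//.
  apply: integral_ge0 => s -[/= h _]; rewrite lee_fin mulr_ge0 ?powR_ge0//.
  by apply: le_trans h; rewrite divr_ge0// addr_ge0// ltW.
apply: (@le_trans _ _ ((K0 * expR (u' * scaleP m l - l%:R))%:E * ((expR (- kk))%:E * X) `^ u')%E).
  apply: lee_wpmul2l; first by rewrite lee_fin; apply: mulr_ge0; [exact: K0_ge0|exact: expR_ge0].
  apply: gt0_ler_poweR => //; first exact: ltW.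
  - by rewrite in_itv/= leey andbT.
  - by rewrite in_itv/= leey andbT mule_ge0// lee_fin expR_ge0.
rewrite poweRM ?lee_fin ?expR_ge0// poweR_EFin expR_powR muleA -EFinM.
have -> : K0 * expR (u' * scaleP m l - l%:R) * expR (- kk * u') = K0 * expR (u * scaleP m l - l%:R).
  rewrite -mulrA -expRD; congr (_ * expR _); rewrite /kk; field; exact: lt0r_neq0.
apply: lee_wpmul2l; first by rewrite lee_fin; apply: mulr_ge0; [exact: K0_ge0|exact: expR_ge0].
exact: poweR_le_exp.
Qed.

Definition AQ (j l : nat) : set (R * R) := ZQ E j l `&` [set z | (0 < z.1)%R].

Lemma measurable_AQ j l : measurable (AQ j l).
Proof.
apply: measurableI; first exact: measurable_ZQ.
by apply: measurable_set_lt => //; exact: measurable_fst.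
Qed.

Lemma Q_core j l (r t : R) : 0 < u <= 1 -> v <= u -> 0 < r -> 1 <= t -> t <= 2 -> E t ->
  `|r - t| < 1 / 4 -> expR (- j.+1%:R) < `|r - t| -> `|r - t| <= expR (- j%:R) ->
  (\int[mu]_(p in Phi l) (g (sdist r t (1 * cos p)))%:E <=
   (1280 * expR (- (1 - 2 * u) * l%:R))%:E *
   (\int[mu]_s (1 * (1 * \1_(AQ j l) (r, s)) * prof g u s)%:E) `^ v)%E.
Proof.
move=> u01 vu r0 t1 t2 Et b4 b1 b2.
apply: (le_trans (piece_Q mg g0 l u01 r0 t1 t2 Et b4 b1 b2)).
apply: lee_wpmul2l; first by rewrite lee_fin; apply: mulr_ge0; [exact: ler0n|exact: expR_ge0].
have -> : (\int[mu]_(s in [set s | ZQ E j l (r, s)]) (g s `^ u^-1 * s)%:E =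
   \int[mu]_s (1 * (1 * \1_(AQ j l) (r, s)) * prof g u s)%:E)%E.
  rewrite integral_indicR; apply: eq_integral => s _; rewrite !mul1r -EFinM; congr (_%:E).
  rewrite (@indic_iff R _ _ (AQ j l) [set s | ZQ E j l (r, s)] (r, s) s); last by split => [[]|].
  rewrite mulrC indicE; case: (boolP (s \in _)) => [|_]; last by rewrite !mul0r.
  rewrite inE/= => -[_ /= h _ _]; rewrite profE//.
  by apply: lt_le_trans h; rewrite divr_gt0 ?expR_gt0.
apply: poweR_le_exp => //.
  by apply: integral_ge0 => s _; rewrite lee_fin wprof_ge0//.
apply: (le_trans _ norm1); apply: le_integral_ge0 => s _.
  by rewrite lee_fin wprof_ge0//.
by rewrite lee_fin ler_piMl ?prof_ge0// !mul1r indicE; case: (_ \in _).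
Qed.

End Core.

(** * The linear programme behind the region of exponents *)

Section Exponents.
Context {R : realType}.
Implicit Types (u v m l y : R).

Lemma min_pos (a b : R) : 0 < a -> 0 < b -> exists2 e : R, 0 < e & e <= a /\ e <= b.
Proof.
move=> a0 b0; exists (Num.min a b); first by rewrite lt_min a0.
by split; rewrite ge_min lexx ?orbT.
Qed.

Definition exponent (u v m l y : R) : R := u * (m + 2 * l) - l + v * (y - (m + 2 * l) - m).

(* On the cone [m, l >= 0] the minimum of the two bounds is linear on each side of the ray
   spanned by [(2 (gamma - beta), beta)], so its sign is read off the three extreme rays. *)
Lemma exponents (b g u v : R) : 0 <= b -> b < 1 -> b < g -> 0 < v -> v <= u -> u <= 2 * v ->
  2 * u - 1 <= (1 - b) * v -> 2 * g * u - b <= 2 * v * (2 * g - b - b * g) ->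
  (u = 2 * v -> v * (1 + g) < 1 / 2) ->
  (exists2 e : R, 0 < e & forall m l y, 0 <= m -> 0 <= l -> y <= b * (m + 2 * l) -> y <= 2 * g * l ->
     exponent u v m l y <= - (e * (m + l))) \/
  [/\ v < u, u < 1 & exists e x1 : R, [/\ 0 < e, 0 < x1, x1 <= 1 &
     forall m l y, 0 <= m -> 0 <= l -> y <= b * (m + 2 * l) -> y <= 2 * g * l ->
     exponent u v m l y <= - (e * `|m - x1 * (m + 2 * l)|)]].
Proof.
move=> b0 b1 bg v0 vu u2v hc hd hw.
have g0 : 0 < g by lra.
(* On the line [u = 2 v] the critical ray is the axis [l = 0], where [m = k]; hence [x1 = 1]. *)
have [u2|u2] := eqVneq u (2 * v).
  right; have vg := hw u2; split; first by lra.
    by clear - vg u2 g0 v0; nra.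
  exists (1 / 2 - v * (1 + g)), 1; split => //; first by lra.
  move=> m l y m0 l0 _ yg.
  have vy : v * y <= v * (2 * g * l) by apply: ler_wpM2l => //; exact: ltW.
  rewrite (_ : m - 1 * (m + 2 * l) = - (2 * l)); last by ring.
  rewrite normrN ger0_norm; last by lra.
  rewrite /exponent u2; clear - vy; nra.
have A2 : u - 2 * v < 0 by move: u2; rewrite neq_lt => /orP[]; lra.
have B1 : 2 * u - 1 - 2 * v * (1 - b) < 0 by clear - hc v0 b1; nra.
pose c := 2 * (g - b); have c0 : 0 < c by rewrite /c; lra.
(* With the smaller count as [y], [A], [B] and [F] are the values of the exponent at
   [(m, l) = (1, 0)], [(0, 1)] and [(c, b)]; on the last ray the two counts agree. *)
pose A := u - 2 * v; pose B := 2 * u - 1 - 2 * v * (1 - b).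
pose F := 2 * g * u - b - 2 * v * (2 * g - b - b * g).
have f1 m l y : y <= b * (m + 2 * l) -> exponent u v m l y <= (m / c) * F + (l - b * (m / c)) * B.
  move=> yb; have vy : v * y <= v * (b * (m + 2 * l)) by apply: ler_wpM2l => //; exact: ltW.
  rewrite (_ : _ + _ * B = u * (m + 2 * l) - l + v * (b * (m + 2 * l) - (m + 2 * l) - m)).
    by rewrite /exponent; lra.
  by rewrite /F /B /c; field; rewrite subr_eq0 gt_eqF.
have f2 m l y : 0 < b -> y <= 2 * g * l -> exponent u v m l y <= (l / b) * F + (m - c * (l / b)) * A.
  move=> bp yb; have vy : v * y <= v * (2 * g * l) by apply: ler_wpM2l => //; exact: ltW.
  rewrite (_ : _ + _ * A = u * (m + 2 * l) - l + v * (2 * g * l - (m + 2 * l) - m)).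
    by rewrite /exponent; lra.
  by rewrite /F /A /c; field; rewrite gt_eqF.
have [F0|F0] := ltP F 0.
  left.
  have [e1 e10 [e1F e1B]] : exists2 e, 0 < e & e <= - F / (c + b) /\ e <= - B.
    by apply: min_pos; [apply: divr_gt0; lra|rewrite /B; lra].
  have [e e0 [ee1 eA]] : exists2 e, 0 < e & e <= e1 /\ e <= - A.
    by apply: min_pos => //; rewrite /A; lra.
  have eB := le_trans ee1 e1B.
  have eF : e * (c + b) <= - F by rewrite -ler_pdivlMr ?(le_trans ee1)//; lra.
  exists e => // m l y m0 l0 yb yg.
  have [r1|r1] := leP (b * m) (c * l).
    apply: (le_trans (f1 _ _ _ yb)).
    have n0 : 0 <= m / c by rewrite divr_ge0// ltW.
    have q0 : 0 <= l - b * (m / c) by rewrite subr_ge0 mulrA ler_pdivrMr// mulrC [l * _]mulrC [m * _]mulrC.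
    have mE : m = c * (m / c) by field; rewrite gt_eqF.
    have h1 : (m / c) * (e * (c + b)) <= (m / c) * (- F) by apply: ler_wpM2l.
    have h2 : (l - b * (m / c)) * e <= (l - b * (m / c)) * (- B) by apply: ler_wpM2l.
    rewrite [X in _ <= - (_ * (X + _))]mE; move: (m / c) h1 h2 => n h1 h2.
    by clear - h1 h2; nra.
  have [bp|bz] := ltP 0 b.
    apply: (le_trans (f2 _ _ _ bp yg)).
    have n0 : 0 <= l / b by rewrite divr_ge0.
    have q0 : 0 <= m - c * (l / b).
      by rewrite subr_ge0 mulrA ler_pdivrMr// [m * _]mulrC; exact: ltW.
    have lE : l = b * (l / b) by field; rewrite gt_eqF.
    have h1 : (l / b) * (e * (c + b)) <= (l / b) * (- F) by apply: ler_wpM2l.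
    have h2 : (m - c * (l / b)) * e <= (m - c * (l / b)) * (- A) by apply: ler_wpM2l.
    rewrite [X in _ <= - (_ * (_ + X))]lE; move: (l / b) h1 h2 => n h1 h2.
    by clear - h1 h2; nra.
  have bE : b = 0 by lra.
  by move: r1; rewrite bE mul0r => /lt_geF; rewrite mulr_ge0// ltW.
(* The remaining case is the edge through [Q3] and [Q2 (2 g - 1)], critical along the ray of
   [(c, b)]. There [k = c + 2 b = 2 g], so [x1 = c / (2 g)]. *)
have F00 : F = 0 by rewrite /F in F0 *; lra.
have bp : 0 < b.
  rewrite lt_neqAle b0 andbT; apply/eqP => bE.
  have h : g * (u - 2 * v) = 0 by move: F00; rewrite /F -bE; lra.
  by move/eqP: h; rewrite mulf_eq0 => /orP[] /eqP; lra.
right; split.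
- rewrite lt_neqAle vu andbT; apply/eqP => uv.
  have h1 : v * (2 * (b + b * g - g)) = b by move: F00; rewrite /F -uv; lra.
  have h2 : v * (1 + b) <= 1 by move: hc; rewrite -uv; lra.
  have h3 : 0 < b + b * g - g.
    by rewrite ltNge; apply/negP => h; clear - h1 h v0 bp; nra.
  have h4 : b * (1 + b) <= 2 * (b + b * g - g).
    rewrite -[leLHS]mulr1 -{1}h1; rewrite (_ : _ * _ * 1 = 2 * (b + b * g - g) * (v * (1 + b))); last by ring.
    by apply: ler_piMr => //; lra.
  by clear - h4 b1 bg bp; nra.
- have h : (1 - b) * v <= (1 - b) * u by apply: ler_wpM2l => //; lra.
  have h2 : u * (1 + b) <= 1 by lra.
  by clear - h2 bp v0 vu; nra.
have [e e0 [eB eA]] : exists2 e, 0 < e & e <= - B * g / c /\ e <= - A * g / b.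
  by apply: min_pos; rewrite divr_gt0// mulr_gt0//; rewrite /A /B; lra.
exists e, (c / (2 * g)); split => //.
- by rewrite divr_gt0//; lra.
- by rewrite ler_pdivrMr /c; lra.
move=> m l y m0 l0 yb yg.
rewrite (_ : m - c / (2 * g) * (m + 2 * l) = (b * m - c * l) / g); last first.
  by rewrite /c; field; rewrite gt_eqF.
rewrite normrM [`|g^-1|]gtr0_norm ?invr_gt0//.
have [r1|r1] := leP (b * m) (c * l).
  apply: (le_trans (f1 _ _ _ yb)); rewrite F00 mulr0 add0r.
  rewrite ler0_norm ?subr_le0//.
  have q0 : 0 <= (c * l - b * m) / g by rewrite divr_ge0 ?subr_ge0// ltW.
  rewrite (_ : (l - _) * B = - ((- B * g / c) * ((c * l - b * m) / g))); last first.
    by field; rewrite !gt_eqF.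
  rewrite lerN2 opprB; exact: ler_wpM2r.
apply: (le_trans (f2 _ _ _ bp yg)); rewrite F00 mulr0 add0r.
rewrite gtr0_norm ?subr_gt0//.
have q0 : 0 <= (b * m - c * l) / g by rewrite divr_ge0 ?subr_ge0// ltW.
rewrite (_ : (m - _) * A = - ((- A * g / b) * ((b * m - c * l) / g))); last first.
  by field; rewrite !gt_eqF.
by rewrite lerN2; exact: ler_wpM2r.
Qed.

End Exponents.

(** * Comparison of one piece with the common weight *)

Section PieceWeight.
Context {R : realType}.
Local Notation mu := (@lebesgue_measure R).
Variables (A : nat -> nat -> set (R * R)) (D : nat -> nat -> R -> R) (om F : R -> R) (v : R).
Hypotheses (mA : forall i l, measurable (A i l)) (mD : forall i l, measurable_fun setT (D i l))
  (D0 : forall i l s, 0 <= D i l s) (mom : measurable_fun setT om) (om0 : forall r, 0 <= om r)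
  (mF : measurable_fun setT F) (F0 : forall s, 0 <= F s) (v0 : 0 < v).

Definition wcoef (b w : nat -> nat -> R) i l s := expR ((b i l + w i l) / v) * D i l s.

(** [expR b * X^v] equals [expR (- w) * (expR ((b + w) / v) * X)^v], and the inner quantity is one
    term of the kernel integral. The [w] is the part of the decay set aside for summing the pieces
    over [l]. *)
Lemma piece_weight (b w : nat -> nat -> R) i l r :
  ((expR (b i l))%:E * (\int[mu]_s (D i l s * (om r * \1_(A i l) (r, s)) * F s)%:E) `^ v <=
   (expR (- w i l))%:E * kint A (wcoef b w) om F r `^ v)%E.
Proof.
pose c := wcoef b w; have c0 i' l' s : 0 <= c i' l' s by rewrite mulr_ge0 ?expR_ge0.
have X0 : (0 <= \int[mu]_s (D i l s * (om r * \1_(A i l) (r, s)) * F s)%:E)%E.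
  by apply: integral_ge0 => s _; rewrite lee_fin !mulr_ge0// indicE.
have -> : expR (b i l) = expR (- w i l) * (expR ((b i l + w i l) / v)) `^ v.
  by rewrite expR_powR -expRD; congr expR; field; rewrite gt_eqF.
rewrite EFinM -muleA; apply: lee_wpmul2l; first by rewrite lee_fin expR_ge0.
rewrite -poweR_EFin -poweRM ?lee_fin ?expR_ge0//.
have U0 : (0 <= kint A c om F r)%E by exact: kint_ge0.
have klE : ((expR ((b i l + w i l) / v))%:E * \int[mu]_s (D i l s * (om r * \1_(A i l) (r, s)) * F s)%:E =
  klo A c om F i l r)%E.
  rewrite -ge0_integralZl//; last 2 first.
  - apply/measurable_EFinP; apply: measurable_funM => //; apply: measurable_funM; first exact: mD.
    apply: measurable_funM => //.
    apply: (@measurableT_comp _ _ _ _ _ _ (\1_(A i l) : R * R -> R) _ (pair r)); first exact: measurable_indic.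
    exact: pair1_measurable.
  - by move=> s _; rewrite lee_fin !mulr_ge0// indicE.
  by apply: eq_integral => s _; rewrite -EFinM /c /wcoef; congr (_%:E); ring.
rewrite klE; apply: gt0_ler_poweR.
- exact: ltW.
- rewrite in_itv/= leey andbT; apply: integral_ge0 => s _.
  by rewrite lee_fin !mulr_ge0 ?expR_ge0// indicE.
- by rewrite in_itv/= leey andbT.
exact: klo_le.
Qed.

End PieceWeight.

(** * The strong bound in terms of a single weight *)

Section ArcBounded.
Context {R : realType}.
Local Notation mu := (@lebesgue_measure R).

(** A normalized [L^p] to [L^q] bound: [U^v] majorizes the arcs, and its [q]-th power, [q = 1 / v],
    is [U] itself, so only the mass of [U] is to be controlled. *)
Definition arc_bounded (E : set R) (cond : R -> R -> R -> Prop) (u v : R) : Prop :=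
  exists2 K' : R, 0 <= K' & forall f : R -> R, measurable_fun setT f -> (forall x, 0 <= f x) ->
    (\int[mu]_s (prof f u s)%:E <= 1)%E ->
    exists U : R -> \bar R, [/\ measurable_fun setT U, forall r, (0 <= U r)%E,
      (\int[mu]_(r in [set r | (0 < r)%R]) (U r * r%:E) <= K'%:E * \int[mu]_s (prof f u s)%:E)%E &
      forall r t e, 0 < r -> E t -> cond r t e -> (arc_integral f e r t <= K'%:E * U r `^ v)%E].


Variables (E : set R) (cond : R -> R -> R -> Prop).

(* All the pieces are summed against the single weight [U], which is what makes the
   Schur test applicable. *)
Lemma arc_bounded_of_pieces (I : R -> R -> R -> nat -> Prop) (A : nat -> nat -> set (R * R)) (om : R -> R)
  (b M : nat -> nat -> R) (u v K W C : R) (D : (R -> R) -> nat -> nat -> R -> R) (w : nat -> nat -> R) :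
  0 < v -> 0 <= K -> 0 <= W -> 0 <= C ->
  (forall i l, measurable (A i l)) -> measurable_fun setT om -> (forall r, 0 <= om r) ->
  (forall i l, 0 <= M i l) -> (forall r t e, 0 < r -> E t -> cond r t e -> exists i, I r t e i) ->
  (forall i l s, 0 < s -> (\int[mu]_(r in [set r | (0 < r)%R]) ((om r * \1_(A i l) (r, s)) * r)%:E <= (M i l)%:E)%E) ->
  (forall (f : R -> R) m l, measurable_fun setT f -> measurable_fun setT (D f m l)) -> (forall f m l s, 0 <= D f m l s) ->
  (forall f : R -> R, measurable_fun setT f -> (forall x, 0 <= f x) -> (\int[mu]_s (prof f u s)%:E <= 1)%E ->
    forall m l r t e, 0 < r -> E t -> cond r t e -> I r t e m ->
    (\int[mu]_(p in Phi l) (f (sdist r t (e * cos p)))%:E <=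
     (K * expR (b m l))%:E *
     (\int[mu]_s (D f m l s * (om r * \1_(A m l) (r, s)) * prof f u s)%:E) `^ v)%E) ->
  (forall m, (\sum_(l <oo) (expR (- w m l))%:E <= W%:E)%E) ->
  (forall f s, 0 < s -> (\sum_(m <oo) \sum_(l <oo) (expR ((b m l + w m l) / v) * D f m l s * M m l)%:E <= C%:E)%E) ->
  arc_bounded E cond u v.
Proof.
move=> v0 K0 W0 C0 mA mom om0 M0 hI hM mD D0 hpiece hW hC.
pose K' := Num.max (K * W) (C) + 1.
have KW : K * W <= K' by rewrite ler_wpDr// le_max lexx.
have CC : C <= K' by rewrite ler_wpDr// le_max lexx orbT.
have K'0 : 0 < K' by rewrite ltr_wpDl// le_max mulr_ge0.
exists K'; first exact: ltW.
move=> f mf f0 nf.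
pose c := wcoef (D f) v b w.
have mc i l : measurable_fun setT (c i l) by apply: measurable_funM => //; exact: mD.
have c0 i l s : 0 <= c i l s by rewrite mulr_ge0 ?expR_ge0.
have mp := measurable_prof u mf.
pose U := kint A c om (prof f u).
have U0 r : (0 <= U r)%E by apply: kint_ge0 => // *; exact: prof_ge0.
exists U; split => //.
- by apply: measurable_kint => //; exact: prof_ge0.
- apply: (@le_trans _ _ ((C)%:E * \int[mu]_s (prof f u s)%:E)%E).
    apply: (@kint_bound _ _ _ _ _ mA mc c0 mom om0 mp (prof_ge0 f u) M C M0 C0 hM (hC f)).
    by move=> s; exact: prof_le0.
  apply: lee_wpmul2r; last by rewrite lee_fin.
  by apply: integral_ge0 => s _; rewrite lee_fin prof_ge0.
move=> r t e r0 Et he; have [m Xr] := hI r t e r0 Et he.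
apply: (le_trans (arc_le_sum _ _ _ mf f0)).
have Uv0 : (0 <= U r `^ v)%E by exact: poweR_ge0.
apply: (@le_trans _ _ (\sum_(l <oo) (K%:E * U r `^ v) * (expR (- w m l))%:E)%E).
  apply: lee_nneseries => [l _ _|l _]; first by apply: integral_ge0 => p _; rewrite lee_fin.
  apply: (le_trans (hpiece f mf f0 nf m l r t e r0 Et he Xr)).
  rewrite EFinM -!muleA; apply: lee_wpmul2l; rewrite ?lee_fin// [leRHS]muleC.
  by apply: (@piece_weight R A (D f) om (prof f u) v) => // *; [exact: mD|exact: prof_ge0].
move: Uv0; case: (U r `^ v)%E => [x x0| _|]//; last by rewrite (@gt0_muley _ K'%:E) ?lte_fin// leey.
rewrite -EFinM nneseriesZl; last by move=> l _; rewrite lee_fin expR_ge0.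
rewrite lee_fin in x0; apply: (@le_trans _ _ ((K * x)%:E * W%:E)%E).
  by apply: lee_wpmul2l => //; rewrite lee_fin mulr_ge0.
by rewrite -!EFinM lee_fin mulrAC; apply: ler_wpM2r.
Qed.

End ArcBounded.

(** * Summation away from the diagonal *)

Section StrongP.
Context {R : realType}.
Local Notation mu := (@lebesgue_measure R).

Variables (E : set R) (beta gamma : R).
Hypotheses (E12 : E `<=` `[1, 2]%classic).
Hypotheses (beta0 : 0 <= beta) (beta1 : beta < 1) (gamma0 : 0 <= gamma) (gamma1 : gamma <= 1).
Hypotheses (hE : minkowski_bound E beta) (aE : assouad_bound E gamma).

Lemma measurable_omP : measurable_fun setT (@omP R).
Proof.
apply: continuous_measurable_fun => r; rewrite /omP.
apply: (@continuousV R _ (fun r : R => 1 + `|r|)); first by rewrite gt_eqF// ltr_wpDr.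
by apply: continuousD; [exact: cst_continuous|exact: norm_continuous].
Qed.

Lemma indic_gt0 (r : R) : \1_[set r : R | (0 < r)%R] r = (0 < r)%R%:R :> R.
Proof. by rewrite indicE; congr (nat_of_bool _)%:R; apply/idP/idP; rewrite inE. Qed.

(** The weight [omP r * r = r / (1 + r)] is at most [expR (- m)] on the shell, the source of the
    last [- m] in the exponents. *)
Lemma integral_AP_le (C : R) m l s : 0 <= C -> (mu (secP E m l s) <= C%:E)%E ->
  (\int[mu]_(r in [set r | (0 < r)%R]) ((omP r * \1_(AP E m l) (r, s)) * r)%:E <= (C * expR (- m%:R))%:E)%E.
Proof.
move=> C0 hC.
apply: (@le_trans _ _ (\int[mu]_r ((expR (- m%:R))%:E * (\1_(secP E m l s) r)%:E))%E).
  rewrite integral_indicR; apply: le_integral_ge0 => r _.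
    rewrite -EFinM lee_fin indic_gt0; have [r0|_] := ltP 0 r; last by rewrite mulr0.
    by rewrite mulr1; apply: mulr_ge0; [rewrite mulr_ge0 ?omP_ge0// indicE|exact: ltW].
  rewrite -!EFinM lee_fin indic_gt0 !indicE.
  case: (boolP (r \in secP E m l s)) => [|h].
    rewrite inE/= => -[Xr Zr]; have r0 := Xm_gt0 Xr.
    rewrite (mem_set (_ : AP E m l (r, s))); last by split.
    rewrite r0 !mulr1 mulrC /omP gtr0_norm//; exact: Xm_ratio_le.
  have nA : ~ AP E m l (r, s) by move=> [Zr Xr]; move: h; rewrite notin_setE; apply.
  by rewrite (memNset nA) mulr0 mul0r mul0r mulr0.
have ms := @measurable_secP R E m l s.
rewrite ge0_integralZl//; last by apply/measurable_EFinP; exact: measurable_indic.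
rewrite integral_indic// setIT mulrC EFinM; exact: lee_wpmul2l.
Qed.

Definition exP m l : R := Num.min (beta * scaleP m l) (2 * gamma * l%:R).

Lemma MP_bound : exists2 C : R, 0 <= C & forall m l s, 
  (\int[mu]_(r in [set r | (0 < r)%R]) ((omP r * \1_(AP E m l) (r, s)) * r)%:E <=
   (C * expR (exP m l - scaleP m l - m%:R))%:E)%E.
Proof.
have [C1 C10 h1] := count_P_beta beta0 beta1 hE.
have [C2 C20 h2] := count_P_gamma E12 gamma0 gamma1 aE.
exists (Num.max C1 C2); first by rewrite le_max C10.
move=> m l s.
rewrite expRD mulrA; apply: integral_AP_le.
  by rewrite mulr_ge0 ?expR_ge0// le_max C10.
have e0 := expR_ge0 (exP m l - scaleP m l).
rewrite /exP in e0 *; case: (leP (beta * _) (2 * gamma * _)) e0 => _ e0.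
  apply: (le_trans (h1 m l s)); rewrite lee_fin; apply: ler_wpM2r => //.
  by rewrite le_max lexx.
apply: (le_trans (h2 m l s)); rewrite lee_fin (_ : gamma * _ = 2 * gamma * l%:R); last by ring.
apply: ler_wpM2r => //.
by rewrite le_max lexx orbT.
Qed.

Definition decay_slack (u v : R) : Prop := exists2 e : R, 0 < e &
  forall m l : nat, u * scaleP m l - l%:R + v * (exP m l - scaleP m l - m%:R) <= - (e * (m%:R + l%:R)).

(** Decay is guaranteed only transversally to the ray [m = x1 * scaleP m l]. *)
Definition decay_critical (u v : R) : Prop := exists e x1 : R, [/\ 0 < e, 0 < x1, x1 <= 1 &
  forall m l : nat, u * scaleP m l - l%:R + v * (exP m l - scaleP m l - m%:R) <=
    - (e * `|m%:R - x1 * scaleP m l|)].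

Lemma strong_P_of_pieces (u v K W C : R) (D : (R -> R) -> nat -> nat -> R -> R) (w : nat -> nat -> R) :
  0 < v -> 0 <= K -> 0 <= W -> 0 <= C ->
  (forall (f : R -> R) m l, measurable_fun setT f -> measurable_fun setT (D f m l)) -> (forall f m l s, 0 <= D f m l s) ->
  (forall f : R -> R, measurable_fun setT f -> (forall x, 0 <= f x) -> (\int[mu]_s (prof f u s)%:E <= 1)%E ->
    forall m l r t e, Xm m r -> E t -> condP r t e ->
    (\int[mu]_(p in Phi l) (f (sdist r t (e * cos p)))%:E <=
     (K * expR (u * scaleP m l - l%:R))%:E *
     (\int[mu]_s (D f m l s * (omP r * \1_(AP E m l) (r, s)) * prof f u s)%:E) `^ v)%E) ->
  (forall m, (\sum_(l <oo) (expR (- w m l))%:E <= W%:E)%E) ->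
  (forall f s, (\sum_(m <oo) \sum_(l <oo) (expR ((u * scaleP m l - l%:R + w m l) / v) * D f m l s *
     expR (exP m l - scaleP m l - m%:R))%:E <= C%:E)%E) ->
  arc_bounded E condP u v.
Proof.
move=> v0 K0 W0 C0 mD D0 hpiece hW hC.
have [C1 C10 hM] := MP_bound.
apply: (@arc_bounded_of_pieces R E condP (fun r _ _ m => Xm m r) (AP E) (@omP R)
  (fun m l => u * scaleP m l - l%:R) (fun m l => C1 * expR (exP m l - scaleP m l - m%:R)) u v K W (C1 * C) D w) => //.
- exact: mulr_ge0.
- by move=> *; exact: measurable_AP.
- exact: measurable_omP.
- exact: omP_ge0.
- by move=> *; rewrite mulr_ge0 ?expR_ge0.
- by move=> r t e r0 _ _; exact: Xm_exists.
- by move=> f mf f0 nf m l r t e r0 Et he Xr; exact: hpiece.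
- move=> f s _.
  under eq_eseriesr => i _.
    under eq_eseriesr => l _ do rewrite mulrCA EFinM.
    rewrite nneseriesZl; last by move=> l _; rewrite lee_fin mulr_ge0 ?expR_ge0// mulr_ge0 ?expR_ge0.
    over.
  rewrite nneseriesZl; last first.
    by move=> i _; apply: nneseries_ge0 => l _ _; rewrite lee_fin mulr_ge0 ?expR_ge0// mulr_ge0 ?expR_ge0.
  by rewrite EFinM; apply: lee_wpmul2l; rewrite ?lee_fin//; exact: hC.
Qed.

End StrongP.

(** * Strong bounds away from the diagonal: interior and critical edges *)

Section StrongP2.
Context {R : realType}.
Local Notation mu := (@lebesgue_measure R).
Local Notation pi := (@trigo.pi R).
Variables (E : set R) (beta gamma : R).
Hypotheses (E12 : E `<=` `[1, 2]%classic).
Hypotheses (beta0 : 0 <= beta) (beta1 : beta < 1) (gamma0 : 0 <= gamma) (gamma1 : gamma <= 1).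
Hypotheses (hE : minkowski_bound E beta) (aE : assouad_bound E gamma).

Lemma E_ge1 t : E t -> 1 <= t. Proof. by move=> /E12; rewrite /= in_itv/= => /andP[]. Qed.
Lemma E_le2 t : E t -> t <= 2. Proof. by move=> /E12; rewrite /= in_itv/= => /andP[]. Qed.

(** The decay is shared: [e / 2 * l] goes to the sum over [l], and the remainder sums the kernel
    over [(m, l)]. *)
Lemma strong_P_slack (u v : R) : 0 < v -> v <= u -> u <= 1 -> decay_slack beta gamma u v ->
  arc_bounded E condP u v.
Proof.
move=> v0 vu u1 [e e0 hd].
have u0 : 0 < u by exact: lt_le_trans vu.
have e20 : 0 < e / 2 by lra.
have [W W0 hW] := exp_series e20.
have e2v : 0 < e / (2 * v) by rewrite divr_gt0// mulr_gt0.
have [C C0 hC] := exp_series2 e2v.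
have K0 : 0 <= 8192 :> R by exact: ler0n.
apply: (@strong_P_of_pieces R E beta gamma E12 beta0 beta1 gamma0 gamma1 hE aE u v 8192 W (1 * C)
  (fun _ _ _ _ => 1) (fun _ l => e / 2 * l%:R) v0 K0 W0) => //.
- by rewrite mul1r.
- move=> f mf f0 nf m l r t ee Xr Et he.
  apply: (P_core mf v0 nf mf f0 _ _ _ vu _ Xr (E_ge1 Et) (E_le2 Et) Et he) => //.
  + by move=> s; rewrite lexx ler01.
  + by rewrite u0.
  + by move=> s s0; rewrite divff ?gt_eqF// subrr mulr0 oppr0 expR0 mulr1 mul1r.
- move=> m; apply: le_trans (hW 0); apply: lee_nneseries => [l _ _|l _].
    by rewrite lee_fin expR_ge0.
  by rewrite lee_fin ler_expR subr0 ger0_norm.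
move=> _ _; apply: (hC 0 0 1) => // i j.
rewrite mulr1 mul1r !subr0 !ger0_norm// -!expRD ler_expR.
have h := hd i j; have i0 : 0 <= i%:R :> R by []. have j0 : 0 <= j%:R :> R by [].
rewrite -(ler_pM2l v0).
move: (exP _ _ _ _) (scaleP i j) h i0 j0 => y k; move: (i%:R : R) (j%:R : R) => m l h i0 j0.
have -> : v * ((u * k - l + e / 2 * l) / v + (y - k - m)) = u * k - l + v * (y - k - m) + e / 2 * l.
  by field; rewrite gt_eqF.
have -> : v * (- (e / (2 * v) * m) + - (e / (2 * v) * l)) = - (e / 2 * (m + l)).
  by field; rewrite gt_eqF.
apply: (@le_trans _ _ (- (e * (m + l)) + e / 2 * l)); first by rewrite lerD2r.
have : 0 <= e / 2 * m by apply: mulr_ge0 => //; exact: ltW.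
by move: h hd hC hW => _ _ _ _; lra.
Qed.

(** With [g = expR y], the upper part has [y / u > k], and replacing the exponent [1 / u] by 1 gains
    [expR (- (1 - u) (y / u - k))]. *)
Lemma split_hi (g k u eta : R) : 0 <= g -> 0 < u -> u < 1 -> eta <= 1 - u ->
  (g * \1_[set x : R | (expR (k * u) < x)%R] g) `^ 1^-1 <=
  expR (- (k * (1 - u / 1))) * (g `^ u^-1 * expR (- (eta * `|k - ln g / u|))).
Proof.
move=> g0 u0 u1 eu; rewrite indicE; case: (boolP (g \in _)) => [|_]; last first.
  by rewrite mulr0 invr1 powRr1// !mulr_ge0 ?expR_ge0 ?powR_ge0.
rewrite inE/= mulr1 => gk; have gp : 0 < g by exact: lt_trans (expR_gt0 _) gk.
pose y := ln g; have gE : g = expR y by rewrite lnK.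
have yk : k * u < y by rewrite -ltr_expR -gE.
rewrite -/y [in X in X <= _]gE [in X in _ <= _ * (X `^ _ * _)]gE !expR_powR -!expRD ler_expR.
have zp : 0 <= y / u - k by rewrite subr_ge0 ler_pdivlMr// ltW.
rewrite distrC ger0_norm// !divr1.
rewrite [leLHS](_ : y = u * (y / u - k) + u * k); last by field; rewrite gt_eqF.
have h : eta * (y / u - k) <= (1 - u) * (y / u - k) by apply: ler_wpM2r.
rewrite -[y * u^-1]/(y / u); move: (y / u) h => z h; by lra.
Qed.

(** Symmetric to the upper part: for [y / u <= k] the larger exponent [1 / v] gains
    [expR (- (u / v - 1) (k - y / u))]. *)
Lemma split_lo (g k u v eta : R) : 0 <= g -> 0 < v -> v < u -> eta <= u / v - 1 ->
  (g * \1_[set x : R | (x <= expR (k * u))%R] g) `^ v^-1 <=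
  expR (- (k * (1 - u / v))) * (g `^ u^-1 * expR (- (eta * `|k - ln g / u|))).
Proof.
move=> g0 v0 vu ev; have u0 : 0 < u by exact: lt_trans vu.
have R0 : 0 <= expR (- (k * (1 - u / v))) * (g `^ u^-1 * expR (- (eta * `|k - ln g / u|))).
  by rewrite !mulr_ge0 ?expR_ge0 ?powR_ge0.
rewrite indicE; case: (boolP (g \in _)) => [|_]; last first.
  by rewrite mulr0 powR0// gt_eqF// invr_gt0.
rewrite inE/= mulr1 => gk.
have [g00|gp] := leP g 0.
  have -> : g = 0 by lra.
  by rewrite powR0 ?gt_eqF ?invr_gt0// !mulr_ge0 ?expR_ge0 ?powR_ge0.
pose y := ln g; have gE : g = expR y by rewrite lnK.
have yk : y <= k * u by rewrite -ler_expR -gE.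
rewrite -/y [in X in X <= _]gE [in X in _ <= _ * (X `^ _ * _)]gE !expR_powR -!expRD ler_expR.
have zp : 0 <= k - y / u by rewrite subr_ge0 ler_pdivrMr.
rewrite ger0_norm//.
rewrite (_ : y * v^-1 = u / v * k - u / v * (k - y / u)); last by field; rewrite !gt_eqF.
have h : eta * (k - y / u) <= (u / v - 1) * (k - y / u) by apply: ler_wpM2r.
rewrite -[y * u^-1]/(y / u); move: (y / u) (u / v) h => z w h; by lra.
Qed.

Lemma measurable_mul_indic_set (f : R -> R) (S : set R) : measurable_fun setT f -> measurable S ->
  measurable_fun setT (fun x => f x * \1_S (f x)).
Proof.
move=> mf mS; apply: measurable_funM => //.
by apply: (measurableT_comp _ mf); exact: measurable_indic.
Qed.

(* In the critical case each piece is split at height [exp (k u)], the lower part being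
   estimated with exponent [1/v] and the upper one with exponent [1]; this gains the factor
   [exp (- eta |k - ln (f s) / u|)]. *)
Lemma piece_critical (u v : R) (f : R -> R) m l r t e eta :
  0 < v -> v < u -> u < 1 -> eta <= 1 - u -> eta <= u / v - 1 -> 0 <= eta ->
  measurable_fun setT f -> (forall x, 0 <= f x) -> (\int[mu]_s (prof f u s)%:E <= 1)%E ->
  Xm m r -> E t -> condP r t e ->
  (\int[mu]_(p in Phi l) (f (sdist r t (e * cos p)))%:E <=
     (2 * 8192 * expR (u * scaleP m l - l%:R))%:E *
     (\int[mu]_s (expR (- (eta * `|scaleP m l - ln (f s) / u|)) *
        (omP r * \1_(AP E m l) (r, s)) * prof f u s)%:E) `^ v)%E.
Proof.
move=> v0 vu u1 e1 e2 e0 mf f0 nf Xr Et he.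
have u0 : 0 < u by exact: lt_trans vu.
set X := (X in (_ <= _ * X `^ v)%E).
pose T := expR (scaleP m l * u).
pose hi := fun x => f x * \1_[set x : R | (T < x)%R] (f x).
pose lo := fun x => f x * \1_[set x : R | (x <= T)%R] (f x).
have mhi : measurable_fun setT hi.
  by apply: measurable_mul_indic_set => //; exact: measurable_set_lt.
have mlo : measurable_fun setT lo.
  by apply: measurable_mul_indic_set => //; exact: measurable_set_le.
have hi0 x : 0 <= hi x by rewrite mulr_ge0// indicE.
have lo0 x : 0 <= lo x by rewrite mulr_ge0// indicE.
have fE x : f x = hi x + lo x.
  rewrite /hi /lo !indicE; have [h|h] := leP (f x) T.
    by rewrite memNset ?mem_set ?mulr0 ?add0r ?mulr1//= ltNge h.
  by rewrite mem_set ?memNset ?mulr0 ?addr0 ?mulr1//= leNgt h.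
pose D s := expR (- (eta * `|scaleP m l - ln (f s) / u|)).
have mD : measurable_fun setT D.
  apply: measurableT_comp; first exact: measurable_expR.
  apply: measurableT_comp => //; apply: measurable_funM => //.
  apply: measurableT_comp => //; apply: measurable_funB => //; apply: measurable_funM => //.
  by apply: measurableT_comp => //; exact: measurable_ln.
have D01 s : 0 <= D s <= 1.
  by rewrite expR_ge0 expR_le1 oppr_le0 mulr_ge0.
have hhi := P_core mf v0 nf mhi hi0 mD D01 (u' := 1) _ _ _ Xr (E_ge1 Et) (E_le2 Et) Et he.
have hlo := P_core mf v0 nf mlo lo0 mD D01 (u' := v) _ _ _ Xr (E_ge1 Et) (E_le2 Et) Et he.
have {}hhi := hhi l _ _ _.
have {}hlo := hlo l _ _ _.
have mcomp (h : R -> R) : measurable_fun setT h -> measurable_fun (Phi l) (fun p => (h (sdist r t (e * cos p)))%:E).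
  move=> mh; apply: (@measurable_funS _ _ _ _ setT) => //.
  by apply/measurable_EFinP; apply: measurableT_comp => //; exact: measurable_sdist_cos.
under eq_integral do rewrite fE EFinD.
rewrite ge0_integralD//; last 5 first.
- exact: measurable_Phi.
- by move=> p _; rewrite lee_fin.
- exact: mcomp.
- by move=> p _; rewrite lee_fin.
- exact: mcomp.
rewrite (_ : 2 * 8192 * expR (u * scaleP m l - l%:R) =
  8192 * expR (u * scaleP m l - l%:R) + 8192 * expR (u * scaleP m l - l%:R)); last first.
  by move: (8192 : R) (expR _) => a b; ring.
have X0 : (0 <= X `^ v)%E by exact: poweR_ge0.
have K0 : 0 <= 8192 * expR (u * scaleP m l - l%:R) by apply: mulr_ge0; [exact: ler0n|exact: expR_ge0].
rewrite EFinD ge0_muleDl ?lee_fin//; apply: leeD.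
- apply: hhi; first by rewrite ltr01 lexx.
    by apply: ltW; exact: lt_trans u1.
  by move=> s s0; exact: split_hi.
- apply: hlo; [|exact: lexx|].
    by rewrite v0; apply: ltW; exact: lt_trans u1.
  by move=> s s0; exact: split_lo.
Qed.

Lemma quarter_sum (A B p q : R) : 0 <= A -> 0 <= B -> p <= (A + B) / 4 -> q <= (A + 2 * B) / 4 ->
  - A - B <= - p - q.
Proof. by lra. Qed.

(** Two independent decays are available: in [m - x1 k] from the exponents, in [k - ln (f s) / u]
    from the splitting by height. Together they sum over [(m, l)] with a bound independent of
    [f s]. *)
Lemma strong_P_critical (u v : R) : 0 < v -> v < u -> u < 1 -> decay_critical beta gamma u v ->
  arc_bounded E condP u v.
Proof.
move=> v0 vu u1 [e [x1 [e0 x10 x11 hd]]].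
have u0 : 0 < u by exact: lt_trans vu.
have uv1 : 0 < u / v - 1 by rewrite subr_gt0 ltr_pdivlMr// mul1r.
have [eta eta0 [eta1 eta2]] : exists2 a, 0 < a & a <= 1 - u /\ a <= u / v - 1.
  by apply: min_pos => //; lra.
have ex0 : 0 < e * x1 by exact: mulr_gt0.
have [W W0 hW] := exp_series ex0.
have e2v : 0 < e / (2 * v) by rewrite divr_gt0// mulr_gt0.
have [a a0 [a1 a2]] := min_pos e2v eta0.
have a4 : 0 < a / 4 by lra.
have [C C0 hC] := exp_series2 a4.
have K0 : 0 <= 2 * 8192 :> R by apply: mulr_ge0; exact: ler0n.
apply: (@strong_P_of_pieces R E beta gamma E12 beta0 beta1 gamma0 gamma1 hE aE u v (2 * 8192) W (1 * C)
  (fun f m l s => expR (- (eta * `|scaleP m l - ln (f s) / u|)))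
  (fun m l => e / 2 * `|m%:R - x1 * scaleP m l|) v0 K0 W0).
- by rewrite mul1r.
- move=> f m l mf; apply: measurableT_comp; first exact: measurable_expR.
  apply: measurableT_comp => //; apply: measurable_funM => //.
  apply: measurableT_comp => //; apply: measurable_funB => //; apply: measurable_funM => //.
  by apply: measurableT_comp => //; exact: measurable_ln.
- by move=> f m l s; exact: expR_ge0.
- move=> f mf f0 nf m l r t ee Xr Et he.
  by apply: piece_critical => //; exact: ltW.
(* For fixed [m], this centre is the [l] at which [m = x1 * (m + 2 * l)]. *)
- move=> m; apply: le_trans (hW (m%:R * (1 - x1) / (2 * x1))); apply: lee_nneseries => [l _ _|l _].
    by rewrite lee_fin expR_ge0.
  rewrite lee_fin ler_expR lerN2.
  rewrite (_ : m%:R - x1 * scaleP m l = - (2 * x1 * (l%:R - m%:R * (1 - x1) / (2 * x1)))); last first.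
    by rewrite /scaleP; field; rewrite gt_eqF.
  rewrite normrN normrM [`|2 * x1|]gtr0_norm ?mulr_gt0//.
  by move: `|_| => z; rewrite le_eqVlt; apply/orP; left; apply/eqP; field.
move=> f s; pose y := ln (f s) / u.
(* The centre is the point [(m, l)] of the critical ray where [m + 2 * l = y]. *)
apply: (hC (x1 * y) ((1 - x1) / 2 * y) 1) => // i j.
rewrite mul1r -!expRD ler_expR -/y.
have h := hd i j.
have n1 : `|i%:R - x1 * y| <= `|i%:R - x1 * scaleP i j| + `|scaleP i j - y|.
  rewrite (_ : i%:R - x1 * y = (i%:R - x1 * scaleP i j) + x1 * (scaleP i j - y)); last by ring.
  apply: (le_trans (ler_normD _ _)); rewrite lerD2l normrM gtr0_norm//.
  by apply: ler_piMl.
have n2 : `|j%:R - (1 - x1) / 2 * y| <= `|i%:R - x1 * scaleP i j| + 2 * `|scaleP i j - y|.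
  rewrite (_ : j%:R - (1 - x1) / 2 * y = - (1 / 2 * (i%:R - x1 * scaleP i j)) + (1 - x1) / 2 * (scaleP i j - y)); last first.
    by rewrite /scaleP; field.
  apply: (le_trans (ler_normD _ _)); rewrite normrN; apply: lerD; rewrite normrM.
    by apply: ler_piMl => //; rewrite ger0_norm; lra.
  apply: ler_wpM2r => //; rewrite ger0_norm; [lra|by apply: mulr_ge0; lra].
have z0 : 0 <= `|i%:R - x1 * scaleP i j| by [].
have w0 : 0 <= `|scaleP i j - y| by [].
move: n1 n2 z0 w0 h.
move: `|i%:R - x1 * scaleP i j| `|scaleP i j - y| `|i%:R - x1 * y| `|j%:R - (1 - x1) / 2 * y| => z w p q n1 n2 z0 w0 h.
have h1 : (u * scaleP i j - j%:R + e / 2 * z) / v + (exP beta gamma i j - scaleP i j - i%:R) <= - (e / (2 * v) * z).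
  rewrite -(ler_pM2l v0).
  rewrite (_ : v * - (e / (2 * v) * z) = - (e * z) + e / 2 * z); last by field; rewrite gt_eqF.
  rewrite (_ : v * (_ + _) = u * scaleP i j - j%:R + v * (exP beta gamma i j - scaleP i j - i%:R) + e / 2 * z).
    by rewrite lerD2r.
  by field; rewrite gt_eqF.
have h2 : a * z <= e / (2 * v) * z by apply: ler_wpM2r.
have h3 : a * w <= eta * w by apply: ler_wpM2r.
have h4 : a / 4 * p <= a / 4 * (z + w) by apply: ler_wpM2l => //; exact: ltW.
have h5 : a / 4 * q <= a / 4 * (z + 2 * w) by apply: ler_wpM2l => //; exact: ltW.
have az : 0 <= a * z by rewrite mulr_ge0// ltW.
have aw : 0 <= a * w by rewrite mulr_ge0// ltW.
rewrite addrAC; apply: (@le_trans _ _ (- (e / (2 * v) * z) - eta * w)); first by rewrite lerD2r.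
apply: (@le_trans _ _ (- (a * z) - a * w)); first by rewrite lerB// lerN2.
apply: quarter_sum => //.
  by rewrite (_ : (_ + _) / 4 = a / 4 * (z + w)); last by field.
by rewrite (_ : (_ + _) / 4 = a / 4 * (z + 2 * w)); last by field.
Qed.

Lemma strong_P_all (u v : R) : beta < gamma -> 0 < v -> v <= u -> u <= 1 -> u <= 2 * v ->
  2 * u - 1 <= (1 - beta) * v -> 2 * gamma * u - beta <= 2 * v * (2 * gamma - beta - beta * gamma) ->
  (u = 2 * v -> v * (1 + gamma) < 1 / 2) ->
  arc_bounded E condP u v.
Proof.
move=> bg v0 vu u1 u2v hc hd hw.
have ex1 m l : exP beta gamma m l <= beta * (m%:R + 2 * l%:R) by rewrite ge_min lexx.
have ex2 m l : exP beta gamma m l <= 2 * gamma * l%:R by rewrite ge_min lexx orbT.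
case: (exponents beta0 beta1 bg v0 vu u2v hc hd hw) => [[e e0 h]|[vu' u1' [e [x1 [e0 x10 x11 h]]]]].
  apply: strong_P_slack => //; exists e => // m l; exact: h.
apply: strong_P_critical => //; exists e, x1; split => // m l; exact: h.
Qed.

End StrongP2.

(** * Summation near the diagonal *)

Section StrongQ.
Context {R : realType}.
Local Notation mu := (@lebesgue_measure R).
Variables (E : set R) (beta : R).
Hypotheses (E12 : E `<=` `[1, 2]%classic).
Hypotheses (beta0 : 0 <= beta) (beta1 : beta < 1).
Hypotheses (hE : minkowski_bound E beta).

(** [r != t] is what makes the index [j] of [|r - t|] exist; it holds for almost every radius by
    [E_null]. *)
Definition condQ' (r t e : R) : Prop := [/\ e = 1, r != t & `|r - t| < 1 / 4].

Definition idxQ (r t e : R) (j : nat) : Prop :=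
  [/\ expR (- j.+1%:R) < `|r - t|, `|r - t| <= expR (- j%:R), `|r - t| < 1 / 4 & e = 1].

Definition rangeQ (j l : nat) : set R :=
  [set s | expR (- (minn j l)%:R) / 5 <= s /\ s <= 5 * expR (- (minn j l)%:R)].

Lemma measurable_rangeQ j l : measurable (rangeQ j l).
Proof. by apply: measurableI; exact: measurable_set_le. Qed.

Lemma AQ_range j l (r s : R) : AQ E j l (r, s) -> rangeQ j l s.
Proof. by move=> [[_ h1 h2 _] _]. Qed.

Lemma indic_rangeQ j l (r s : R) :
  \1_(rangeQ j l) s * \1_(AQ E j l) (r, s) = \1_(AQ E j l) (r, s) :> R.
Proof.
rewrite [\1_(AQ E j l) _]indicE; case: (boolP (_ \in _)) => [|_]; last by rewrite mulr0.
by rewrite inE => /AQ_range h; rewrite indicE mem_set// mulr1.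
Qed.

(** Being comparable to [expR (- min j l)] within a factor 5 means that [expR] of [|min j l + ln s|]
    is at most 5; this makes a support condition summable. *)
Lemma rangeQ_decay j l (s : R) : 0 < s ->
  \1_(rangeQ j l) s <= 5 * expR (- `|(minn j l)%:R + ln s|).
Proof.
move=> s0; rewrite indicE; case: (boolP (_ \in _)) => [|_]; last by rewrite mulr_ge0 ?expR_ge0.
rewrite inE/= => -[]; set L : R := (minn j l)%:R => h1 h2.
set x := L + ln s.
have eL := expR_gt0 L; have eLN : expR L * expR (- L) = 1 by rewrite -expRD subrr expR0.
have ex : expR x = expR L * s by rewrite expRD lnK.
have x5 : expR x <= 5.
  rewrite ex; apply: (@le_trans _ _ (expR L * (5 * expR (- L)))); first by apply: ler_wpM2l => //; exact: ltW.
  by rewrite mulrCA eLN mulr1.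
have xN5 : expR (- x) <= 5.
  rewrite expRN ex -[leRHS]invrK lef_pV2 ?posrE ?mulr_gt0 ?invr_gt0//.
  apply: (@le_trans _ _ (expR L * (expR (- L) / 5))); first by rewrite mulrA eLN mul1r.
  by apply: ler_wpM2l => //; exact: ltW.
have nx : expR `|x| <= 5 by case: (ger0P x).
have -> : true%:R = expR `|x| * expR (- `|x|) :> R by rewrite -expRD subrr expR0.
by apply: ler_wpM2r => //; exact: expR_ge0.
Qed.

Definition MQ (C : R) (j l : nat) : R :=
  3 * (C * expR (- (1 - beta) * (if (j <= l)%N then 2 * l%:R - j%:R else j%:R))).

(** The 3 bounds the weight [r], as [ZQ] requires [r < 3]. *)
Lemma integral_AQ_le (C : R) j l s : 
  (mu (secQ E j l s) <= C%:E)%E ->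
  (\int[mu]_(r in [set r | (0 < r)%R]) ((1 * \1_(AQ E j l) (r, s)) * r)%:E <= (3 * C)%:E)%E.
Proof.
move=> hC.
apply: (@le_trans _ _ (\int[mu]_r (3%:E * (\1_(secQ E j l s) r)%:E))%E).
  rewrite integral_indicR; apply: le_integral_ge0 => r _.
    rewrite -EFinM lee_fin indic_gt0; have [r0|_] := ltP 0 r; last by rewrite mulr0.
    by rewrite mulr1 mul1r; apply: mulr_ge0; [rewrite indicE|exact: ltW].
  rewrite -!EFinM lee_fin indic_gt0 mul1r !indicE.
  case: (boolP (r \in secQ E j l s)) => [|h].
    rewrite inE/= => -[/= r3 h1 h2 h3]; have [r0|r0] := ltP 0 r; last by rewrite mulr0 mulr1.
    rewrite !mulr1; apply: (@le_trans _ _ r); last exact: ltW.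
    by apply: ler_piMl; [exact: ltW|case: (_ \in _)].
  have nA : ~ AQ E j l (r, s) by move=> [Zr Xr]; move: h; rewrite notin_setE; apply.
  by rewrite (memNset nA) mul0r mul0r mulr0.
have ms := @measurable_secQ R E j l s.
rewrite ge0_integralZl//; last by apply/measurable_EFinP; exact: measurable_indic.
by rewrite integral_indic// setIT EFinM; exact: lee_wpmul2l.
Qed.

(** The extremal case is [j = l], where the inequality is exactly [2 u - 1 <= (1 - beta) v]. Off it
    there is decay in [|l - j|], half of which pays for the first summand. *)
Lemma Q_exponent (u v : R) (j l : nat) : 0 < v -> 2 * u - 1 <= (1 - beta) * v ->
  (- (1 - 2 * u) * l%:R + (1 - beta) * v / 2 * `|l%:R - j%:R|) / v +
    - (1 - beta) * (if (j <= l)%N then 2 * l%:R - j%:R else j%:R) <=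
  - ((1 - beta) / 2 * `|l%:R - j%:R|).
Proof.
move=> v0 hc; have b1 := beta1.
rewrite -(ler_pM2l v0) mulrDr [v * (_ / v)](_ : _ = - (1 - 2 * u) * l%:R + (1 - beta) * v / 2 * `|l%:R - j%:R|); last first.
  by field; rewrite gt_eqF.
have l0 : 0 <= l%:R :> R by []. have j0 : 0 <= j%:R :> R by [].
have h : l%:R * (2 * u - 1) <= l%:R * ((1 - beta) * v) by apply: ler_wpM2l.
case: (leqP j l) => jl; [have jlR : j%:R <= l%:R :> R by rewrite ler_nat|have jlR : l%:R <= j%:R :> R by rewrite ler_nat ltnW].
  rewrite ger0_norm ?subr_ge0//; move: h l0 j0 jlR; move: (l%:R : R) (j%:R : R) => x y h x0 y0 xy.
  have h2 : 0 <= (1 - beta) * v * (x - y) by apply: mulr_ge0; [apply: mulr_ge0; lra|lra].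
  by lra.
rewrite ler0_norm ?subr_le0//; move: h l0 j0 jlR; move: (l%:R : R) (j%:R : R) => x y h x0 y0 xy.
by lra.
Qed.

Lemma norm_min_sum (e y : R) (j l : nat) : 0 <= e <= 1 / 2 ->
  e * `|j%:R + y| + e * `|l%:R + y| <= 2 * e * `|l%:R - j%:R| + `|(minn j l)%:R + y|.
Proof.
move=> /andP[e0 e1].
have aux (a b : R) : e * `|a + y| + e * `|b + y| <= 2 * e * `|b - a| + `|a + y|.
  have h : `|b + y| <= `|b - a| + `|a + y|.
    by apply: le_trans (ler_normD _ _); rewrite addrA subrK.
  have h1 : e * `|b + y| <= e * (`|b - a| + `|a + y|) by apply: ler_wpM2l.
  have h2 : e * `|a + y| <= 1 / 2 * `|a + y| by apply: ler_wpM2r.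
  have h3 : 0 <= e * `|b - a| by apply: mulr_ge0.
  by lra.
case: (leqP j l) => jl; first exact: aux.
by rewrite addrC distrC; exact: aux.
Qed.

(** Convergence comes from the decay in [|l - j|] of [Q_exponent] and from the localization of
    [min j l] near [- ln s], so the closed edge needs no splitting by height. *)
Lemma strong_Q (u v : R) : 0 < v -> v <= u -> u <= 1 -> 2 * u - 1 <= (1 - beta) * v ->
  arc_bounded E condQ' u v.
Proof.
move=> v0 vu u1 hc; have b1 := beta1.
have u0 : 0 < u by exact: lt_le_trans vu.
have c0 : 0 < (1 - beta) * v / 2 by rewrite divr_gt0// mulr_gt0// subr_gt0.
have [W W0 hW] := exp_series c0.
have eta0 : 0 < (1 - beta) / 4 by rewrite divr_gt0// subr_gt0.
have [C C0 hC] := exp_series2 eta0.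
have [C1 C10 hM] := count_Q beta0 beta1 hE.
have K0 : 0 <= 1280 :> R by exact: ler0n.
have B0 : 0 <= 3 * (C1 * 5) by rewrite !mulr_ge0.
apply: (@arc_bounded_of_pieces R E condQ' idxQ (AQ E) (fun=> 1)
  (fun _ l => - (1 - 2 * u) * l%:R) (MQ C1) u v 1280 W (3 * (C1 * 5) * C) (fun _ j l s => \1_(rangeQ j l) s)
  (fun j l => (1 - beta) * v / 2 * `|l%:R - j%:R|) v0 K0 W0).
- exact: mulr_ge0.
- by move=> *; exact: measurable_AQ.
- exact: measurable_cst.
- by move=> *; exact: ler01.
- by move=> *; rewrite /MQ !mulr_ge0 ?expR_ge0.
- move=> r t e r0 Et [e1 rt r4].
  have d0 : 0 < `|r - t| by rewrite normr_gt0 subr_eq0.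
  have d1 : `|r - t| <= 1 by apply: (le_trans (ltW r4)); lra.
  have [j [h1 h2]] := dyadic_scale d0 d1; exists j.
  by move: h1 h2; rewrite !mul1r.
- move=> j l s s0; exact: integral_AQ_le.
- by move=> f j l mf; apply: measurable_indic; exact: measurable_rangeQ.
- by move=> f j l s; rewrite indicE.
- move=> f mf f0 nf j l r t e r0 Et _ [b1' b2 b4 ->].
  have := Q_core mf f0 v0 nf l _ vu r0 (E_ge1 E12 Et) (E_le2 E12 Et) Et b4 b1' b2.
  rewrite u0 u1 => /(_ erefl) /le_trans; apply.
  rewrite le_eqVlt; apply/orP; left; apply/eqP; congr (_ * _ `^ v)%E.
  apply: eq_integral => s _; by rewrite !mul1r indic_rangeQ.
- move=> j; apply: le_trans (hW j%:R); apply: lee_nneseries => [l _ _|l _].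
    by rewrite lee_fin expR_ge0.
  by [].
move=> f s s0; apply: (hC (- ln s) (- ln s)) => // [j l|j l].
  by rewrite /MQ !mulr_ge0 ?expR_ge0// indicE.
have h := Q_exponent j l v0 hc.
have hr := @rangeQ_decay j l s s0.
have tri : (1 - beta) / 4 * `|j%:R - - ln s| + (1 - beta) / 4 * `|l%:R - - ln s| <=
    (1 - beta) / 2 * `|l%:R - j%:R| + `|(minn j l)%:R + ln s|.
  have e1 : 0 <= (1 - beta) / 4 <= 1 / 2 by have := beta0; move=> b0; apply/andP; split; lra.
  rewrite !opprK (_ : (1 - beta) / 2 = 2 * ((1 - beta) / 4)); last by field.
  exact: norm_min_sum.
rewrite (_ : _ * MQ C1 j l = 3 * C1 * expR ((- (1 - 2 * u) * l%:R + (1 - beta) * v / 2 * `|l%:R - j%:R|) / v +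
    - (1 - beta) * (if (j <= l)%N then 2 * l%:R - j%:R else j%:R)) * \1_(rangeQ j l) s); last first.
  by rewrite /MQ expRD; move: (expR _) (expR _) => x y; ring.
apply: (@le_trans _ _ (3 * C1 * expR (- ((1 - beta) / 2 * `|l%:R - j%:R|)) * (5 * expR (- `|(minn j l)%:R + ln s|)))).
  apply: ler_pM => //; first by rewrite !mulr_ge0 ?expR_ge0.
  by apply: ler_wpM2l; [exact: mulr_ge0|rewrite ler_expR].
rewrite (_ : 3 * C1 * _ * _ = 3 * (C1 * 5) * expR (- ((1 - beta) / 2 * `|l%:R - j%:R|) + - `|(minn j l)%:R + ln s|)); last first.
  by rewrite expRD; ring.
rewrite -[leRHS]mulrA -expRD; apply: ler_wpM2l => //.
by rewrite ler_expR -!opprD lerN2.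
Qed.

End StrongQ.

(** * Union of the two regimes and homogeneity *)

Section Transfer.
Context {R : realType}.
Local Notation mu := (@lebesgue_measure R).
Variables (E : set R).

Lemma le_poweR (x y : \bar R) (r : R) : 0 <= r -> (0 <= x)%E -> (x <= y)%E -> (x `^ r <= y `^ r)%E.
Proof.
move=> r0 x0 xy; apply: gt0_ler_poweR => //; rewrite in_itv/= leey andbT//.
exact: le_trans xy.
Qed.

Lemma arc_bounded_or (c1 c2 : R -> R -> R -> Prop) (u v : R) : 0 < v ->
  arc_bounded E c1 u v -> arc_bounded E c2 u v ->
  arc_bounded E (fun r t e => c1 r t e \/ c2 r t e) u v.
Proof.
move=> v0 [K1 K10 h1] [K2 K20 h2]; exists (K1 + K2); first exact: addr_ge0.
move=> f mf f0 nf.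
have [U1 [mU1 U10 i1 b1]] := h1 f mf f0 nf; have [U2 [mU2 U20 i2 b2]] := h2 f mf f0 nf.
have aux (K K' : R) (U U' : \bar R) : 0 <= K -> 0 <= K' -> (0 <= U)%E -> (0 <= U')%E ->
    (K%:E * U `^ v <= (K + K')%:E * (U + U') `^ v)%E.
  move=> k0 k0' u0 u0'; apply: lee_pmul => //; first exact: poweR_ge0.
    by rewrite lee_fin lerDl.
  by apply: le_poweR; [exact: ltW|exact: u0|rewrite leeDl].
exists (fun r => U1 r + U2 r)%E; split.
- exact: emeasurable_funD.
- by move=> r; exact: adde_ge0.
- have mP : measurable [set r : R | (0 < r)%R] by exact: measurable_set_lt.
  under eq_integral => r _ do rewrite ge0_muleDl//.
  rewrite ge0_integralD//.
  + rewrite EFinD ge0_muleDl ?lee_fin//; exact: leeD.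
  + by move=> r /= r0; rewrite mule_ge0// lee_fin ltW.
  + apply: emeasurable_funM; first exact: measurable_funS mU1.
    by apply/measurable_EFinP.
  + by move=> r /= r0; rewrite mule_ge0// lee_fin ltW.
  + apply: emeasurable_funM; first exact: measurable_funS mU2.
    by apply/measurable_EFinP.
- move=> r t e r0 Et [h|h]; first exact: (le_trans (b1 r t e r0 Et h) (aux _ _ _ _ _ _ _ _)).
  by rewrite addrC addeC; exact: (le_trans (b2 r t e r0 Et h) (aux _ _ _ _ _ _ _ _)).
Qed.

Lemma arc_integral_scale (f : R -> R) (e r t la : R) : measurable_fun setT f -> (forall x, 0 <= f x) ->
  0 < la -> (arc_integral f e r t = la%:E * arc_integral (fun s => (f s / la)%R) e r t)%E.
Proof.
move=> mf f0 la0; rewrite /arc_integral -ge0_integralZl//; last 3 first.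
- apply: (@measurable_funS _ _ _ _ setT) => //; apply/measurable_EFinP.
  by apply: measurable_funM => //; apply: measurableT_comp => //; exact: measurable_sdist_cos.
- by move=> p _; rewrite lee_fin divr_ge0// ltW.
- by rewrite lee_fin ltW.
by apply: eq_integral => p _; rewrite -EFinM; congr (_%:E); field; rewrite gt_eqF.
Qed.

Lemma integral_prof_scale (f : R -> R) (u la : R) : measurable_fun setT f -> (forall x, 0 <= f x) ->
  0 < la -> (\int[mu]_s (prof (fun s => (f s / la)%R) u s)%:E =
    (la `^ (- u^-1))%:E * \int[mu]_s (prof f u s)%:E)%E.
Proof.
move=> mf f0 la0; rewrite -ge0_integralZl//; last 3 first.
- by apply/measurable_EFinP; exact: measurable_prof.
- by move=> s _; rewrite lee_fin prof_ge0.
- by rewrite lee_fin powR_ge0.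
apply: eq_integral => s _; rewrite -EFinM; congr (_%:E).
have lE : la^-1 `^ u^-1 = la `^ (- u^-1).
  by rewrite -[la^-1]powR_inv1 ?(ltW la0)// -powRrM mulN1r.
rewrite /prof powRM ?invr_ge0 ?(ltW la0)// lE; ring.
Qed.

(* The homogeneous form of [arc_bounded]. *)
Lemma arc_bounded_hom (cond : R -> R -> R -> Prop) (u v : R) : 0 < u -> 0 < v -> arc_bounded E cond u v ->
  exists2 K : R, 0 <= K & forall f : R -> R, measurable_fun setT f -> (forall x, 0 <= f x) ->
    (\int[mu]_s (prof f u s)%:E < +oo)%E ->
    exists G : R -> \bar R, [/\ measurable_fun setT G, forall r, (0 <= G r)%E,
      ((\int[mu]_(r in [set r | (0 < r)%R]) (G r `^ v^-1 * r%:E)) `^ v <=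
        K%:E * (\int[mu]_s (prof f u s)%:E) `^ u)%E &
      forall r t e, 0 < r -> E t -> cond r t e -> (arc_integral f e r t <= G r)%E].
Proof.
move=> u0 v0 [K K0 hK]; exists (K * K `^ v); first by rewrite mulr_ge0 ?powR_ge0.
move=> f mf f0 fin.
have P0 : (0 <= \int[mu]_s (prof f u s)%:E)%E by apply: integral_ge0 => s _; rewrite lee_fin prof_ge0.
have [p pE] : exists p : R, (\int[mu]_s (prof f u s)%:E = p%:E)%E.
  by exists (fine (\int[mu]_s (prof f u s)%:E)%E); rewrite fineK// ge0_fin_numE.
rewrite pE; have p0 : 0 <= p by rewrite -lee_fin -pE.
(* [la] is the norm used for normalization; it is replaced by 1 for zero mass to avoid dividing by
   0. *)
pose la := if p == 0 then 1 else p `^ u.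
have la0 : 0 < la.
  by rewrite /la; case: eqP => // /eqP pn0; rewrite powR_gt0// lt_neqAle eq_sym pn0.
pose n := la `^ (- u^-1) * p.
have n0 : 0 <= n by rewrite mulr_ge0 ?powR_ge0.
have [n1 nv] : n <= 1 /\ la * n `^ v <= p `^ u.
  rewrite /n /la; case: eqP => [->|/eqP pn0].
    by rewrite mulr0 !powR0 ?gt_eqF// mulr0.
  rewrite -powRrM mulrN divff ?gt_eqF// powR_inv1// mulVf//.
  by rewrite powR1 mulr1.
pose h s := f s / la.
have mh : measurable_fun setT h by exact: measurable_funM.
have h0 s : 0 <= h s by rewrite divr_ge0// ltW.
have nE : (\int[mu]_s (prof h u s)%:E = n%:E)%E by rewrite integral_prof_scale// pE.
clearbody n.
have [|U [mU U0 iU bU]] := hK h mh h0; first by rewrite nE lee_fin.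
pose G r := ((la * K)%:E * U r `^ v)%E.
have laK : 0 <= la * K by rewrite mulr_ge0// ltW.
exists G; split.
- by apply: emeasurable_funM => //; apply: (measurableT_comp (measurable_poweR v)).
- by move=> r; rewrite mule_ge0// poweR_ge0.
- rewrite /G; under eq_integral => r _.
    rewrite poweRM ?lee_fin ?poweR_ge0// poweR_EFin -poweRrM divff ?gt_eqF// poweRe1// -muleA.
    over.
  have mP : measurable [set r : R | (0 < r)%R] by exact: measurable_set_lt.
  rewrite ge0_integralZl//; last 3 first.
  + apply: emeasurable_funM; first exact: measurable_funS mU.
    by apply/measurable_EFinP.
  + by move=> r /= r0; rewrite mule_ge0// lee_fin ltW.
  + by rewrite lee_fin powR_ge0.
  apply: (@le_trans _ _ ((((la * K) `^ v^-1)%:E * (K * n)%:E) `^ v)%E).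
    apply: le_poweR; [exact: ltW| |].
      rewrite mule_ge0 ?lee_fin ?powR_ge0//; apply: integral_ge0 => r /= r0.
      by rewrite mule_ge0// lee_fin ltW.
    by apply: lee_wpmul2l; [rewrite lee_fin powR_ge0|rewrite EFinM -nE].
  rewrite -EFinM !poweR_EFin -EFinM lee_fin (@powRM _ (_ `^ _)) ?powR_ge0 ?mulr_ge0//.
  rewrite -powRrM mulVf ?gt_eqF// powRr1// (@powRM _ K)//.
  rewrite (_ : la * K * _ = K * K `^ v * (la * n `^ v)); last by ring.
  by apply: ler_wpM2l => //; rewrite mulr_ge0 ?powR_ge0.
- move=> r t e r0 Et he; rewrite (arc_integral_scale _ _ _ mf f0 la0) /G EFinM -muleA.
  apply: lee_wpmul2l; first by rewrite lee_fin ltW.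
  exact: bU.
Qed.

End Transfer.

(** * From arcs to the maximal function almost everywhere *)

Section Majorant.
Context {R : realType}.
Local Notation mu := (@lebesgue_measure R).
Local Notation leb2 := (@leb2 R).
Variables (E : set R) (beta : R).
Hypotheses (E12 : E `<=` `[1, 2]%classic).

(** The [expR (- k)]-neighbourhood of [E] has measure at most of order [expR (- (1 - beta) k)],
    which tends to 0 because [beta < 1]. *)
Lemma E_null : 0 <= beta -> beta < 1 -> minkowski_bound E beta ->
  exists N : set R, [/\ measurable N, E `<=` N & mu N = 0%E].
Proof.
move=> b0 b1 /(cover_beta b0 b1)[C C0 HC].
pose N : set R := \bigcap_k nbd E (expR (- k%:R)).
have mN : measurable N by apply: bigcap_measurable => // k _; exact: measurable_nbd.
exists N; split => //.
  by move=> t Et k _; exists t => //; rewrite subrr normr0 expR_gt0.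
have le_k k : (mu N <= (3 * C * expR (- ((1 - beta) * k%:R)))%:E)%E.
  have k0 : 0 <= k%:R :> R by [].
  have [n cn nC] := HC k%:R k0.
  have ek := expR_gt0 (- k%:R : R).
  apply: (le_trans (@measure_covered R E N (expR (- k%:R)) (expR (- k%:R) / 2) 1 0 n _ _ _ cn mN _)).
  - exact: ltW.
  - by rewrite divr_ge0// ltW.
  - by left.
  - move=> r Nr; have [t Et h] := Nr k I; exists t => //.
    by rewrite mul1r addr0.
  rewrite lee_fin (_ : - ((1 - beta) * k%:R) = beta * k%:R + - k%:R); last by ring.
  rewrite expRD mulrA -mulrA mulrA.
  apply: (@le_trans _ _ (C * expR (beta * k%:R) * (2 * expR (- k%:R) + expR (- k%:R) / 2))).
    by apply: ler_wpM2r => //; rewrite addr_ge0// ?mulr_ge0 ?divr_ge0// ltW.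
  have := mulr_ge0 C0 (ltW (mulr_gt0 (expR_gt0 (beta * k%:R)) ek)); lra.
apply/eqP; rewrite eq_le measure_ge0 andbT; apply/lee_addgt0Pr => e e0; rewrite add0e.
have b10 : 0 < 1 - beta by rewrite subr_gt0.
have [k hk] : exists k : nat, 3 * C * expR (- ((1 - beta) * k%:R)) <= e.
  pose y := 3 * C / (e * (1 - beta)).
  have y0 : 0 <= y by rewrite divr_ge0 ?mulr_ge0// ltW// mulr_gt0.
  exists (Num.bound y); set k : R := (Num.bound y)%:R.
  have yk : y < k by exact: archi_boundP.
  have h : (1 - beta) * k <= expR ((1 - beta) * k) by apply: le_trans (expR_ge1Dx _); rewrite lerDr.
  rewrite expRN ler_pdivrMr ?expR_gt0//.
  apply: (@le_trans _ _ (e * ((1 - beta) * k))); last by apply: ler_wpM2l => //; exact: ltW.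
  by rewrite mulrA [leRHS]mulrC -ler_pdivrMr ?mulr_gt0// ltW.
by apply: (le_trans (le_k k)); rewrite lee_fin.
Qed.

Lemma arc_cond (r t e : R) : e = 1 \/ e = -1 -> r != t -> condP r t e \/ condQ' r t e.
Proof.
move=> [->|->] rt; last by left; left.
have [h|h] := leP (1 / 4) `|r - t|; first by left; right.
by right.
Qed.

(** The points whose norm is 0 or lies in a null set containing [E] form a null set by
    [polar_upper]. Elsewhere [r != t] for all [t] in [E], one of the two regimes applies to each
    arc, and [16 = 8 * 2] counts two arcs. *)
Lemma MaxE_ae (f : R * R -> R) (G : R -> \bar R) :
  0 <= beta -> beta < 1 -> minkowski_bound E beta ->
  measurable_fun [set: R * R] f -> radial f ->
  (forall r t e, 0 < r -> E t -> condP r t e \/ condQ' r t e ->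
     (arc_integral (fun s : R => `|f (s, 0%R)|%R) e r t <= G r)%E) ->
  {ae leb2, forall x, (MaxE E f x <= 16%:E * G (enorm x))%E}.
Proof.
move=> b0 b1 hE mf rf hG.
have [N [mN EN N0]] := E_null b0 b1 hE.
pose B : set R := N `|` [set r | r <= 0].
have mB : measurable B by apply: measurableU => //; exact: measurable_set_le.
pose A : set (R * R) := [set x | B (enorm x)].
have mA : measurable A.
  by rewrite -[A]setTI; apply: measurable_enorm.
exists A; split => //.
  apply/eqP; rewrite eq_le measure_ge0 andbT.
  have := @polar_upper R (fun s => (\1_B s)%:E) _ _.
  rewrite (_ : (\int[leb2]_x (\1_B (enorm x))%:E = leb2 A)%E); last first.
    by rewrite -[in RHS](setIT A) /Defs.leb2 -integral_indic//; apply: eq_integral => x _; rewrite !indicE.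
  rewrite (_ : (\int[mu]_(s in [set s | (0 < s)%R]) ((\1_B s)%:E * s%:E) = 0)%E) ?mule0.
    by apply; [apply/measurable_EFinP; exact: measurable_indic|move=> x; rewrite lee_fin].
  have -> : (\int[mu]_(s in [set s : R | (0 < s)%R]) ((\1_B s)%:E * s%:E) =
      \int[mu]_(s in N) (s%:E * (\1_[set s : R | (0 < s)%R] s)%:E))%E.
    rewrite integral_indicR [RHS]integral_indicR; apply: eq_integral => s _.
    rewrite indic_gt0 !indicE -!EFinM; congr (_%:E).
    have [s0|s0] := ltP 0 s; last by rewrite !mulr0 mul0r.
    rewrite !mulr1 mulrC; congr (_ * (nat_of_bool _)%:R).
    apply/idP/idP; rewrite !inE; last by left.
    by case => //= h; move: s0; rewrite ltNge h.
  have mP : measurable [set r : R | (0 < r)%R] by exact: measurable_set_lt.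
  by apply: null_set_integral => //; apply: (@measurable_funS _ _ _ _ setT) => //; apply: measurable_fun_indicM => //; exact/measurable_EFinP.
move=> x /=; apply: contra_notP => nA.
have x0 : 0 < enorm x.
  by rewrite ltNge; apply/negP => h; apply: nA; right.
have xE : ~ E (enorm x) by move=> h; apply: nA; left; exact: EN.
apply: ge_ereal_sup => _ [t Et <-].
apply: (le_trans (circ_avg_le t mf rf x0)).
have xt : enorm x != t by apply/eqP => h; apply: xE; rewrite h.
rewrite (_ : 16 = 8 * 2 :> R); last by ring.
rewrite EFinM -muleA; apply: lee_wpmul2l; first by rewrite lee_fin.
rewrite [leRHS]mule_natl mule2n; apply: leeD; apply: hG => //; apply: arc_cond => //; [left|right]; done.
Qed.

Lemma bounded_rad_of_arcs (u v : R) : 0 <= beta -> beta < 1 -> minkowski_bound E beta ->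
  0 < u -> 0 < v -> arc_bounded E condP u v -> arc_bounded E condQ' u v -> bounded_rad E u v.
Proof.
move=> b0 b1 hE u0 v0 hP hQ.
have [K K0 hK] := arc_bounded_hom u0 v0 (arc_bounded_or v0 hP hQ).
exists (32 `^ v * 16 * K * 2 `^ u) => f mf rf fin.
pose g (s : R) := `|f (s, 0)|.
have mg : measurable_fun setT g := measurable_radial_profile mf.
have g0 s : 0 <= g s by rewrite /g.
have un0 : u != 0 by rewrite gt_eqF.
have vn0 : v != 0 by rewrite gt_eqF.
rewrite /expo (negbTE un0) (negbTE vn0) in fin *.
move: fin; rewrite unlock /Lnorm invrK => fin.
have ui0 : u^-1 != 0 by rewrite invr_eq0.
pose J := (\int[leb2]_x (`|(EFin \o f) x| `^ u^-1))%E.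
have profJ : (\int[mu]_s (prof g u s)%:E <= 2%:E * J)%E.
  have -> : J = (\int[leb2]_x (g (enorm x) `^ u^-1)%:E)%E.
    apply: eq_integral => x _; rewrite /= /g; congr (`|_| `^ _)%:E; apply: rf => /=.
    by rewrite expr0n/= addr0 sqr_sqrtr// addr_ge0// sqr_ge0.
  apply: le_trans (@polar_lower R (fun s => (g s `^ u^-1)%:E) _ _); last 2 first.
  - by apply/measurable_EFinP; exact: measurable_powR_fun.
  - by move=> s; rewrite lee_fin powR_ge0.
  rewrite [leRHS]integral_indicR; apply: le_integral_ge0 => s _; first by rewrite lee_fin prof_ge0.
  by rewrite /prof -!EFinM lee_fin mulrC.
have J0 : (0 <= J)%E by apply: integral_ge0 => x _; exact: poweR_ge0.
have Jfin : (J < +oo)%E by exact: lty_poweRy fin.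
have Pfin : (\int[mu]_s (prof g u s)%:E < +oo)%E.
  by apply: (le_lt_trans profJ); rewrite lte_mul_pinfty// lee_fin.
have [G [mG G0 iG bG]] := hK g mg g0 Pfin.
exists (fun x => 16%:E * G (enorm x))%E; split.
  by apply: emeasurable_funM => //; exact: measurable_enorm_comp.
split; first exact: MaxE_ae.
rewrite invrK -/J.
have mGv : measurable_fun setT (fun s => G s `^ v^-1)%E.
  exact: (measurableT_comp (measurable_poweR v^-1)).
have step : (\int[leb2]_x (`|16%:E * G (enorm x)| `^ v^-1) <=
    (16 `^ v^-1)%:E * (32%:E * \int[mu]_(r in [set r | (0 < r)%R]) (G r `^ v^-1 * r%:E)))%E.
  under eq_integral => x _.
    rewrite gee0_abs ?mule_ge0 ?lee_fin// poweRM ?lee_fin// poweR_EFin.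
    over.
  rewrite ge0_integralZl//; last 2 first.
  - exact: (measurable_enorm_comp mGv).
  - by move=> x _; exact: poweR_ge0.
  apply: lee_wpmul2l; first by rewrite lee_fin powR_ge0.
  by apply: (polar_upper mGv) => s; exact: poweR_ge0.
have I0 : (0 <= \int[mu]_(r in [set r | (0 < r)%R]) (G r `^ v^-1 * r%:E))%E.
  by apply: integral_ge0 => r /= r0; rewrite mule_ge0 ?poweR_ge0// lee_fin ltW.
apply: (@le_trans _ _ _ _ _ (le_poweR (ltW v0) _ step)).
  by apply: integral_ge0 => x _; exact: poweR_ge0.
rewrite !poweRM ?mule_ge0 ?lee_fin ?powR_ge0// poweR_EFin -powRrM mulVf// powRr1//.
rewrite (_ : (32 `^ v * 16 * K * 2 `^ u)%:E = 16%:E * ((32 `^ v)%:E * (K%:E * (2 `^ u)%:E)))%E; last first.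
  by rewrite -!EFinM; congr (_%:E); ring.
rewrite -!muleA; apply: lee_wpmul2l; first by rewrite lee_fin.
apply: lee_wpmul2l; first by rewrite lee_fin powR_ge0.
apply: (le_trans iG); apply: lee_wpmul2l; first by rewrite lee_fin.
rewrite -poweR_EFin -poweRM ?lee_fin//.
apply: le_poweR => //; first exact: ltW.
by apply: integral_ge0 => s _; rewrite lee_fin prof_ge0.
Qed.

End Majorant.

(** * Masses of level sets seen through the pieces *)

Section WeakEngine.
Context {R : realType}.
Local Notation mu := (@lebesgue_measure R).
Variables (A : nat -> nat -> set (R * R)) (om : R -> R) (g : R -> R) (b k mm : nat -> nat -> R) (u v h : R).
Hypotheses (mA : forall i l, measurable (A i l)) (mom : measurable_fun setT om)
  (om01 : forall r, 0 <= om r <= 1) (mg : measurable_fun setT g)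
  (hM : forall i l s, 0 < s ->
    (\int[mu]_(r in [set r | (0 < r)%R]) ((om r * \1_(A i l) (r, s)) * r)%:E <= (expR (mm i l))%:E)%E)
  (h0 : 0 < h) (hv : h < v) (hvu : v + h <= u - h).

Definition lweight (s lam : R) : R :=
  \1_[set s : R | (0 < s)%R] s * \1_[set z : R * R | (z.2 < g z.1)%R] (s, lam) * s.

Lemma lweight_ge0 s lam : 0 <= lweight s lam.
Proof.
rewrite /lweight indic_gt0; have [s0|_] := ltP 0 s; last by rewrite !mul0r.
by rewrite mul1r mulr_ge0 ?(ltW s0)// indicE.
Qed.

Lemma lweight_le0 s lam : s <= 0 -> lweight s lam = 0.
Proof. by rewrite /lweight indic_gt0 => s0; rewrite ltNge s0 !mul0r. Qed.

Lemma measurable_level : measurable [set z : R * R | (z.2 < g z.1)%R].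
Proof.
apply: measurable_set_lt; first exact: measurable_snd.
by apply: (measurableT_comp mg); exact: measurable_fst.
Qed.

Lemma measurable_lweight : measurable_fun setT (fun z : R * R => lweight z.1 z.2).
Proof.
apply: measurable_funM; last exact: measurable_fst.
apply: measurable_funM; last first.
  rewrite (_ : (fun x : R * R => _) = \1_[set z : R * R | (z.2 < g z.1)%R]); last by apply/funext => -[].
  by apply: measurable_indic; exact: measurable_level.
apply: (@measurableT_comp _ _ _ _ _ _ (\1_[set s : R | (0 < s)%R] : R -> R)); last exact: measurable_fst.
by apply: measurable_indic; exact: measurable_set_lt.
Qed.

(** Up to [2 * pi], the planar measure of the level set of height [lam] of the radial function with
    profile [g]. *)
Definition area (lam : R) : \bar R := (\int[mu]_s (lweight s lam)%:E)%E.

Lemma area_ge0 lam : (0 <= area lam)%E.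
Proof. by apply: integral_ge0 => s _; rewrite lee_fin lweight_ge0. Qed.

Lemma measurable_area : measurable_fun setT area.
Proof.
apply: (@measurable_fun_fubini_tonelli_G _ _ _ _ _ mu (fun z : R * R => (lweight z.1 z.2)%:E)).
  by apply/measurable_EFinP; exact: measurable_lweight.
by move=> z; rewrite lee_fin lweight_ge0.
Qed.

Definition zterm i l (w : (R * R) * R) : R :=
  om w.1.1 * \1_(A i l) (w.1.1, w.2) * lweight w.2 w.1.2.

Lemma zterm_ge0 i l w : 0 <= zterm i l w.
Proof.
have /andP[q0 _] := om01 (w.1.1).
by apply: mulr_ge0; [apply: mulr_ge0 => //; rewrite indicE|exact: lweight_ge0].
Qed.

Lemma measurable_zterm i l : measurable_fun setT (zterm i l).
Proof.
have mw1 : measurable_fun setT (fun w : (R * R) * R => w.1.1).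
  by apply: (measurableT_comp (@measurable_fst _ _ R R)); exact: measurable_fst.
have mw2 : measurable_fun setT (fun w : (R * R) * R => w.1.2).
  by apply: (measurableT_comp (@measurable_snd _ _ R R)); exact: measurable_fst.
have mw3 : measurable_fun setT (fun w : (R * R) * R => w.2) by exact: measurable_snd.
apply: measurable_funM; last first.
  apply: (@measurableT_comp _ _ _ _ _ _ (fun z : R * R => lweight z.1 z.2) _ (fun w : (R * R) * R => (w.2, w.1.2))).
    exact: measurable_lweight.
  exact: measurable_fun_pair.
apply: measurable_funM; first exact: measurableT_comp.
apply: (@measurableT_comp _ _ _ _ _ _ (\1_(A i l) : R * R -> R) _ (fun w : (R * R) * R => (w.1.1, w.2))).
  exact: measurable_indic.
exact: measurable_fun_pair.
Qed.

(** For [z = (r, lam)], the part of the level set of height [lam] that the piece [(i, l)] sees from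
    radius [r], weighted by [om r]. *)
Definition zeta i l (z : R * R) : \bar R := (\int[mu]_s (zterm i l (z, s))%:E)%E.

Lemma zeta_ge0 i l z : (0 <= zeta i l z)%E.
Proof. by apply: integral_ge0 => s _; rewrite lee_fin zterm_ge0. Qed.

Lemma measurable_zeta i l : measurable_fun setT (zeta i l).
Proof.
apply: (@measurable_fun_fubini_tonelli_F _ _ _ _ _ mu (fun w => (zterm i l w)%:E)).
  by apply/measurable_EFinP; exact: measurable_zterm.
by move=> w; rewrite lee_fin zterm_ge0.
Qed.

Lemma zeta_le_area i l r lam : (zeta i l (r, lam) <= area lam)%E.
Proof.
apply: le_integral_ge0 => s _; first by rewrite lee_fin zterm_ge0.
rewrite lee_fin; have /andP[q0 q1] := om01 r.
apply: ler_piMl; first exact: lweight_ge0.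
by apply: mulr_ile1 => //=; rewrite indicE; case: (_ \in _).
Qed.

Lemma integral_zeta_le i l lam :
  (\int[mu]_(r in [set r | (0 < r)%R]) (zeta i l (r, lam) * r%:E) <= (expR (mm i l))%:E * area lam)%E.
Proof.
pose rp (r : R) : R := r * \1_[set r : R | (0 < r)%R] r.
have rp0 r : 0 <= rp r.
  by rewrite /rp indic_gt0; have [r0|_] := ltP 0 r; rewrite ?mulr0// mulr1 ltW.
have mrp : measurable_fun setT rp.
  by apply: measurable_funM => //; apply: measurable_indic; exact: measurable_set_lt.
pose G (z : R * R) : \bar R := (zterm i l ((z.1, lam), z.2) * rp z.1)%:E.
have mG : measurable_fun setT G.
  apply/measurable_EFinP; apply: measurable_funM; last first.
    by apply: (measurableT_comp mrp); exact: measurable_fst.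
  apply: (@measurableT_comp _ _ _ _ _ _ (zterm i l) _ (fun z : R * R => ((z.1, lam), z.2))).
    exact: measurable_zterm.
  apply: measurable_fun_pair; last exact: measurable_snd.
  by apply: measurable_fun_pair => //; exact: measurable_fst.
have G0 z : (0 <= G z)%E by rewrite lee_fin mulr_ge0// zterm_ge0.
have -> : (\int[mu]_(r in [set r | (0 < r)%R]) (zeta i l (r, lam) * r%:E) = \int[mu]_r \int[mu]_s G (r, s))%E.
  rewrite integral_indicR; apply: eq_integral => r _.
  rewrite /G/= -muleA -EFinM -/(rp r); under [RHS]eq_integral do rewrite EFinM.
  rewrite ge0_integralZr ?lee_fin//; last by move=> s _; rewrite lee_fin zterm_ge0.
  apply/measurable_EFinP.
  by apply: (@measurableT_comp _ _ _ _ _ _ (zterm i l) _ (pair (r, lam))); [exact: measurable_zterm|exact: pair1_measurable].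
rewrite (@fubini_tonelli _ _ _ _ _ mu mu G)//=.
rewrite -ge0_integralZl//; last 2 first.
- apply/measurable_EFinP.
  by apply: (@measurableT_comp _ _ _ _ _ _ (fun z : R * R => lweight z.1 z.2) _ (pair^~ lam)); [exact: measurable_lweight|exact: pair2_measurable].
- by move=> s _; rewrite lee_fin lweight_ge0.
apply: le_integral_ge0 => s _; first by apply: integral_ge0.
have [s0|s0] := leP s 0.
  rewrite lweight_le0// mule0 integral0_eq// => r _.
  by rewrite /G /zterm/= lweight_le0// mulr0 mul0r.
apply: (@le_trans _ _ ((lweight s lam)%:E * \int[mu]_(r in [set r | (0 < r)%R]) ((om r * \1_(A i l) (r, s)) * r)%:E)%E); last first.
  rewrite [leRHS]muleC; apply: lee_wpmul2l; first by rewrite lee_fin lweight_ge0.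
  exact: hM.
rewrite integral_indicR -ge0_integralZl ?lee_fin ?lweight_ge0//; last 2 first.
- apply: measurable_fun_indicM; first exact: measurable_set_lt.
  apply/measurable_EFinP; apply: measurable_funM => //; apply: measurable_funM => //.
  apply: (@measurableT_comp _ _ _ _ _ _ (\1_(A i l) : R * R -> R) _ (pair^~ s)); first exact: measurable_indic.
  exact: pair2_measurable.
- move=> r _; rewrite -EFinM lee_fin indic_gt0; have [r0|_] := ltP 0 r; last by rewrite mulr0.
  have /andP[q0 _] := om01 r.
  by rewrite mulr1 mulr_ge0 ?(ltW r0)// mulr_ge0// indicE.
apply: le_integral_ge0 => r _; first exact: G0.
rewrite /G /zterm /rp/= -!EFinM lee_fin le_eqVlt; apply/orP; left; apply/eqP; ring.
Qed.

End WeakEngine.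

(** * Interpolated estimates for indicators of level sets *)

Section WeakSum.
Context {R : realType}.
Local Notation mu := (@lebesgue_measure R).
Variables (A : nat -> nat -> set (R * R)) (om : R -> R) (g : R -> R) (b k mm : nat -> nat -> R) (u v h : R).
Hypotheses (mA : forall i l, measurable (A i l)) (mom : measurable_fun setT om)
  (om01 : forall r, 0 <= om r <= 1) (mg : measurable_fun setT g)
  (hM : forall i l s, 0 < s ->
    (\int[mu]_(r in [set r | (0 < r)%R]) ((om r * \1_(A i l) (r, s)) * r)%:E <= (expR (mm i l))%:E)%E)
  (h0 : 0 < h) (hv : h < v) (hvu : v + h <= u - h).


Local Notation zeta := (zeta A om g).
Local Notation area := (area g).

(** The power [u' - v'] is bounded through [x <= a]. Since [v' <= 1], the power [v'] is at most
    [c^v'] below [c] and [c^(v' - 1) x] above, an affine bound that can be integrated. *)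
Lemma powR_interpolate (x c a u' v' : R) : 0 <= x -> x <= a -> 0 < c -> 0 < v' -> v' <= u' -> v' <= 1 ->
  x `^ u' <= a `^ (u' - v') * (c `^ (v' - 1) * x + c `^ v').
Proof.
move=> x0 xa c0 v0 vu v1.
have a0 : 0 <= a by exact: le_trans xa.
have [->|xn0] := eqVneq x 0.
  rewrite powR0; last by rewrite gt_eqF// (lt_le_trans v0).
  by rewrite mulr_ge0 ?powR_ge0// addr_ge0 ?mulr_ge0 ?powR_ge0.
have xp : 0 < x by rewrite lt_neqAle eq_sym xn0.
rewrite -[X in x `^ X](subrK v') (@powRD _ x); last by rewrite xn0 implybT.
apply: ler_pM; rewrite ?powR_ge0//.
  by apply: ge0_ler_powR; rewrite ?nnegrE// subr_ge0.
have [xc|cx] := leP x c.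
  apply: ler_wpDl; first by rewrite mulr_ge0 ?powR_ge0.
  by apply: ge0_ler_powR; rewrite ?nnegrE ?(ltW v0) ?(ltW c0).
apply: ler_wpDr; first exact: powR_ge0.
rewrite -[X in x `^ X](subrK 1) (@powRD _ x) ?xn0 ?implybT// powRr1//.
apply: ler_wpM2r => //.
have -> : v' - 1 = - (1 - v') by ring.
rewrite !powRN lef_pV2 ?posrE ?powR_gt0//.
by apply: ge0_ler_powR; rewrite ?nnegrE ?subr_ge0 ?(ltW c0)// ltW.
Qed.

Lemma integral_power_zeta_le i l lam la y (A' : set R) (u' v' : R) :
  measurable A' -> A' `<=` [set r | 0 < r] -> (\int[mu]_(r in A') r%:E = (expR y)%:E)%E ->
  area lam = (expR la)%:E -> 0 < v' -> v' <= u' -> v' <= 1 ->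
  (\int[mu]_(r in A') (((expR (k i l))%:E * zeta i l (r, lam)) `^ u' * r%:E) <=
   (2 * expR (u' * (k i l + la) + v' * (mm i l - y) + y))%:E)%E.
Proof.
move=> mA' A'0 hy ha v0 vu v1.
(* [expR x0] is the pointwise bound and [expR z] a bound for the mean of [expR (k i l) * zeta] over
   [A']; taking [c = expR z] balances the two terms, hence the 2. *)
pose x0 := k i l + la; pose z := k i l + mm i l + la - y.
pose P := expR ((u' - v') * x0) * expR (z * (v' - 1)).
pose Q := expR ((u' - v') * x0) * expR (z * v').
have P0 : 0 <= P by rewrite mulr_ge0 ?expR_ge0.
have Q0 : 0 <= Q by rewrite mulr_ge0 ?expR_ge0.
have mzr : measurable_fun setT (fun r : R => zeta i l (r, lam) * r%:E)%E.
  apply: emeasurable_funM; last exact/measurable_EFinP.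
  apply: (@measurableT_comp _ _ _ _ _ _ (zeta i l) _ (pair^~ lam)); last exact: pair2_measurable.
  exact: measurable_zeta.
have z0 r : (0 <= zeta i l (r, lam))%E by exact: zeta_ge0.
apply: (@le_trans _ _ (\int[mu]_(r in A') ((P * expR (k i l))%:E * (zeta i l (r, lam) * r%:E) + Q%:E * r%:E))%E).
  apply: le_integral_ge0 => r Ar; have r0 : 0 < r by exact: A'0.
    by rewrite mule_ge0 ?poweR_ge0// lee_fin ltW.
  have zl : (zeta i l (r, lam) <= (expR la)%:E)%E by rewrite -ha; exact: zeta_le_area.
  have [w wE] : exists w : R, zeta i l (r, lam) = w%:E.
    exists (fine (zeta i l (r, lam))); rewrite fineK// ge0_fin_numE//.
    by apply: (le_lt_trans zl); rewrite ltry.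
  have w0 : 0 <= w by rewrite -lee_fin -wE.
  have wl : w <= expR la by rewrite -lee_fin -wE.
  rewrite wE.
  rewrite -!EFinM -EFinD lee_fin (_ : P * _ * _ + _ = (P * (expR (k i l) * w) + Q) * r); last by ring.
  apply: ler_wpM2r; first exact: ltW.
  have := @powR_interpolate (expR (k i l) * w) (expR z) (expR x0) u' v' _ _ (expR_gt0 _) v0 vu v1.
  rewrite !expR_powR => /(_ _ _)/le_trans; apply.
  - by rewrite mulr_ge0 ?expR_ge0.
  - by rewrite /x0 expRD ler_pM2l ?expR_gt0.
  - by rewrite /P /Q [x0 * _]mulrC mulrDr mulrA.
have mr : measurable_fun A' (fun r : R => r%:E) by exact/measurable_EFinP.
rewrite ge0_integralD//; last 4 first.
- by move=> r /A'0 r0; rewrite mule_ge0 ?mule_ge0 ?lee_fin ?mulr_ge0 ?expR_ge0// ltW.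
- by apply: emeasurable_funM => //; exact: measurable_funS mzr.
- by move=> r /A'0 r0; rewrite mule_ge0 ?lee_fin// ltW.
- exact: emeasurable_funM.
rewrite !ge0_integralZl//; last 4 first.
- by move=> r /A'0 r0; rewrite lee_fin ltW.
- exact: measurable_funS mzr.
- by move=> r /A'0 r0; rewrite mule_ge0 ?lee_fin// ltW.
- by rewrite lee_fin mulr_ge0 ?expR_ge0.
rewrite hy.
have hz : (\int[mu]_(r in A') (zeta i l (r, lam) * r%:E) <= (expR (mm i l))%:E * (expR la)%:E)%E.
  rewrite -ha; apply: (@le_trans _ _ (\int[mu]_(r in [set r | (0 < r)%R]) (zeta i l (r, lam) * r%:E))%E); last exact: integral_zeta_le.
  apply: ge0_subset_integral => //; first exact: measurable_set_lt.
    exact: measurable_funS mzr.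
  by move=> r /= r0; rewrite mule_ge0 ?lee_fin// ltW.
apply: (@le_trans _ _ ((P * expR (k i l))%:E * ((expR (mm i l))%:E * (expR la)%:E) + Q%:E * (expR y)%:E)%E).
  by apply: leeD => //; apply: lee_wpmul2l => //; rewrite lee_fin mulr_ge0 ?expR_ge0.
have hP : P * expR (k i l) * (expR (mm i l) * expR la) = expR (u' * (k i l + la) + v' * (mm i l - y) + y).
  by rewrite /P -!expRD; congr expR; rewrite /z /x0; ring.
have hQ : Q * expR y = expR (u' * (k i l + la) + v' * (mm i l - y) + y).
  by rewrite /Q -!expRD; congr expR; rewrite /z /x0; ring.
by rewrite -!EFinM -EFinD lee_fin hP hQ -mulr2n mulr_natl.
Qed.

(** An indicator equals its powers, so the piece bound holds with [u - h] as well as [u + h], and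
    the smaller one is kept. *)
Definition hterm i l z : \bar R :=
  ((expR (b i l))%:E * mine (((expR (k i l))%:E * zeta i l z) `^ (u - h))
    (((expR (k i l))%:E * zeta i l z) `^ (u + h)))%E.

Lemma hterm_ge0 i l z : (0 <= hterm i l z)%E.
Proof. by rewrite mule_ge0 ?lee_fin ?expR_ge0// le_min !poweR_ge0. Qed.

Lemma measurable_hterm i l : measurable_fun setT (hterm i l).
Proof.
have mz : measurable_fun setT (fun z => (expR (k i l))%:E * zeta i l z)%E.
  by apply: emeasurable_funM => //; exact: measurable_zeta.
apply: emeasurable_funM => //; apply: measurable_mine.
  exact: (measurableT_comp (measurable_poweR _) mz).
exact: (measurableT_comp (measurable_poweR _) mz).
Qed.

Definition hsum z : \bar R := (\sum_(i <oo) \sum_(l <oo) hterm i l z)%E.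

Lemma hsum_ge0 z : (0 <= hsum z)%E.
Proof. by apply: nneseries_ge0 => i _ _; apply: nneseries_ge0 => l _ _; exact: hterm_ge0. Qed.

Lemma measurable_hsum : measurable_fun setT hsum.
Proof.
apply: ge0_emeasurable_sum => [i z _ _|i _].
  by apply: nneseries_ge0 => l _ _; exact: hterm_ge0.
by apply: ge0_emeasurable_sum => [l z _ _|l _]; [exact: hterm_ge0|exact: measurable_hterm].
Qed.

(* The four exponents [(u +- h, v +- h)] give the decay in both variables. *)
Lemma integral_hterm_le i l lam la y (A' : set R) :
  v + h <= 1 -> measurable A' -> A' `<=` [set r | 0 < r] -> (\int[mu]_(r in A') r%:E = (expR y)%:E)%E ->
  area lam = (expR la)%:E ->
  (\int[mu]_(r in A') (hterm i l (r, lam) * r%:E) <=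
   (2 * expR (u * la + (1 - v) * y) *
     expR (b i l + u * k i l + v * mm i l - h * `|k i l + la| - h * `|mm i l - y|))%:E)%E.
Proof.
move=> v1 mA' A'0 hy ha.
(* The signs of [k i l + la] and [mm i l - y] select the exponents so that both perturbations by [h]
   are gains. *)
pose u' := if 0 <= k i l + la then u - h else u + h.
pose v' := if 0 <= mm i l - y then v - h else v + h.
have hh := h0; have hv' := hv; have hvu' := hvu.
have v'0 : 0 < v' by rewrite /v'; case: ifP => _; lra.
have vu' : v' <= u' by rewrite /u' /v'; case: ifP => _; case: ifP => _; lra.
have v'1 : v' <= 1 by rewrite /v'; case: ifP => _; lra.
have := integral_power_zeta_le i l mA' A'0 hy ha v'0 vu' v'1.
set I1 := (X in (X <= _)%E -> _) => hI.
have mX : measurable_fun setT (fun r : R => ((expR (k i l))%:E * zeta i l (r, lam)) `^ u' * r%:E)%E.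
  apply: emeasurable_funM; last exact/measurable_EFinP.
  apply: (measurableT_comp (measurable_poweR _)); apply: emeasurable_funM => //.
  apply: (@measurableT_comp _ _ _ _ _ _ (zeta i l) _ (pair^~ lam)); last exact: pair2_measurable.
  exact: measurable_zeta.
apply: (@le_trans _ _ ((expR (b i l))%:E * I1)%E).
  rewrite /I1 -ge0_integralZl//; last 2 first.
  - exact: measurable_funS mX.
  - by move=> r /A'0 r0; rewrite mule_ge0 ?poweR_ge0// lee_fin ltW.
  apply: le_integral_ge0 => r /A'0 r0.
    by rewrite mule_ge0 ?hterm_ge0// lee_fin ltW.
  rewrite /hterm -muleA; apply: lee_wpmul2l; first by rewrite lee_fin expR_ge0.
  apply: lee_wpmul2r; first by rewrite lee_fin ltW.
  by rewrite /u' ge_min; case: ifP => _; rewrite lexx ?orbT.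
apply: (@le_trans _ _ ((expR (b i l))%:E * (2 * expR (u' * (k i l + la) + v' * (mm i l - y) + y))%:E)%E).
  by apply: lee_wpmul2l => //; rewrite lee_fin expR_ge0.
rewrite -EFinM lee_fin mulrCA -mulrA -!expRD; apply: ler_wpM2l => //; rewrite ler_expR.
have -> : u' * (k i l + la) = u * (k i l + la) - h * `|k i l + la|.
  by rewrite /u'; case: (ger0P (k i l + la)) => _; ring.
have -> : v' * (mm i l - y) = v * (mm i l - y) - h * `|mm i l - y|.
  by rewrite /v'; case: (ger0P (mm i l - y)) => _; ring.
by rewrite le_eqVlt; apply/orP; left; apply/eqP; ring.
Qed.

Lemma integral_hsum_le (C : R) : v + h <= 1 -> 0 < C -> 
  (forall x y, (\sum_(i <oo) \sum_(l <oo)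
     (expR (b i l + u * k i l + v * mm i l - h * `|k i l + x| - h * `|mm i l - y|))%:E <= C%:E)%E) ->
  forall lam y (A' : set R), measurable A' -> A' `<=` [set r | 0 < r] ->
  (\int[mu]_(r in A') r%:E = (expR y)%:E)%E ->
  (\int[mu]_(r in A') (hsum (r, lam) * r%:E) <= (2 * C * expR ((1 - v) * y))%:E * area lam `^ u)%E.
Proof.
move=> v1 C0 hC lam y A' mA' A'0 hy.
have u0 : 0 < u by have := h0; have := hv; have := hvu; lra.
have K0 : 0 < 2 * C * expR ((1 - v) * y) by rewrite !mulr_gt0 ?expR_gt0.
have [ay|afin] := eqVneq (area lam) +oo%E.
  by rewrite ay poweRyr ?gt_eqF// gt0_muley ?leey// lte_fin.
have [a aE] : exists a : R, area lam = a%:E.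
  by exists (fine (area lam)); rewrite fineK// ge0_fin_numE ?area_ge0// ltey.
have a0 : 0 <= a by rewrite -lee_fin -aE area_ge0.
have uh : u - h != 0 /\ u + h != 0.
  by split; rewrite gt_eqF//; have := h0; have := hv; have := hvu; lra.
have [az|an0] := eqVneq a 0.
  rewrite integral0_eq; first by rewrite mule_ge0 ?lee_fin ?poweR_ge0// ltW.
  move=> r Ar; rewrite /hsum.
  have z0 i l : zeta i l (r, lam) = 0%E.
    apply/eqP; rewrite eq_le zeta_ge0// andbT; apply: (@le_trans _ _ (area lam)); last by rewrite aE az.
    exact: zeta_le_area.
  rewrite eseries0 ?mul0e// => i _ _; rewrite eseries0// => l _ _.
  by rewrite /hterm z0 mule0 !poweR0r ?(proj1 uh) ?(proj2 uh)// minxx mule0.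
have ap : 0 < a by rewrite lt_neqAle eq_sym an0.
have aE' : area lam = (expR (ln a))%:E by rewrite lnK.
have mh i l : measurable_fun A' (fun r : R => hterm i l (r, lam) * r%:E)%E.
  apply: emeasurable_funM; last exact/measurable_EFinP.
  apply: (@measurable_funS _ _ _ _ setT) => //.
  apply: (@measurableT_comp _ _ _ _ _ _ (hterm i l) _ (pair^~ lam)); last exact: pair2_measurable.
  exact: measurable_hterm.
have th0 i l r : A' r -> (0 <= hterm i l (r, lam) * r%:E)%E.
  by move=> /A'0 r0; rewrite mule_ge0 ?hterm_ge0// lee_fin ltW.
have -> : (\int[mu]_(r in A') (hsum (r, lam) * r%:E) =
    \int[mu]_(r in A') \sum_(i <oo) \sum_(l <oo) (hterm i l (r, lam) * r%:E))%E.
  apply: eq_integral => r; rewrite inE => /A'0 r0; rewrite muleC /hsum -nneseriesZl; last first.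
    by move=> i _; apply: nneseries_ge0 => l _ _; exact: hterm_ge0.
  apply: eq_eseriesr => i _; rewrite -nneseriesZl; last by move=> l _; exact: hterm_ge0.
  by apply: eq_eseriesr => l _; rewrite muleC.
rewrite integral_nneseries//; last 2 first.
- move=> i; apply: ge0_emeasurable_sum => [l r Ar _|l _]; [exact: th0|exact: mh].
- by move=> i r Ar; apply: nneseries_ge0 => l _ _; exact: th0.
pose L := 2 * expR (u * ln a + (1 - v) * y).
have L0 : 0 <= L by rewrite mulr_ge0 ?expR_ge0.
apply: (@le_trans _ _ (\sum_(i <oo) (L%:E * \sum_(l <oo)
     (expR (b i l + u * k i l + v * mm i l - h * `|k i l + ln a| - h * `|mm i l - y|))%:E))%E).
  apply: lee_nneseries => [i _ _|i _].
    by apply: integral_ge0 => r Ar; apply: nneseries_ge0 => l _ _; exact: th0.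
  rewrite integral_nneseries//; last 2 first.
  - by move=> l; exact: mh.
  - by move=> l r Ar; exact: th0.
  rewrite -nneseriesZl; last by move=> l _; rewrite lee_fin expR_ge0.
  apply: lee_nneseries => [l _ _|l _]; first by apply: integral_ge0 => r Ar; exact: th0.
  by rewrite -EFinM; exact: integral_hterm_le.
rewrite nneseriesZl; last by move=> i _; apply: nneseries_ge0 => l _ _; rewrite lee_fin expR_ge0.
apply: (@le_trans _ _ (L%:E * C%:E)%E); first by apply: lee_wpmul2l; rewrite ?lee_fin.
rewrite aE poweR_EFin -!EFinM lee_fin /L expRD le_eqVlt; apply/orP; left; apply/eqP.
rewrite -[a in RHS]lnK ?posrE// expR_powR [ln a * u]mulrC; ring.
Qed.

End WeakSum.

(** * The layer-cake decomposition and the dual form of weak type *)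

Section WeakArc.
Context {R : realType}.
Local Notation mu := (@lebesgue_measure R).

Definition lev (f : R -> R) (lam s : R) : R := \1_[set s | (lam < f s)%R] s.

Lemma measurable_lev f lam : measurable_fun setT f -> measurable_fun setT (lev f lam).
Proof. by move=> mf; apply: measurable_indic; exact: measurable_set_lt. Qed.

Lemma lev_ge0 f lam s : 0 <= lev f lam s.
Proof. by rewrite /lev indicE. Qed.

Lemma levE f lam s : lev f lam s = (lam < f s)%R%:R.
Proof. by rewrite /lev indicE; congr (nat_of_bool _)%:R; apply/idP/idP; rewrite inE. Qed.

Lemma arc_integral_layer (f : R -> R) e r t : measurable_fun setT f -> (forall x, 0 <= f x) ->
  (arc_integral f e r t = \int[mu]_(lam in [set lam | (0 < lam)%R]) arc_integral (lev f lam) e r t)%E.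
Proof.
move=> mf f0.
pose I : set R := `]0%R, (@trigo.pi R / 2)%R]%classic.
have mI : measurable I by exact: measurable_itv.
pose sd p := sdist r t (e * cos p).
have msd : measurable_fun setT sd by exact: measurable_sdist_cos.
pose F (z : R * R) : \bar R := (\1_I z.1 * ((0 < z.2)%R%:R * (z.2 < f (sd z.1))%R%:R))%:E.
have F0 z : (0 <= F z)%E by rewrite lee_fin !mulr_ge0// indicE.
have mF : measurable_fun setT F.
  apply/measurable_EFinP; apply: measurable_funM.
    by apply: (@measurableT_comp _ _ _ _ _ _ (\1_I : R -> R)); [exact: measurable_indic|exact: measurable_fst].
  apply: measurable_funM.
    rewrite (_ : (fun x => _) = \1_[set z : R * R | (0 < z.2)%R]).
      by apply: measurable_indic; apply: measurable_set_lt => //; exact: measurable_snd.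
    by apply/funext => z; rewrite indicE; congr (nat_of_bool _)%:R; apply/idP/idP; rewrite inE.
  rewrite (_ : (fun x => _) = \1_[set z : R * R | (z.2 < f (sd z.1))%R]).
    apply: measurable_indic; apply: measurable_set_lt; first exact: measurable_snd.
    apply: (@measurableT_comp _ _ _ _ _ _ (f \o sd)); last exact: measurable_fst.
    exact: measurableT_comp.
  by apply/funext => z; rewrite indicE; congr (nat_of_bool _)%:R; apply/idP/idP; rewrite inE.
have -> : (arc_integral f e r t = \int[mu]_p \int[mu]_lam F (p, lam))%E.
  rewrite /arc_integral integral_indicR; apply: eq_integral => p _.
  rewrite /F/=; under [RHS]eq_integral do rewrite EFinM.
  rewrite ge0_integralZl//; last first.
  - apply/measurable_EFinP; apply: measurable_funM.
      rewrite (_ : (fun x => _) = \1_[set z : R | (0 < z)%R]).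
        by apply: measurable_indic; exact: measurable_set_lt.
      by apply/funext => z; rewrite indic_gt0.
    rewrite (_ : (fun x => _) = \1_[set z : R | (z < f (sd p))%R]).
      by apply: measurable_indic; exact: measurable_set_lt.
    by apply/funext => z; rewrite indicE; congr (nat_of_bool _)%:R; apply/idP/idP; rewrite inE.
  rewrite muleC; congr (_ * _)%E.
  rewrite (_ : (\int[mu]_x ((0 < x)%R%:R * (x < f (sd p))%R%:R)%:E =
     \int[mu]_x (\1_(`]0%R, f (sd p)[%classic) x)%:E)%E); last first.
    apply: eq_integral => x _; congr (_%:E); rewrite indicE -natrM mulnb.
    by congr (nat_of_bool _)%:R; apply/idP/idP; rewrite inE/= in_itv.
  have muE : mu `]0%R, f (sd p)[%classic = (f (sd p))%:E.
    rewrite lebesgue_measure_itv/= lte_fin.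
    by case: ltgtP (f0 (sd p)) => // [_ _|<-//]; rewrite -EFinB subr0.
  by rewrite integral_indic// setIT; apply/esym; exact: muE.
rewrite (@fubini_tonelli _ _ _ _ _ mu mu F)//= [RHS]integral_indicR.
apply: eq_integral => lam _; rewrite indic_gt0.
rewrite /arc_integral integral_indicR muleC -ge0_integralZl//; last 2 first.
- apply: measurable_fun_indicM => //; apply/measurable_EFinP.
  by apply: (measurableT_comp (measurable_lev lam mf)).
- by move=> p _; rewrite mule_ge0// lee_fin lev_ge0.
by apply: eq_integral => p _; rewrite /F/= -!EFinM levE; congr (_%:E); rewrite /sd; ring.
Qed.

(** Weak [L^q] in dual form: on a set of mass [expR y] for [r dr], the integral of [G] is at most
    the mass to the power [1 - 1/q] times the [L^{p,1}] norm, up to constants. This form is additive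
    in [G], so levels and pieces can be summed. *)
Definition weak_arc_bounded (E : set R) (cond : R -> R -> R -> Prop) (u v : R) : Prop :=
  exists2 C : R, 0 < C & forall f : R -> R, measurable_fun setT f -> (forall x, 0 <= f x) ->
    exists G : R -> \bar R, [/\ measurable_fun setT G, forall r, (0 <= G r)%E,
      forall y (A' : set R), measurable A' -> A' `<=` [set r | 0 < r] ->
        (\int[mu]_(r in A') r%:E = (expR y)%:E)%E ->
        (\int[mu]_(r in A') (G r * r%:E) <= (C * expR ((1 - v) * y))%:E *
           \int[mu]_(lam in [set lam | (0 < lam)%R]) area f lam `^ u)%E &
      forall r t e, 0 < r -> E t -> cond r t e -> (arc_integral f e r t <= G r)%E].

Lemma weak_arc_of_pieces (E : set R) (cond : R -> R -> R -> Prop) (A : nat -> nat -> set (R * R)) (om : R -> R)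
    (b k mm : nat -> nat -> R) (u v h C : R) :
  (forall i l, measurable (A i l)) -> measurable_fun setT om -> (forall r, 0 <= om r <= 1) ->
  (forall i l s, 0 < s ->
    (\int[mu]_(r in [set r | (0 < r)%R]) ((om r * \1_(A i l) (r, s)) * r)%:E <= (expR (mm i l))%:E)%E) ->
  0 < h -> h < v -> v + h <= u - h -> v + h <= 1 -> 0 < C ->
  (forall x y, (\sum_(i <oo) \sum_(l <oo)
     (expR (b i l + u * k i l + v * mm i l - h * `|k i l + x| - h * `|mm i l - y|))%:E <= C%:E)%E) ->
  (forall f : R -> R, measurable_fun setT f -> forall lam r t e, 0 < r -> E t -> cond r t e ->
     exists i, forall l, 
     (\int[mu]_(p in Phi l) (lev f lam (sdist r t (e * cos p)))%:E <= hterm A om f b k u h i l (r, lam))%E) ->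
  weak_arc_bounded E cond u v.
Proof.
move=> mA mom om01 hM h0 hv hvu v1 C0 hC hA.
exists (2 * C); first exact: mulr_gt0.
move=> f mf f0.
pose H := hsum A om f b k u h.
have mH : measurable_fun setT H by exact: measurable_hsum.
have H0 z : (0 <= H z)%E by exact: hsum_ge0.
pose pos (x : R) : R := \1_[set x : R | (0 < x)%R] x.
have mpos : measurable_fun setT pos by apply: measurable_indic; exact: measurable_set_lt.
have pos0 x : 0 <= pos x by rewrite /pos indicE.
pose HP (z : R * R) : \bar R := (H z * (pos z.2)%:E)%E.
have mHP : measurable_fun setT HP.
  apply: emeasurable_funM => //; apply/measurable_EFinP.
  by apply: (measurableT_comp mpos); exact: measurable_snd.
have HP0 z : (0 <= HP z)%E by rewrite mule_ge0// lee_fin.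
pose G r := (\int[mu]_lam HP (r, lam))%E.
have GE r : (G r = \int[mu]_(lam in [set lam | (0 < lam)%R]) H (r, lam))%E.
  by rewrite integral_indicR.
have mG : measurable_fun setT G by exact: (@measurable_fun_fubini_tonelli_F _ _ _ _ _ mu HP).
exists G; split => //.
- by move=> r; apply: integral_ge0.
- move=> y A' mA' A'0 hy.
  pose ia (r : R) : R := r * \1_A' r.
  have ia0 r : 0 <= ia r.
    rewrite /ia indicE; case: (boolP (r \in A')) => [|_]; rewrite ?mulr0// mulr1 inE => /A'0.
    exact: ltW.
  have mia : measurable_fun setT ia by apply: measurable_funM => //; exact: measurable_indic.
  pose W (z : R * R) : \bar R := (HP z * (ia z.1)%:E)%E.
  have mW : measurable_fun setT W.
    apply: emeasurable_funM => //; apply/measurable_EFinP.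
    by apply: (measurableT_comp mia); exact: measurable_fst.
  have W0 z : (0 <= W z)%E by rewrite mule_ge0// lee_fin.
  have -> : (\int[mu]_(r in A') (G r * r%:E) = \int[mu]_r \int[mu]_lam W (r, lam))%E.
    rewrite integral_indicR; apply: eq_integral => r _.
    rewrite /W/= -muleA -EFinM -/(ia r) ge0_integralZr ?lee_fin//.
    by apply: (@measurableT_comp _ _ _ _ _ _ HP _ (pair r)) => //; exact: pair1_measurable.
  rewrite (@fubini_tonelli _ _ _ _ _ mu mu W)//=.
  have mar : measurable_fun setT (fun lam : R => area f lam `^ u)%E.
    by apply: (measurableT_comp (measurable_poweR u)); exact: measurable_area.
  have K0 : 0 <= 2 * C * expR ((1 - v) * y).
    by apply: mulr_ge0; [exact: ltW (mulr_gt0 _ _)|exact: expR_ge0].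
  have mP : measurable [set lam : R | (0 < lam)%R] by exact: measurable_set_lt.
  have mar' : measurable_fun [set lam : R | (0 < lam)%R] (fun lam : R => area f lam `^ u)%E.
    exact: measurable_funS mar.
  have ar0 lam : (0 <= area f lam `^ u)%E by exact: poweR_ge0.
  rewrite -ge0_integralZl ?lee_fin//.
  rewrite [leRHS]integral_indicR; apply: le_integral_ge0 => lam _; first exact: integral_ge0.
  have -> : (\int[mu]_r W (r, lam) = \int[mu]_(r in A') (H (r, lam) * r%:E) * (pos lam)%:E)%E.
    rewrite [in RHS]integral_indicR -ge0_integralZr ?lee_fin//; last 2 first.
    + apply: measurable_fun_indicM => //; apply: emeasurable_funM; last exact/measurable_EFinP.
      by apply: (@measurableT_comp _ _ _ _ _ _ H _ (pair^~ lam)) => //; exact: pair2_measurable.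
    + move=> r _; rewrite indicE; case: (boolP (r \in A')) => [|_]; last by rewrite mule0.
      by rewrite inE mule1 => /A'0 r0; rewrite mule_ge0// lee_fin ltW.
    apply: eq_integral => r _; rewrite /W /HP/= /ia EFinM -!muleA; congr (_ * _)%E.
    by rewrite muleC muleA.
  apply: lee_wpmul2r; first by rewrite lee_fin.
  exact: (integral_hsum_le mA mom om01 mf hM h0 hv hvu v1 C0 hC).
- move=> r t e r0 Et he; rewrite (arc_integral_layer _ _ _ mf f0) GE.
  apply: le_integral_ge0 => lam lam0; first by apply: integral_ge0 => p _; rewrite lee_fin lev_ge0.
  apply: (le_trans (arc_le_sum _ _ _ (measurable_lev lam mf) (lev_ge0 f lam))).
  have [i hi] := hA f mf lam r t e r0 Et he.
  apply: (@le_trans _ _ (\sum_(l <oo) hterm A om f b k u h i l (r, lam))%E).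
    by apply: lee_nneseries => [l _ _|l _]; [apply: integral_ge0 => p _; rewrite lee_fin lev_ge0|exact: hi].
  apply: (nneseries_ge_term i) => n.
  by apply: nneseries_ge0 => l _ _; exact: hterm_ge0.
Qed.

End WeakArc.

(** * The endpoint [Q2 (2 * gamma - 1)] in the two regimes *)

Section WeakInstances.
Context {R : realType}.
Local Notation mu := (@lebesgue_measure R).
Variables (E : set R) (beta gamma : R).
Hypotheses (E12 : E `<=` `[1, 2]%classic).

Lemma powR_lev (f : R -> R) lam s q : q != 0 -> lev f lam s `^ q = lev f lam s.
Proof. by move=> q0; rewrite levE; case: (_ < _); rewrite ?powR1 ?powR0. Qed.

Lemma lweight_gt0 (f : R -> R) s lam : 0 < s -> lweight f s lam = lev f lam s * s.
Proof.
move=> s0; rewrite /lweight indic_gt0 s0 mul1r levE indicE; congr ((nat_of_bool _)%:R * _).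
by apply/idP/idP; rewrite inE.
Qed.

Lemma lev_sum_ge0 (f : R -> R) s lam q : 0 <= s -> 0 <= lev f lam s `^ q * s.
Proof. by move=> s0; rewrite mulr_ge0 ?powR_ge0. Qed.

Lemma piece_le_hterm (A : nat -> nat -> set (R * R)) (om f : R -> R) (b k : nat -> nat -> R) (u h : R) i l z
    (P : \bar R) (X : R -> \bar R) :
  0 < u - h -> 0 < h -> u + h <= 1 ->
  (forall u', 0 < u' <= 1 -> (0 <= X u')%E /\ (X u' <= zeta A om f i l z)%E) ->
  (forall u', 0 < u' <= 1 -> (P <= (expR (b i l + u' * k i l))%:E * X u' `^ u')%E) ->
  (P <= hterm A om f b k u h i l z)%E.
Proof.
move=> uh h0 u1 hX hP.
have key u' : 0 < u' <= 1 -> (P <= (expR (b i l))%:E * ((expR (k i l))%:E * zeta A om f i l z) `^ u')%E.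
  move=> hu; have [X0 Xz] := hX u' hu; have /andP[u'0 u'1] := hu.
  apply: (le_trans (hP u' hu)).
  rewrite expRD EFinM -muleA; apply: lee_wpmul2l; first by rewrite lee_fin expR_ge0.
  have -> : expR (u' * k i l) = expR (k i l) `^ u' by rewrite expR_powR mulrC.
  rewrite -poweR_EFin -poweRM ?lee_fin ?expR_ge0//; apply: le_poweR.
  - exact: ltW.
  - by rewrite mule_ge0// lee_fin expR_ge0.
  - by apply: lee_wpmul2l => //; rewrite lee_fin expR_ge0.
have k1 : 0 < u - h <= 1 by apply/andP; split; lra.
have k2 : 0 < u + h <= 1 by apply/andP; split; lra.
have := key _ k1; have := key _ k2; rewrite /hterm.
by rewrite /mine; case: ifP.
Qed.

Lemma AP_mass (f : R -> R) m l r lam q : measurable_fun setT f -> Xm m r -> q != 0 ->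
  (0 <= ((1 + r)^-1)%:E * \int[mu]_(s in [set s | ZP E m l (r, s)]) (lev f lam s `^ q * s)%:E)%E /\
  (((1 + r)^-1)%:E * \int[mu]_(s in [set s | ZP E m l (r, s)]) (lev f lam s `^ q * s)%:E <=
   zeta (AP E) (@omP R) f m l (r, lam))%E.
Proof.
move=> mf Xr q0; have r0 := Xm_gt0 Xr.
have omE : omP r = (1 + r)^-1 by rewrite /omP gtr0_norm.
have Zp s : ZP E m l (r, s) -> 0 < s.
  by case=> /= h _; apply: lt_le_trans h; rewrite divr_gt0// addr_gt0.
have i0 : (0 <= \int[mu]_(s in [set s | ZP E m l (r, s)]) (lev f lam s `^ q * s)%:E)%E.
  by apply: integral_ge0 => s /Zp s0; rewrite lee_fin lev_sum_ge0// ltW.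
split; first by rewrite mule_ge0// lee_fin -omE omP_ge0.
have mZ : measurable [set s | ZP E m l (r, s)] by apply: measurable_section; exact: measurable_ZP.
rewrite -omE -ge0_integralZl//; last 3 first.
- apply: (@measurable_funS _ _ _ _ setT) => //; apply/measurable_EFinP; apply: measurable_funM => //.
  by apply: measurable_powR_fun; exact: measurable_lev.
- by move=> s /Zp s0; rewrite lee_fin lev_sum_ge0// ltW.
- by rewrite lee_fin omP_ge0.
rewrite integral_indicR; apply: le_integral_ge0 => s _.
  rewrite indicE; case: (boolP (s \in _)) => [|_]; last by rewrite mule0.
  by rewrite inE mule1 => /Zp s0; rewrite -EFinM lee_fin mulr_ge0 ?omP_ge0 ?lev_sum_ge0// ltW.
rewrite [X in (_ * X%:E <= _)%E]indicE; case: (boolP (s \in _)) => [|_]; last first.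
  by rewrite mule0 lee_fin; apply: zterm_ge0 => r'; rewrite omP_ge0 omP_le1.
rewrite inE/= mule1 => Zs; have s0 := Zp s Zs.
have ZA : AP E m l (r, s) by split.
by rewrite /zterm/= indicE (mem_set ZA) mulr1 lweight_gt0// powR_lev.
Qed.

Lemma AQ_mass (f : R -> R) j l r lam q : measurable_fun setT f -> 0 < r -> q != 0 ->
  (0 <= \int[mu]_(s in [set s | ZQ E j l (r, s)]) (lev f lam s `^ q * s)%:E)%E /\
  (\int[mu]_(s in [set s | ZQ E j l (r, s)]) (lev f lam s `^ q * s)%:E <=
   zeta (AQ E) (fun=> 1%R) f j l (r, lam))%E.
Proof.
move=> mf r0 q0.
have Zp s : ZQ E j l (r, s) -> 0 < s.
  by case=> _ /= h _ _; apply: lt_le_trans h; rewrite divr_gt0 ?expR_gt0.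
split; first by apply: integral_ge0 => s /Zp s0; rewrite lee_fin lev_sum_ge0// ltW.
rewrite integral_indicR; apply: le_integral_ge0 => s _.
  rewrite indicE; case: (boolP (s \in _)) => [|_]; last by rewrite mule0.
  by rewrite inE mule1 => /Zp s0; rewrite lee_fin lev_sum_ge0// ltW.
rewrite [X in (_ * X%:E <= _)%E]indicE; case: (boolP (s \in _)) => [|_]; last first.
  by rewrite mule0 lee_fin; apply: zterm_ge0 => r'; rewrite ler01 lexx.
rewrite inE/= mule1 => Zs; have s0 := Zp s Zs.
have ZA : AQ E j l (r, s) by split.
by rewrite /zterm/= indicE (mem_set ZA) !mul1r lweight_gt0// powR_lev.
Qed.

Lemma const_le_expR (K : R) : K <= expR K.
Proof. by apply: le_trans (expR_ge1Dx _); rewrite lerDr. Qed.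

(** The linear forms [m + 2 l] and [-2 m - 2 (1 - g) l] have determinant [2 (1 + g) > 0], so they
    control [m] and [l]; the centre is their common zero after the shifts [x] and [y']. *)
Lemma plane_decay (g x y' m l : R) : 0 <= g ->
  `|m - (- x - 2 * (- (2 * x + y') / (2 * (1 + g))))| + `|l - (- (2 * x + y') / (2 * (1 + g)))| <=
  4 * (`|m + 2 * l + x| + `|- 2 * m - 2 * (1 - g) * l + y'|).
Proof.
move=> g0; set p := m + 2 * l + x; set q := - 2 * m - 2 * (1 - g) * l + y'.
set l0 := - (2 * x + y') / (2 * (1 + g)).
have g1 : 0 < 2 * (1 + g) by lra.
have dl : l - l0 = (2 * p + q) / (2 * (1 + g)).
  by rewrite /l0 /p /q; field; rewrite gt_eqF//; lra.
have dm : m - (- x - 2 * l0) = p - 2 * (l - l0) by rewrite /p; ring.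
have hl : `|l - l0| <= `|p| + `|q|.
  rewrite dl normrM [`|_^-1|]gtr0_norm ?invr_gt0// ler_pdivrMr//.
  have h1 : `|2 * p + q| <= 2 * `|p| + `|q|.
    by apply: le_trans (ler_normD _ _) _; rewrite normrM ger0_norm.
  have h2 : 2 * `|p| + `|q| <= (`|p| + `|q|) * 2.
    by have := normr_ge0 q; lra.
  apply: (le_trans h1); apply: (le_trans h2); apply: ler_wpM2l; [exact: addr_ge0|lra].
have hm : `|m - (- x - 2 * l0)| <= `|p| + 2 * `|l - l0|.
  by rewrite dm; apply: le_trans (ler_normB _ _) _; rewrite normrM [`|2|]ger0_norm.
have := normr_ge0 p; have := normr_ge0 q; move: `|p| `|q| `|l - l0| (`|m - (- x - 2 * l0)|) hl hm.
by clear; move=> a b c d; lra.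
Qed.

(** With the Assouad count and these exponents, [b + u k + v mm] is constant in [(m, l)]: the
    identity [u (1 + gamma) = 1] removes [l], and [v = u / 2] removes [m]. Convergence comes from
    [plane_decay] alone. *)
Lemma weak_P : 1 / 2 <= gamma -> gamma <= 1 -> assouad_bound E gamma ->
  weak_arc_bounded E condP (1 + gamma)^-1 ((1 + gamma)^-1 / 2).
Proof.
move=> g2 g1 aE; have g0 : 0 <= gamma by lra.
set u := (1 + gamma)^-1.
have [C C0 hC] := count_P_gamma E12 g0 g1 aE.
have C1 : 0 < C + 1 by lra.
pose c0 := ln (C + 1); have c0E : expR c0 = C + 1 by rewrite lnK// posrE.
have uE : u * (1 + gamma) = 1 by rewrite mulVf// gt_eqF//; lra.
have u1 : 1 / 2 <= u <= 2 / 3.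
  by apply/andP; split; clear - uE g1 g2; nra.
have /andP[ul ur] := u1.
have h0 : 0 < 1 / 16 :> R by lra.
have h64 : 0 < 1 / 64 :> R by lra.
have [C' C'0 hC'] := exp_series2 h64.
(* The constant is made opaque and absorbed into the exponent through [K <= expR K]. *)
have [K K0 KE] : exists2 K : R, 0 <= K & K = 8192 by exists 8192; [exact: ler0n|reflexivity].
have D0 : 0 < expR (K + u / 2 * c0) * C' + 1.
  by apply: ltr_wpDl => //; rewrite mulr_ge0 ?expR_ge0.
apply: (@weak_arc_of_pieces R E condP (AP E) (@omP R) (fun _ l => K - l%:R) (@scaleP R)
  (fun m l => c0 + (gamma * (2 * l%:R) - scaleP m l) - m%:R) u (u / 2) (1 / 16) (expR (K + u / 2 * c0) * C' + 1)) => //.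
- by move=> *; exact: measurable_AP.
- exact: measurable_omP.
- by move=> r; rewrite omP_ge0 omP_le1.
- move=> m l s s0; rewrite expRD expRD c0E.
  apply: (@integral_AP_le R E ((C + 1) * expR (gamma * (2 * l%:R) - scaleP m l))).
    by rewrite mulr_ge0 ?expR_ge0// ltW.
  apply: (le_trans (hC m l s)); rewrite lee_fin; apply: ler_wpM2r; [exact: expR_ge0|by rewrite lerDl].
- by lra.
- by lra.
- by lra.
- move=> x y.
  pose y' := c0 - y; pose l0 := - (2 * x + y') / (2 * (1 + gamma)).
  apply: (@le_trans _ _ (expR (K + u / 2 * c0) * C')%:E); last by rewrite lee_fin lerDl.
  apply: (hC' (- x - 2 * l0) l0) => [|m l|m l]; [exact: expR_ge0|exact: expR_ge0|].
  rewrite -!expRD ler_expR.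
  have e0 : K - l%:R + u * scaleP m l + u / 2 * (c0 + (gamma * (2 * l%:R) - scaleP m l) - m%:R) = K + u / 2 * c0.
    rewrite [LHS](_ : _ = K + u / 2 * c0 + l%:R * (u * (1 + gamma) - 1)).
      by rewrite uE subrr mulr0 addr0.
    by rewrite /scaleP; field.
  have q0 : c0 + (gamma * (2 * l%:R) - scaleP m l) - m%:R - y = - 2 * m%:R - 2 * (1 - gamma) * l%:R + y'.
    by rewrite /y' /scaleP; ring.
  have := plane_decay x y' m%:R l%:R g0; rewrite -/l0 e0 q0 /scaleP.
  move: `|_| `|_| `|_| `|_| => a1 a2 a3 a4; move: (K + _) => z.
  by clear; lra.
move=> f mf lam r t e r0 Et he; have [m Xr] := Xm_exists r0; exists m => l.
pose X u' := (((1 + r)^-1)%:E * \int[mu]_(s in [set s | ZP E m l (r, s)]) (lev f lam s `^ u'^-1 * s)%:E)%E.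
apply: (@piece_le_hterm _ _ _ _ _ _ _ _ _ _ _ X) => //; [lra|lra| |].
  move=> u' /andP[u'0 _]; apply: AP_mass => //; by rewrite invr_eq0 gt_eqF.
move=> u' u'01.
apply: (le_trans (piece_P (measurable_lev lam mf) (lev_ge0 f lam) l u'01 Xr (E_ge1 E12 Et) (E_le2 E12 Et) Et he)).
rewrite -KE -/(X u'); apply: lee_wpmul2r; first exact: poweR_ge0.
rewrite lee_fin (_ : K - l%:R + u' * scaleP m l = K + (u' * scaleP m l - l%:R)); last by ring.
by rewrite expRD; apply: ler_wpM2r; [exact: expR_ge0|exact: const_le_expR].
Qed.

Lemma weak_Q : 0 <= beta -> beta < 1 -> beta + 1 <= 2 * gamma -> gamma <= 1 -> minkowski_bound E beta ->
  weak_arc_bounded E condQ' (1 + gamma)^-1 ((1 + gamma)^-1 / 2).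
Proof.
move=> b0 b1 bg g1 hE.
set u := (1 + gamma)^-1; pose v := u / 2.
have [C C0 hC] := count_Q b0 b1 hE.
have C1 : 0 < 3 * (C + 1) by lra.
pose c0 := ln (3 * (C + 1)); have c0E : expR c0 = 3 * (C + 1) by rewrite lnK// posrE.
have uE : u * (1 + gamma) = 1 by rewrite mulVf// gt_eqF//; lra.
have u1 : 1 / 2 <= u <= 2 / 3.
  by apply/andP; split; clear - uE g1 bg b0; nra.
have /andP[ul ur] := u1.
have v0 : 0 < v by rewrite /v; lra.
(* With [u = 1 / (1 + gamma)] and [v = u / 2] this is [beta + 1 <= 2 * gamma], so the near-diagonal
   pieces behave as in the strong case. *)
have hc : 2 * u - 1 <= (1 - beta) * v.
  by rewrite /v; clear - uE bg ul; nra.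
have h0 : 0 < 1 / 16 :> R by lra.
pose e1 := (1 - beta) * v; have e10 : 0 < e1 by rewrite mulr_gt0// subr_gt0.
have [eta eta0 [he1 he2]] := min_pos e10 h0.
have eta2 : 0 < eta / 2 by lra.
have [C' C'0 hC'] := exp_series2 eta2.
have [K K0 KE] : exists2 K : R, 0 <= K & K = 1280 by exists 1280; [exact: ler0n|reflexivity].
have D0 : 0 < expR (K + v * c0) * C' + 1.
  by apply: ltr_wpDl => //; rewrite mulr_ge0 ?expR_ge0.
pose ex (j l : nat) : R := if (j <= l)%N then 2 * l%:R - j%:R else j%:R.
apply: (@weak_arc_of_pieces R E condQ' (AQ E) (fun=> 1) (fun _ l => K - l%:R) (fun _ l => 2 * l%:R)
  (fun j l => c0 + - (1 - beta) * ex j l) u v (1 / 16) (expR (K + v * c0) * C' + 1)) => //.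
- by move=> *; exact: measurable_AQ.
- by move=> r; rewrite ler01 lexx.
- move=> j l s s0; rewrite expRD c0E -mulrA; apply: integral_AQ_le.
  apply: (le_trans (hC j l s)); rewrite lee_fin; apply: ler_wpM2r; [exact: expR_ge0|by rewrite lerDl].
- by rewrite /v; lra.
- by rewrite /v; lra.
- by rewrite /v; lra.
- move=> x y.
  apply: (@le_trans _ _ (expR (K + v * c0) * C')%:E); last by rewrite lee_fin lerDl.
  apply: (hC' (- x / 2) (- x / 2)) => [|j l|j l]; [exact: expR_ge0|exact: expR_ge0|].
  rewrite -!expRD ler_expR.
  have hq := Q_exponent b1 j l v0 hc.
  have {}hq : - l%:R + u * (2 * l%:R) - v * ((1 - beta) * ex j l) <= - (e1 * `|l%:R - j%:R|).
    move: hq; rewrite -(ler_pM2l v0) -/(ex j l).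
    rewrite (_ : v * - _ = - (e1 * `|l%:R - j%:R|) + e1 / 2 * `|l%:R - j%:R|); last by rewrite /e1; field.
    rewrite (_ : v * (_ + _) = - l%:R + u * (2 * l%:R) - v * ((1 - beta) * ex j l) + e1 / 2 * `|l%:R - j%:R|); last first.
      by rewrite /e1; field; rewrite gt_eqF.
    by rewrite lerD2r.
  have n1 : `|l%:R - - x / 2| = `|2 * l%:R + x| / 2.
    rewrite (_ : l%:R - - x / 2 = (2 * l%:R + x) / 2); last by field.
    by rewrite normrM [`|2^-1|]ger0_norm.
  have n2 : `|j%:R - - x / 2| <= `|l%:R - j%:R| + `|2 * l%:R + x| / 2.
    rewrite -n1 [`|l%:R - j%:R|]distrC; apply: le_trans (ler_normD _ _).
    by rewrite addrA subrK.
  have n3 : 0 <= `|c0 + - (1 - beta) * ex j l - y| by [].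
  have m1 : eta * `|l%:R - j%:R| <= e1 * `|l%:R - j%:R| by apply: ler_wpM2r.
  have m2 : eta * `|2 * l%:R + x| <= 1 / 16 * `|2 * l%:R + x| by apply: ler_wpM2r.
  have m3 : eta / 2 * `|j%:R - - x / 2| <= eta / 2 * (`|l%:R - j%:R| + `|2 * l%:R + x| / 2).
    by apply: ler_wpM2l => //; exact: ltW.
  have m4 : 0 <= eta * `|l%:R - j%:R| by rewrite mulr_ge0// ltW.
  have m5 : 0 <= eta * `|2 * l%:R + x| by rewrite mulr_ge0// ltW.
  rewrite n1; move: n3 hq m1 m2 m3 m4 m5; clear.
  move: (ex j l) `|l%:R - j%:R| `|2 * l%:R + x| `|j%:R - - x / 2| `|c0 + _ - y| => z1 z2 z3 z4 z5.
  by lra.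
move=> f mf lam r t e r0 Et [e1' rt r4].
have d0 : 0 < `|r - t| by rewrite normr_gt0 subr_eq0.
have d1 : `|r - t| <= 1 by apply: (le_trans (ltW r4)); lra.
have [j [h1 h2]] := dyadic_scale d0 d1; exists j => l.
rewrite mul1r in h1; rewrite mul1r in h2.
pose X u' := (\int[mu]_(s in [set s | ZQ E j l (r, s)]) (lev f lam s `^ u'^-1 * s)%:E)%E.
apply: (@piece_le_hterm _ _ _ _ _ _ _ _ _ _ _ X) => //; [lra|lra| |].
  move=> u' /andP[u'0 _]; apply: AQ_mass => //; by rewrite invr_eq0 gt_eqF.
move=> u' u'01; rewrite e1'.
apply: (le_trans (piece_Q (measurable_lev lam mf) (lev_ge0 f lam) l u'01 r0 (E_ge1 E12 Et) (E_le2 E12 Et) Et r4 h1 h2)).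
rewrite -KE -/(X u'); apply: lee_wpmul2r; first exact: poweR_ge0.
rewrite lee_fin (_ : K - l%:R + u' * (2 * l%:R) = K + - (1 - 2 * u') * l%:R); last by ring.
by rewrite expRD; apply: ler_wpM2r; [exact: expR_ge0|exact: const_le_expR].
Qed.

End WeakInstances.

(** * Restricted weak type from the dual form *)

Section RestrictedWeak.
Context {R : realType}.
Local Notation mu := (@lebesgue_measure R).
Local Notation leb2 := (@leb2 R).

Lemma weak_arc_bounded_or (E : set R) (c1 c2 : R -> R -> R -> Prop) (u v : R) :
  weak_arc_bounded E c1 u v -> weak_arc_bounded E c2 u v ->
  weak_arc_bounded E (fun r t e => c1 r t e \/ c2 r t e) u v.
Proof.
move=> [C1 C10 h1] [C2 C20 h2]; exists (C1 + C2); first exact: addr_gt0.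
move=> f mf f0; have [G1 [mG1 G10 i1 b1]] := h1 f mf f0; have [G2 [mG2 G20 i2 b2]] := h2 f mf f0.
exists (fun r => G1 r + G2 r)%E; split.
- exact: emeasurable_funD.
- by move=> r; exact: adde_ge0.
- move=> y A mA A0 hy.
  have mr : measurable_fun A (fun r : R => r%:E) by exact/measurable_EFinP.
  have r0 r : A r -> (0 <= r%:E)%E by move=> /A0 h; rewrite lee_fin ltW.
  have mG1r : measurable_fun A (fun r : R => G1 r * r%:E)%E.
    by apply: emeasurable_funM => //; exact: measurable_funS mG1.
  have mG2r : measurable_fun A (fun r : R => G2 r * r%:E)%E.
    by apply: emeasurable_funM => //; exact: measurable_funS mG2.
  under eq_integral => r _ do rewrite ge0_muleDl//.
  rewrite ge0_integralD//; last 2 first.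
  + by move=> r /r0 h; rewrite mule_ge0.
  + by move=> r /r0 h; rewrite mule_ge0.
  rewrite mulrDl EFinD ge0_muleDl ?lee_fin ?mulr_ge0 ?expR_ge0 ?(ltW C10) ?(ltW C20)//.
  by apply: leeD; [exact: i1|exact: i2].
- move=> r t e r0 Et [h|h]; first by apply: (le_trans (b1 r t e r0 Et h)); rewrite leeDl.
  by apply: (le_trans (b2 r t e r0 Et h)); rewrite leeDr.
Qed.

Lemma level_mass_le (G : R -> \bar R) (C J l v : R) : measurable_fun setT G -> (forall r, 0 <= G r)%E ->
  0 < v -> 0 < C -> 0 <= J -> 0 < l ->
  (forall y (A : set R), measurable A -> A `<=` [set r | 0 < r] ->
     (\int[mu]_(r in A) r%:E = (expR y)%:E)%E ->
     (\int[mu]_(r in A) (G r * r%:E) <= (C * expR ((1 - v) * y))%:E * J%:E)%E) ->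
  (\int[mu]_(r in [set r : R | (0 < r)%R /\ (l%:E < G r)%E]) r%:E <= ((C * J / l) `^ v^-1)%R%:E)%E.
Proof.
move=> mG G0 v0 C0 J0 l0 hG.
set B := (C * J / l) `^ v^-1.
have mA : measurable [set r : R | (0 < r)%R /\ (l%:E < G r)%E].
  apply: measurableI; first exact: measurable_set_lt.
  by rewrite -[X in measurable X]setTI; exact: emeasurable_fun_o_infty.
(* Truncation makes the mass finite, as the division requires; monotone convergence removes it. *)
pose F n : set R := [set r : R | (0 < r)%R /\ (l%:E < G r)%E] `&` [set r | r <= n%:R].
have mF n : measurable (F n) by apply: measurableI => //; exact: measurable_set_le.
have F0 n r : F n r -> 0 < r by case=> -[].
have hF n : (\int[mu]_(r in F n) r%:E <= B%:E)%E.
  have B0 : 0 <= B by exact: powR_ge0.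
  set al := (\int[mu]_(r in F n) r%:E)%E.
  have al0 : (0 <= al)%E by apply: integral_ge0 => r /F0 h; rewrite lee_fin ltW.
  have alfin : (al < +oo)%E.
    have hY : (al <= \int[mu]_(r in `[0%R, (0 + n%:R)%R]%classic) (n%:R%R : R)%:E)%E.
      rewrite /al integral_indicR [leRHS]integral_indicR; apply: le_integral_ge0 => r _.
        rewrite indicE; case: (boolP (r \in _)) => [|_]; last by rewrite mule0.
        by rewrite inE mule1 => /F0 h; rewrite lee_fin ltW.
      rewrite -!EFinM lee_fin [X in _ * X <= _]indicE; case: (boolP (r \in F n)) => [|_]; last first.
        by rewrite mulr0 mulr_ge0// indicE.
      rewrite inE => Fr; have r0 := F0 _ _ Fr; case: Fr => _ /= rn.
      by rewrite indicE mem_set ?mulr1//= in_itv/= add0r rn ltW.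
    apply: (le_lt_trans hY); rewrite integral_cst//=.
    have -> : mu `[0%R, (0 + n%:R)%R]%classic = (n%:R%R : R)%:E by exact: measure_itvcc.
    by rewrite -EFinM ltry.
  have [a aE] : exists a : R, al = a%:E by exists (fine al); rewrite fineK// ge0_fin_numE.
  rewrite aE lee_fin; have a0 : 0 <= a by rewrite -lee_fin -aE.
  have [->|an0] := eqVneq a 0; first by [].
  have ap : 0 < a by rewrite lt_neqAle eq_sym an0.
  have lnE : expR (ln a) = a by rewrite lnK.
  have := hG (ln a) (F n) (mF n) (F0 n); rewrite lnE -/al aE => /(_ erefl) h.
  have h1 : l * a <= C * expR ((1 - v) * ln a) * J.
    rewrite -lee_fin EFinM -aE; apply: le_trans h.
    have mid : measurable_fun (F n) (fun r : R => r%:E) by exact/measurable_EFinP.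
    have idp r : F n r -> (0 <= r%:E)%E by move=> /F0 h; rewrite lee_fin ltW.
    rewrite /al -ge0_integralZl ?lee_fin ?(ltW l0)//; last exact: mF.
    apply: le_integral_ge0 => r Fr; have r0 := F0 _ _ Fr.
      by rewrite mule_ge0 ?lee_fin ?(ltW l0) ?(ltW r0).
    by apply: lee_wpmul2r; [rewrite lee_fin ltW|case: Fr => -[_ /ltW]].
  have h2 : expR (v * ln a) <= C * J / l.
    rewrite ler_pdivlMr// -(ler_pM2r (expR_gt0 ((1 - v) * ln a))).
    rewrite mulrAC -expRD (_ : v * ln a + (1 - v) * ln a = ln a); last by ring.
    by rewrite lnE [leLHS]mulrC; apply: (le_trans h1); rewrite mulrAC.
  rewrite -lnE (_ : ln a = v * ln a * v^-1); last by field; rewrite gt_eqF.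
  rewrite -expR_powR /B; apply: ge0_ler_powR; rewrite ?nnegrE ?expR_ge0 ?invr_ge0 ?(ltW v0)//.
  by apply: le_trans h2; exact: expR_ge0.
have bE : [set r : R | (0 < r)%R /\ (l%:E < G r)%E] = \bigcup_n F n.
  apply/seteqP; split => [r [r0 h]|r [n _ []]//].
  by exists (Num.bound r) => //; split => //=; apply: ltW; apply: archi_boundP; exact: ltW.
rewrite bE.
have c1 : (\int[mu]_(r in F n) r%:E @[n --> \oo] --> \int[mu]_(r in \bigcup_n F n) r%:E)%E.
  apply: ge0_nondecreasing_set_cvg_integral => //.
  - apply/nondecreasing_seqP => n; apply/subsetPset => r [h1 /= h2]; split => //=.
    by apply: le_trans h2 _; rewrite ler_nat.
  - by move=> n r /F0 h; rewrite lee_fin ltW.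
rewrite -(cvg_lim _ c1)//; apply: lime_le; first by apply/cvg_ex; eexists; exact: c1.
by apply: nearW.
Qed.

Lemma area_le_distrib (f : R * R -> R) (lam : R) : measurable_fun [set: R * R] f -> radial f ->
  (area (fun s => `|f (s, 0%R)|%R) lam <= 2%:E * distrib (EFin \o f) lam)%E.
Proof.
move=> mf rf; pose g (s : R) := `|f (s, 0)|.
have mg : measurable_fun setT g := measurable_radial_profile mf.
have -> : distrib (EFin \o f) lam = (\int[leb2]_x (lev g lam (enorm x))%:E)%E.
  have mS : measurable [set x : R * R | (lam%:E < `|(EFin \o f) x|)%E].
    by apply: measurable_set_lt => //; exact: measurableT_comp.
  rewrite /distrib -[X in _ X = _](setIT _) /Defs.leb2 -integral_indic//; apply: eq_integral => x _.
  rewrite levE indicE; congr ((nat_of_bool _)%:R%:E).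
  have -> : g (enorm x) = `|f x|.
    rewrite /g; congr `|_|; apply: rf => /=.
    by rewrite expr0n/= addr0 sqr_sqrtr// addr_ge0// sqr_ge0.
  by apply/idP/idP; rewrite inE.
apply: le_trans (@polar_lower R (fun s => (lev g lam s)%:E) _ _); last 2 first.
- by apply/measurable_EFinP; exact: measurable_lev.
- by move=> s; rewrite lee_fin lev_ge0.
rewrite [leRHS]integral_indicR; apply: le_integral_ge0 => s _; first by rewrite lee_fin lweight_ge0.
rewrite indic_gt0 -!EFinM lee_fin; have [s0|s0] := ltP 0 s; last by rewrite lweight_le0// mulr0.
rewrite mulr1 /lweight indic_gt0 s0 mul1r levE indicE le_eqVlt; apply/orP; left; apply/eqP.
by congr ((nat_of_bool _)%:R * _); apply/idP/idP; rewrite inE.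
Qed.

Lemma restricted_weak_of_arcs (E : set R) (beta u v : R) : E `<=` `[1, 2]%classic ->
  0 <= beta -> beta < 1 -> minkowski_bound E beta -> 0 < u -> 0 < v ->
  weak_arc_bounded E condP u v -> weak_arc_bounded E condQ' u v ->
  restricted_weak_rad E u^-1 v^-1.
Proof.
move=> E12 b0 b1 hE u0 v0 hP hQ.
have [C C0 hC] := weak_arc_bounded_or hP hQ.
exists (32 `^ v * 16 * C * 2 `^ u * u) => f mf rf.
rewrite /lorentz_p1 invrK => fin.
pose g (s : R) := `|f (s, 0)|.
have mg : measurable_fun setT g := measurable_radial_profile mf.
have g0 s : 0 <= g s by rewrite /g.
pose D := (\int[mu]_(l in [set l : R | (0 < l)%R]) (distrib (EFin \o f) l `^ u))%E.
pose J := (\int[mu]_(l in [set l : R | (0 < l)%R]) (area g l `^ u))%E.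
have D0 : (0 <= D)%E by apply: integral_ge0 => l _; exact: poweR_ge0.
have J0 : (0 <= J)%E by apply: integral_ge0 => l _; exact: poweR_ge0.
have mar : measurable_fun [set l : R | (0 < l)%R] (fun l : R => area g l `^ u)%E.
  apply: (@measurable_funS _ _ _ _ setT) => //.
  by apply: (measurableT_comp (measurable_poweR u)); exact: measurable_area.
have mP : measurable [set l : R | (0 < l)%R] by exact: measurable_set_lt.
have t0 : 0 < 2 `^ u by exact: powR_gt0.
have JD : (J <= (2 `^ u)%:E * D)%E.
  have JE : (((2 `^ u)^-1)%:E * J <= D)%E.
    have ar0 l : [set l : R | (0 < l)%R] l -> (0 <= area g l `^ u)%E by move=> _; exact: poweR_ge0.
    rewrite /J -ge0_integralZl ?lee_fin ?invr_ge0 ?(ltW t0)//.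
    apply: le_integral_ge0 => l _; first by rewrite mule_ge0 ?poweR_ge0// lee_fin invr_ge0 ltW.
    have a0 : (0 <= area g l)%E by exact: area_ge0.
    have d0 : (0 <= distrib (EFin \o f) l)%E by exact: measure_ge0.
    apply: (@le_trans _ _ (((2 `^ u)^-1)%:E * (2%:E * distrib (EFin \o f) l) `^ u)%E).
      apply: lee_wpmul2l; first by rewrite lee_fin invr_ge0 ltW.
      by apply: le_poweR => //; [exact: ltW|exact: area_le_distrib].
    by rewrite poweRM// poweR_EFin muleA -EFinM mulVf ?mul1e// gt_eqF.
  by rewrite -lee_pdivrMl// ?invrK.
have Dfin : (D < +oo)%E.
  have [Dy|Dn] := eqVneq D +oo%E; last by rewrite ltey.
  by move: fin; rewrite -/D Dy gt0_muley ?ltxx// lte_fin invr_gt0.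
have Jfin : (J < +oo)%E.
  by apply: (le_lt_trans JD); rewrite lte_mul_pinfty// lee_fin ltW.
have [j jE] : exists j : R, J = j%:E by exists (fine J); rewrite fineK// ge0_fin_numE.
have j0 : 0 <= j by rewrite -lee_fin -jE.
have [G [mG G0 iG bG]] := hC g mg g0.
exists (fun x => 16%:E * G (enorm x))%E; split.
  by apply: emeasurable_funM => //; exact: measurable_enorm_comp.
split; first exact: (@MaxE_ae R E beta).
apply: ge_ereal_sup => _ [l /= l0 <-]; rewrite invrK.
have l16 : 0 < l / 16 by rewrite divr_gt0.
have lev16 x : (l%:E < `|16%:E * G x|)%E = ((l / 16)%R%:E < G x)%E.
  by rewrite gee0_abs ?mule_ge0 ?lee_fin// -lte_pdivrMl// -EFinM mulrC.
have hl := level_mass_le mG G0 v0 C0 j0 l16.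
have {hl} : (\int[mu]_(r in [set r : R | (0 < r)%R /\ ((l / 16)%R%:E < G r)%E]) r%:E <= ((C * j / (l / 16)) `^ v^-1)%R%:E)%E.
  by apply: hl => y A mA A0 hy; rewrite -jE; exact: iG.
set m := (\int[mu]_(r in _) r%:E)%E => hm.
pose S : set R := [set r | ((l / 16)%R%:E < G r)%E].
have mS : measurable S by rewrite -[S]setTI; exact: emeasurable_fun_o_infty.
have dle : (distrib (fun x : R * R => 16%:E * G (enorm x)) l <= 32%:E * m)%E.
  rewrite (_ : distrib _ _ = \int[leb2]_x (\1_S (enorm x))%:E)%E; last first.
    have mS2 : measurable [set x : R * R | (l%:E < `|16%:E * G (enorm x)|)%E].
      rewrite (_ : [set x | _] = [set x | S (enorm x)]).
        by rewrite -[X in measurable X]setTI; apply: measurable_enorm.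
      by apply/seteqP; split => x /=; rewrite lev16.
    rewrite /distrib -[X in _ X = _](setIT _) /Defs.leb2 -integral_indic//; apply: eq_integral => x _.
    rewrite !indicE; congr ((nat_of_bool _)%:R%:E); apply/idP/idP; rewrite !inE/= lev16//.
  apply: (le_trans (@polar_upper R (fun s => (\1_S s)%:E) _ _)).
  - by apply/measurable_EFinP; exact: measurable_indic.
  - by move=> s; rewrite lee_fin indicE.
  apply: lee_wpmul2l; first by rewrite lee_fin.
  rewrite /m integral_indicR [leRHS]integral_indicR; apply: le_integral_ge0 => s _.
    rewrite indic_gt0 -!EFinM lee_fin; have [s0|s0] := ltP 0 s; last by rewrite mulr0.
    by rewrite mulr1 mulr_ge0 ?(ltW s0)// indicE.
  rewrite indic_gt0 -!EFinM lee_fin !indicE; have [s0|s0] := ltP 0 s; last first.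
    by rewrite mulr0 memNset ?mulr0//= => -[]; rewrite ltNge s0.
  rewrite mulr1 mulrC; case: (boolP (s \in S)) => [|_]; last by rewrite mulr0 mulr_ge0 ?(ltW s0).
  by rewrite inE => hs; rewrite mem_set.
have m0 : (0 <= m)%E by apply: integral_ge0 => r -[r0 _]; rewrite lee_fin ltW.
apply: (@le_trans _ _ (l%:E * (32%:E * ((C * j / (l / 16)) `^ v^-1)%R%:E) `^ v)%E).
  apply: lee_wpmul2l; first by rewrite lee_fin ltW.
  apply: le_poweR; [exact: ltW|exact: measure_ge0|apply: (le_trans dle)].
  by apply: lee_wpmul2l; rewrite ?lee_fin.
have cj : 0 <= C * j / (l / 16) by rewrite divr_ge0 ?mulr_ge0// ltW.
rewrite poweRM ?lee_fin ?powR_ge0// !poweR_EFin -powRrM mulVf ?gt_eqF// powRr1// -!EFinM.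
have e1 (W : R) : l * (W * (C * j / (l / 16))) = W * 16 * C * j by field; rewrite gt_eqF.
have e2 (W : R) : W * u * u^-1 = W by rewrite mulfK// gt_eqF.
rewrite e1.
rewrite EFinM -jE; apply: (@le_trans _ _ ((32 `^ v * 16 * C)%:E * ((2 `^ u)%:E * D))%E).
  by apply: lee_wpmul2l => //; rewrite lee_fin !mulr_ge0 ?powR_ge0// ltW.
by rewrite -/D !muleA -!EFinM e2.
Qed.

End RestrictedWeak.

(** * The vertex [O]: boundedness on [L^infinity] *)

Section PointO.
Context {R : realType}.
Local Notation mu := (@lebesgue_measure R).
Local Notation leb2 := (@leb2 R).
Variables (E : set R) (beta : R).
Hypotheses (E12 : E `<=` `[1, 2]%classic).

(** The piece bounds at [u = v = 1] are multiples of the mass of [f], so an almost everywhere zero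
    profile has zero arc integrals for all the [t] at once. *)
Lemma arc_integral_null (f : R -> R) (r t e : R) : measurable_fun setT f -> (forall x, 0 <= f x) ->
  (\int[mu]_s (prof f 1 s)%:E = 0)%E -> 0 < r -> E t -> condP r t e \/ condQ' r t e ->
  (arc_integral f e r t <= 0)%E.
Proof.
move=> mf f0 n0 r0 Et he.
have n1 : (\int[mu]_s (prof f 1 s)%:E <= 1)%E by rewrite n0 lee_fin.
have X0 (A : set (R * R)) (a : R) : 0 <= a <= 1 ->
    (\int[mu]_s (1 * (a * \1_A (r, s)) * prof f 1 s)%:E = 0)%E.
  move=> /andP[a0 a1]; apply/eqP; rewrite eq_le; apply/andP; split.
    rewrite -[leRHS]n0; apply: le_integral_ge0 => s _; first by rewrite lee_fin wprof_ge0.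
    rewrite lee_fin mul1r; apply: ler_piMl; first exact: prof_ge0.
    by apply: mulr_ile1 => //; rewrite indicE; case: (_ \in _).
  by apply: integral_ge0 => s _; rewrite lee_fin wprof_ge0.
apply: (le_trans (arc_le_sum _ _ _ mf f0)).
rewrite eseries0// => l _ _; apply/eqP; rewrite eq_le; apply/andP; split; last first.
  by apply: integral_ge0 => p _; rewrite lee_fin.
case: he => [he|[-> rt r4]].
  have [m Xr] := Xm_exists r0.
  have mc : measurable_fun setT (fun _ : R => 1 : R) by exact: measurable_cst.
  have c01 (s : R) : 0 <= (fun _ : R => 1 : R) s <= 1 by rewrite ler01 lexx.
  have := P_core mf ltr01 n1 mf f0 mc c01 (u' := 1) _ (lexx 1) _ Xr (E_ge1 E12 Et) (E_le2 E12 Et) Et he.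
  move=> /(_ l); rewrite X0 ?omP_ge0 ?omP_le1//.
  rewrite poweR0r ?oner_eq0// mule0; apply; first by rewrite ltr01 lexx.
  by move=> s s0; rewrite divff ?oner_eq0// subrr mulr0 oppr0 expR0 mul1r mulr1.
have d0 : 0 < `|r - t| by rewrite normr_gt0 subr_eq0.
have d1 : `|r - t| <= 1 by apply: (le_trans (ltW r4)); lra.
have [j [h1 h2]] := dyadic_scale d0 d1.
rewrite mul1r in h1; rewrite mul1r in h2.
have := Q_core mf f0 ltr01 n1 l _ (lexx 1) r0 (E_ge1 E12 Et) (E_le2 E12 Et) Et r4 h1 h2.
rewrite X0 ?ler01 ?lexx// poweR0r ?oner_eq0// mule0; apply.
by rewrite ltr01.
Qed.

(** A mean of [f] is trivially at most its supremum, but only an essential supremum is given; the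
    excess over it is a null profile, which [arc_integral_null] makes harmless. *)
Lemma bounded_rad_O : 0 <= beta -> beta < 1 -> minkowski_bound E beta -> bounded_rad E 0 0.
Proof.
move=> b0 b1 hE; exists 32 => f mf rf.
(* [Lnorm] at infinity is 0 by convention when the whole space has measure zero. In that branch the
   whole plane serves as exceptional set. *)
rewrite /expo eqxx unlock /Lnorm; case: ifPn => [T0|T0] fin; last first.
  exists (cst +oo%E); split; first exact: measurable_cst.
  split; last by rewrite mule0.
  exists setT; split => //; apply/eqP; rewrite eq_le measure_ge0 andbT leNgt; exact: T0.
have := ess_sup_ge leb2 (abse \o (EFin \o f)).
set M0 := ess_sup _ _ in fin * => hM0.
have M00 : (0 <= M0)%E.
  have := @Lnorm_ge0 _ _ _ leb2 +oo%E (EFin \o f).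
  by rewrite unlock /Lnorm T0.
have [M ME] : exists M : R, M0 = M%:E by exists (fine M0); rewrite fineK// ge0_fin_numE.
have M_ge0 : 0 <= M by rewrite -lee_fin -ME.
pose g (s : R) := `|f (s, 0)|.
have mg : measurable_fun setT g := measurable_radial_profile mf.
have g0 s : 0 <= g s by rewrite /g.
have gE x : g (enorm x) = `|f x|.
  rewrite /g; congr `|_|; apply: rf => /=.
  by rewrite expr0n/= addr0 sqr_sqrtr// addr_ge0// sqr_ge0.
pose hi (s : R) := g s * \1_[set x : R | (M < x)%R] (g s).
have mhi : measurable_fun setT hi.
  by apply: measurable_mul_indic_set => //; exact: measurable_set_lt.
have hi0 s : 0 <= hi s by rewrite mulr_ge0// indicE.
have ghi s : g s <= M + hi s.
  rewrite /hi indicE; have [h|h] := leP (g s) M; first by apply: ler_wpDr => //; rewrite mulr_ge0.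
  by rewrite mem_set//= mulr1 lerDr.
have hi_null : (\int[mu]_s (prof hi 1 s)%:E = 0)%E.
  apply/eqP; rewrite eq_le; apply/andP; split; last by apply: integral_ge0 => s _; rewrite lee_fin prof_ge0.
  apply: (@le_trans _ _ (2%:E * \int[leb2]_x (hi (enorm x))%:E)%E).
    apply: le_trans (@polar_lower R (fun s => (hi s)%:E) _ _); last 2 first.
    - exact/measurable_EFinP.
    - by move=> s; rewrite lee_fin.
    rewrite [leRHS]integral_indicR; apply: le_integral_ge0 => s _; first by rewrite lee_fin prof_ge0.
    by rewrite /prof -!EFinM lee_fin invr1 powRr1// mulrC.
  have [N [mN N0 hN]] := hM0.
  have mhn : measurable_fun setT (fun x => (hi (enorm x))%:E).
    by apply: (@measurable_enorm_comp R (fun s => (hi s)%:E)); exact/measurable_EFinP.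
  apply: (@le_trans _ _ (2%:E * \int[leb2]_(x in N) (hi (enorm x))%:E)%E).
    apply: lee_wpmul2l; first by rewrite lee_fin.
    rewrite [leRHS]integral_indicE; apply: le_integral_ge0 => x _; first by rewrite lee_fin.
    rewrite indicE; case: (boolP (x \in N)) => [_|xN]; first by rewrite mule1.
    rewrite mule0 lee_fin /hi gE indicE memNset ?mulr0//=.
    apply/negP; rewrite -leNgt -lee_fin -ME; apply: contrapT => h; move: xN; rewrite notin_setE; apply.
    by apply: hN => /= h'; apply: h.
  rewrite null_set_integral ?mule0//.
  exact: (@measurable_funS _ _ _ _ setT).
exists (cst (16 * (2 * M))%:E); split; first exact: measurable_cst.
split.
  have := @MaxE_ae R E beta f (cst (2 * M)%:E) b0 b1 hE mf rf.
  apply => r t e r0 Et he.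
  have pi4 : @trigo.pi R / 2 <= 2.
    by have /andP[_ h] := @pihalf_02 R; exact: ltW.
  have mI : measurable (`]0%R, (@trigo.pi R / 2)%R]%classic : set R) by exact: measurable_itv.
  have mhs : measurable_fun (`]0%R, (@trigo.pi R / 2)%R]%classic : set R) (fun p => (hi (sdist r t (e * cos p)))%:E).
    apply: (@measurable_funS _ _ _ _ setT) => //; apply/measurable_EFinP.
    by apply: measurableT_comp => //; exact: measurable_sdist_cos.
  apply: (@le_trans _ _ (\int[mu]_(p in `]0%R, (@trigo.pi R / 2)%R]%classic) (M%:E + (hi (sdist r t (e * cos p)))%:E))%E).
    apply: le_integral_ge0 => p _; first by rewrite lee_fin.
    by rewrite -EFinD lee_fin; exact: ghi.
  have hp p : (`]0%R, (@trigo.pi R / 2)%R]%classic : set R) p -> (0 <= (hi (sdist r t (e * cos p)))%:E)%E.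
    by rewrite lee_fin.
  have cM p : (`]0%R, (@trigo.pi R / 2)%R]%classic : set R) p -> (0 <= M%:E)%E by rewrite lee_fin.
  rewrite ge0_integralD//.
  rewrite -[(2 * M)%:E]adde0; apply: leeD; last exact: (arc_integral_null mhi hi0 hi_null r0 Et he).
  rewrite integral_cst//.
  have muE : mu `]0%R, (@trigo.pi R / 2)%R]%classic = (@trigo.pi R / 2)%:E.
    by rewrite lebesgue_measure_itv/= lte_fin divr_gt0 ?pi_gt0// -EFinB subr0.
  rewrite [X in (_ * X)%E](_ : _ = (@trigo.pi R / 2)%:E)//.
  by rewrite -EFinM lee_fin mulrC; apply: ler_wpM2r.
rewrite -/M0 ME; apply: ge_ereal_inf; exists (16 * (2 * M))%:E.
  by apply: nearW => x /=; rewrite ger0_norm// !mulr_ge0.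
by rewrite -EFinM lee_fin mulrA (_ : 16 * 2 = 32 :> R)//; ring.
Qed.

End PointO.

(** * The vertices satisfy the half-plane conditions *)

Section Geometry2.
Context {R : realType}.
Implicit Types (A B C P : R * R) (a b c : R).

Lemma triangle_affine A B C P (a b c : R) : triangle A B C P ->
  a * A.1 + b * A.2 <= c -> a * B.1 + b * B.2 <= c -> a * C.1 + b * C.2 <= c ->
  a * P.1 + b * P.2 <= c.
Proof.
move=> [l1 [l2 [l3 [h1 h2 h3 hs ->]]]] /= hA hB hC.
have e1 : l1 * (a * A.1 + b * A.2) <= l1 * c by apply: ler_wpM2l.
have e2 : l2 * (a * B.1 + b * B.2) <= l2 * c by apply: ler_wpM2l.
have e3 : l3 * (a * C.1 + b * C.2) <= l3 * c by apply: ler_wpM2l.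
have -> : c = l1 * c + l2 * c + l3 * c by rewrite -!mulrDl hs mul1r.
by move: e1 e2 e3; clear; lra.
Qed.

(* The four half-planes cutting out the region; the last one is void in case (i). *)
Definition admissible (b g : R) (P : R * R) : Prop :=
  [/\ P.2 <= P.1, P.1 <= 2 * P.2, 2 * P.1 - 1 <= (1 - b) * P.2 &
   2 * g * P.1 - b <= 2 * P.2 * (2 * g - b - b * g)].

Lemma admissible_triangle (b g : R) A B C P : triangle A B C P ->
  admissible b g A -> admissible b g B -> admissible b g C -> admissible b g P.
Proof.
move=> T [a1 a2 a3 a4] [b1 b2 b3 b4] [c1 c2 c3 c4]; split.
- suff : - 1 * P.1 + 1 * P.2 <= 0 by lra.
  by apply: (triangle_affine T); lra.
- suff : 1 * P.1 + - 2 * P.2 <= 0 by lra.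
  by apply: (triangle_affine T); lra.
- suff : 2 * P.1 + - (1 - b) * P.2 <= 1 by lra.
  by apply: (triangle_affine T); lra.
- suff : 2 * g * P.1 + - (2 * (2 * g - b - b * g)) * P.2 <= b by lra.
  by apply: (triangle_affine T); lra.
Qed.

Lemma admissible_O (b g : R) : 0 <= b -> admissible b g (@ptO R).
Proof. by move=> b0; split => /=; lra. Qed.

Lemma admissible_scale (b g D x y : R) : 0 < D -> y <= x -> x <= 2 * y -> 2 * x - D <= (1 - b) * y ->
  2 * g * x - b * D <= 2 * y * (2 * g - b - b * g) -> admissible b g (x / D, y / D).
Proof.
move=> D0 h1 h2 h3 h4; split => /=.
- by rewrite ler_pM2r ?invr_gt0.
- by rewrite mulrA ler_pM2r ?invr_gt0.
- rewrite (_ : 2 * (x / D) - 1 = (2 * x - D) / D); last by field; rewrite gt_eqF.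
  by rewrite mulrA ler_pM2r ?invr_gt0.
- rewrite (_ : 2 * g * (x / D) - b = (2 * g * x - b * D) / D); last by field; rewrite gt_eqF.
  by rewrite (_ : 2 * (y / D) * _ = 2 * y * (2 * g - b - b * g) / D) ?ler_pM2r ?invr_gt0//; ring.
Qed.

Lemma admissible_Q1 (b g : R) : 0 <= b -> b < 1 -> b <= g -> admissible b g (Q1 b).
Proof.
move=> b0 b1 bg; rewrite /Q1 -[(1 + b)^-1]mul1r; apply: admissible_scale; [lra|lra|lra|lra|].
by have := mulr_ge0 (_ : 0 <= 1 - b) (_ : 0 <= 2 * g - b); move=> /(_ ltac:(lra) ltac:(lra)); lra.
Qed.

Lemma admissible_Q2 (b g : R) : 0 <= b -> 2 * g <= b + 1 -> admissible b g (Q2 b).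
Proof.
move=> b0 bg; apply: admissible_scale; [lra|lra|lra|lra|].
by have := ler_wpM2l b0 bg; lra.
Qed.

Lemma admissible_Q2' (b g : R) : 0 <= b -> 0 <= g -> b + 1 <= 2 * g -> admissible b g (Q2 (2 * g - 1)).
Proof. by move=> b0 g0 bg; apply: admissible_scale; lra. Qed.

Lemma admissible_Q3 (b g : R) : 0 <= b -> b < 1 -> b + 1 <= 2 * g -> admissible b g (Q3 b g).
Proof.
move=> b0 b1 bg; rewrite /Q3; set t := theta b g.
have gb : 0 < 2 * (g - b) by lra.
have t0 : 0 < t by rewrite divr_gt0//; lra.
have t1 : t <= 1 by rewrite ler_pdivrMr//; lra.
(* The defining property of [theta]: it places [Q3] on the line through [Q1 b] and [Q2 b]. *)
have tE : 2 * (t * g) - 2 * (t * b) = 1 - b.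
  by rewrite /t /theta; field; rewrite subr_eq0 gt_eqF//; lra.
have tb0 : 0 <= b * t by rewrite mulr_ge0// ltW.
have tb1 : b * t <= b by rewrite ler_piMr.
have gt0 : 0 <= g * t by apply: mulr_ge0; lra.
have gtE : g * t = b * t + (1 - b) / 2 by lra.
apply: admissible_scale; [lra|lra|lra|lra|].
have e1 : b * (g * t) = b * (b * t) + b * (1 - b) / 2 by rewrite gtE; ring.
have e2 : g * (b * t) = b * (g * t) by ring.
by rewrite !mulrBr !mulrDr; lra.
Qed.

End Geometry2.

(** * Assembly of the two cases *)

Section Assembly.
Context {R : realType}.
Variables (E : set R) (beta : R).
Hypotheses (E12 : E `<=` `[1, 2]%classic) (b0 : 0 <= beta) (b1 : beta < 1) (hE : minkowski_bound E beta).

Lemma covnum_ge0 (F : set R) (a : R) : (0 <= covnum F a)%E.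
Proof. by apply: le_ereal_inf_tmp => _ [n _ <-]; rewrite lee_fin. Qed.

Lemma covnum_subset (F G : set R) (a : R) : F `<=` G -> (covnum F a <= covnum G a)%E.
Proof.
move=> FG; apply: le_ereal_inf_tmp => _ [n [c hc] <-]; apply: ereal_inf_lbound.
by exists n => //; exists c; exact: subset_trans hc.
Qed.

Lemma assouad_bound_mono (g g' : R) : 0 <= g -> g <= g' -> assouad_bound E g -> assouad_bound E g'.
Proof.
move=> g0 gg [C hC]; exists C => d d01 x y dxy; apply: le_trans (hC d d01 x y dxy).
apply: lee_wpmul2r; first exact: covnum_ge0.
have /andP[d0 _] := d01; have xy : 0 < y - x by exact: lt_le_trans dxy.
by rewrite lee_fin; apply: ger_powR => //; rewrite divr_gt0//= ler_pdivrMr// mul1r.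
Qed.

Lemma assouad_of_minkowski0 : beta = 0 -> assouad_bound E 0.
Proof.
move=> bE; have [C hC] := hE; exists C => d d01 x y _.
have := hC d d01; rewrite bE !powRr0 !mul1e; apply: le_trans.
by apply: covnum_subset => t [].
Qed.

(** If the second coordinate vanishes, so does the first, and the point is [O]; otherwise the strong
    bounds of both regimes apply. The last hypothesis keeps the line [u = 2 v] strictly short of
    [Q2 (2 * g - 1)]. *)
Lemma bounded_rad_admissible (g : R) (P : R * R) : beta < g -> g <= 1 -> assouad_bound E g ->
  admissible beta g P -> (P.1 = 2 * P.2 -> 0 < P.2 -> P.2 * (1 + g) < 1 / 2) -> T_rad E P.
Proof.
move=> bg g1 aE; have b0' := b0; have b1' := b1; case: P => u v [/= h1 h2 h3 h4] hw.
have v0 : 0 <= v by lra.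
have u1 : u <= 1.
  have h : (1 - beta) * v <= (1 - beta) * u by apply: ler_wpM2l => //; lra.
  have h5 : 0 <= beta * u by apply: mulr_ge0; lra.
  by lra.
split=> /=; first by rewrite u1 andbT; lra.
split; first by rewrite v0 (le_trans h1).
have [vz|vn0] := eqVneq v 0.
  have uz : u = 0 by lra.
  by rewrite uz vz; exact: (bounded_rad_O E12 b0 b1 hE).
have vp : 0 < v by rewrite lt_neqAle eq_sym vn0.
have up : 0 < u by exact: lt_le_trans h1.
apply: (bounded_rad_of_arcs b0 b1 hE up vp).
  apply: (@strong_P_all R E beta g E12 b0 b1 _ g1 hE aE u v bg vp h1 u1 h2 h3 h4) => //; first lra.
  by move=> e; exact: hw.
exact: (strong_Q E12 b0 b1 hE vp h1 u1 h3).
Qed.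

Lemma Delta_T_rad (g : R) : beta <= g -> 2 * g < beta + 1 -> assouad_bound E g -> Delta beta `<=` T_rad E.
Proof.
move=> bg g2 aE; have b0' := b0; have b1' := b1.
(* A slightly larger Assouad exponent makes [beta < g'] strict and keeps [2 * g' < beta + 1]. *)
have [g' [gg' bg' g2']] : exists g', [/\ g <= g', beta < g' & 2 * g' < beta + 1].
  by exists ((g + (beta + 1) / 2) / 2); split; lra.
have aE' : assouad_bound E g' by apply: assouad_bound_mono aE => //; lra.
move=> P DP; have adm : admissible beta g' P.
  apply: (admissible_triangle DP); [exact: admissible_O| |].
    by apply: admissible_Q1 => //; exact: ltW.
  by apply: admissible_Q2 => //; exact: ltW.
apply: (@bounded_rad_admissible g') => //; first by have := b1; lra.
case: adm => _ _ h3 _ hP v0; rewrite hP in h3.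
(* On the line [u = 2 v] the third half-plane gives [v (3 + beta) <= 1], and
   [2 + 2 g' < 3 + beta]. *)
have h4 : P.2 * (2 + 2 * g') < P.2 * (3 + beta) by rewrite ltr_pM2l//; lra.
by lra.
Qed.

Lemma Quad_T_rad (g : R) : beta + 1 <= 2 * g -> g <= 1 -> assouad_bound E g ->
  Quad beta g `\` [set Q2 (2 * g - 1)] `<=` T_rad E.
Proof.
move=> bg g1 aE P [QP /= Pn]; have b0' := b0; have b1' := b1.
have g0 : 0 <= g by have := b0; lra.
have adm : admissible beta g P.
  case: QP => QP; apply: (admissible_triangle QP); [exact: admissible_O| | |exact: admissible_O| |].
  - by apply: admissible_Q1 => //; have := b1; lra.
  - exact: admissible_Q3.
  - exact: admissible_Q3.
  - exact: admissible_Q2'.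
(* For [beta = 0] the fourth half-plane reduces to [u <= 2 v] and no longer limits [v (1 + g)]. But
   then the covering numbers are bounded, so any positive Assouad exponent is allowed; [1 / 4] is
   small enough. *)
have [bz|bn0] := eqVneq beta 0.
  have aE' : assouad_bound E (1 / 4).
    by apply: assouad_bound_mono (assouad_of_minkowski0 bz) => //; lra.
  case: adm => h1 h2 h3 _.
  apply: (@bounded_rad_admissible (1 / 4)) => //; [by rewrite bz; lra|lra| |].
    by split => //; rewrite bz; lra.
  by move=> hP v0; rewrite hP bz in h3; lra.
apply: (@bounded_rad_admissible g) => //; first by have := b1; lra.
have bp : 0 < beta by rewrite lt_neqAle eq_sym bn0.
case: adm => h1 h2 h3 h4 hP v0; rewrite hP in h4.
(* On [u = 2 v] the fourth half-plane becomes [v (1 + g) <= 1 / 2], with equality only at the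
   removed vertex. *)
have h5 : beta * (2 * (P.2 * (1 + g))) <= beta * 1 by lra.
rewrite ler_pM2l// in h5.
rewrite lt_neqAle; apply/andP; split; last by lra.
apply/eqP => h6; apply: Pn.
have v2 : P.2 = 1 / (3 + (2 * g - 1)).
  have gn : 3 + (2 * g - 1) != 0 by rewrite gt_eqF//; lra.
  by apply: (mulIf gn); rewrite divfK//; lra.
by case: P hP v2 {h1 h2 h3 h4 h5 h6 QP v0} => u v /= -> ->; rewrite /Q2; congr (_, _); rewrite mulrA mulr1.
Qed.

Lemma restricted_weak_Q2 (g : R) : beta + 1 <= 2 * g -> g <= 1 -> assouad_bound E g ->
  restricted_weak_rad E (Q2 (2 * g - 1)).1^-1 (Q2 (2 * g - 1)).2^-1.
Proof.
move=> bg g1 aE; have g0 : 0 < 1 + g by have := b0; lra.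
have e1 : (Q2 (2 * g - 1)).1 = (1 + g)^-1.
  by rewrite /Q2/=; field; rewrite !gt_eqF//; lra.
have e2 : (Q2 (2 * g - 1)).2 = (1 + g)^-1 / 2.
  by rewrite /Q2/=; field; rewrite !gt_eqF//; lra.
rewrite e1 e2.
have u0 : 0 < (1 + g)^-1 by rewrite invr_gt0.
apply: (restricted_weak_of_arcs E12 b0 b1 hE) => //; first by rewrite divr_gt0.
  by apply: weak_P => //; have := b0; lra.
exact: (weak_Q E12 b0 b1 bg g1 hE).
Qed.

End Assembly.

Theorem theorem1p6 (R : realType) (E : set R) (beta gamma : R) :
  E `<=` `[1, 2]%classic ->
  0 <= beta -> beta < 1 -> beta <= gamma -> gamma <= 1 ->
  (exists C : R, forall delta : R, 0 < delta < 1 ->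
     ((delta `^ beta)%:E * covnum E delta <= C%:E)%E) ->
  (exists C : R, forall delta : R, 0 < delta < 1 ->
     forall a b : R, delta <= b - a ->
     (((delta / (b - a)) `^ gamma)%:E * covnum (E `&` `[a, b]%classic) delta
        <= C%:E)%E) ->
  (2 * gamma < beta + 1 -> Delta beta `<=` T_rad E) /\
  (beta + 1 <= 2 * gamma ->
     Quad beta gamma `\` [set Q2 (2 * gamma - 1)] `<=` T_rad E /\
     restricted_weak_rad E (Q2 (2 * gamma - 1)).1^-1 (Q2 (2 * gamma - 1)).2^-1).
Proof.
move=> E12 b0 b1 bg g1 hE aE; split=> [h|h]; first exact: (Delta_T_rad E12 b0 b1 hE bg h aE).
by split; [exact: (Quad_T_rad E12 b0 b1 hE h g1 aE)|exact: (restricted_weak_Q2 E12 b0 b1 hE h g1 aE)].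
Qed.
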